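(* Let $r\ge1$ and let $N$ be a nonzero proper ideal of $A$. The action of $\mathrm{GL}_r(A/N)$ on $M_{A,K(N)}^r(\mathbb C_\infty)$ and on $\mathcal L_N^r$ induces an action of $(A/N)^\times$ on the irreducible components of $M_{A,K(N)}^r(\mathbb C_\infty)$ and of $\mathcal L_N^r$ via $[\gamma]\mapsto[\det\gamma^{-1}]$, with kernel $\mathbb F_q^\times$, which leaves the ideal class $\pi_N(C)$ of each component $C$ unchanged. That is: each $[\gamma]$ ($\gamma\in\mathrm{GL}_r(\hat A)$) maps irreducible components to irreducible components, taking a component $C$ to the component with $\det([\gamma]C)=\det(C)\cdot[\det\gamma^{-1}]$; this permutation depends only on the class of $\det\gamma$ in $(A/N)^\times$; it is trivial precisely when that class lies in $\mathbb F_q^\times\subseteq(A/N)^\times$; and $\pi_N([\gamma]C)=\pi_N(C)$.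
   Context: $F$ is a global function field of prime characteristic with field of constants $\mathbb F_q$; $\infty$ is a fixed place of $F$; $A\subset F$ is the ring of elements regular away from $\infty$; $F_\infty$ is the completion of $F$ at $\infty$ and $\mathbb C_\infty$ is the completion of an algebraic closure of $F_\infty$. $\hat A$ is the profinite completion of $A$, $\mathbb A_F^{fin}$ is the ring of finite adeles of $F$ (away from $\infty$), $K(N)=\ker(\mathrm{GL}_r(\hat A)\to\mathrm{GL}_r(A/N))$, so $\mathrm{GL}_r(A/N)\cong\mathrm{GL}_r(\hat A)/K(N)$; $[\gamma]$ is the class of $\gamma\in\mathrm{GL}_r(\hat A)$. $\mathrm{Cl}(F)$ is the group of nonzero fractional ideals of $A$ modulo principal ones. $\Psi^r\subset\mathbb C_\infty^r$ is the set of row vectors with $F_\infty$-linearly independent entries, $\Omega^r=\Psi^r/\mathbb C_\infty^\times$. The moduli space $M_{A,K(N)}^r(\mathbb C_\infty)$ (isomorphism classes of lattices of rank $r$ in $\mathbb C_\infty$ with level $N$ structure) is identified with $\mathrm{GL}_r(F)\backslash(\Omega^r\times\mathrm{GL}_r(\mathbb A_F^{fin})/K(N))$, and $\mathcal L_N^r$ (lattices $\Lambda\subset\mathbb C_\infty$ of rank $r$ with level $N$ structure, i.e. an isomorphism $(N^{-1}/A)^r\to N^{-1}\Lambda/\Lambda$) is identified with $\mathrm{GL}_r(F)\backslash(\Psi^r\times\mathrm{GL}_r(\mathbb A_F^{fin})/K(N))$, where $f\in\mathrm{GL}_r(F)$, $k\in K(N)$ act by $f(\psi,g)k=(\psi f^{-1},fgk)$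 (likewise for $\omega\in\Omega^r$); the class of $(\psi,g)$ corresponds to the lattice $\psi(F^r\cap g\hat A^r)$ with the level structure induced by $g$. $[\gamma]\in\mathrm{GL}_r(A/N)$ acts by $[\gamma][(\omega,g)]=[(\omega,g\gamma^{-1})]$ and $[\gamma][(\psi,g)]=[(\psi,g\gamma^{-1})]$ for $\gamma\in\mathrm{GL}_r(\hat A)$. The irreducible components of both spaces are the fibres of $\det:[(\omega,g)]\mapsto[\det g]$, resp. $[(\psi,g)]\mapsto[\det g]$, with values in the group $F^\times\backslash(\mathbb A_F^{fin})^\times/\det K(N)$; write $\det(C)$ for the value on a component $C$. $\pi_N(C)\in\mathrm{Cl}(F)$ is the class of $\prod_{\mathfrak p}\mathfrak p^{v_{\mathfrak p}(x)}$ where $\det(C)=[x]$ ($\mathfrak p$ over nonzero primes of $A$). *)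

(* Defs.v *)
From HB Require Import structures.
From mathcomp Require Import all_boot all_order all_algebra all_field.
From mathcomp Require Import fraction generic_quotient ring_quotient.
From mathcomp Require Import boolp classical_sets cardinality fsbigop.

Set Implicit Arguments.
Unset Strict Implicit.
Unset Printing Implicit Defensive.

Import Order.TTheory GRing.Theory Num.Theory.

Local Open Scope classical_set_scope.
Local Open Scope quotient_scope.
Local Open Scope ring_scope.

(** * Units of a ring; GL_r *)

Record unit_of (R : pzRingType) := UnitOf {
  uval :> R;
  uinv : R;
  uvalK : uval * uinv = 1;
  uinvK : uinv * uval = 1 }.

Definition GL (r : nat) (R : pzRingType) := unit_of 'M[R]_r.

Definition GLmx r (R : pzRingType) (g : GL r R) : 'M[R]_r := uval g.

HB.instance Definition _ (R : pzRingType) := gen_eqMixin (unit_of R).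
HB.instance Definition _ (R : pzRingType) := gen_choiceMixin (unit_of R).

Section UnitGroup.
Variable R : pzRingType.
Implicit Types u v w : unit_of R.

Lemma unit_inj u v : uval u = uval v -> u = v.
Proof.
case: u v => [x x' xx' x'x] [y y' yy' y'y] /= exy; subst y.
have e : x' = y' by rewrite -[x']mulr1 -yy' mulrA x'x mul1r.
by subst y'; congr UnitOf; exact: Prop_irrelevance.
Qed.

Definition unit_one : unit_of R := UnitOf (mulr1 1) (mulr1 1).

Lemma unit_mulK u v : (uval u * uval v) * (uinv v * uinv u) = 1.
Proof. by rewrite mulrA -(mulrA (uval u)) uvalK mulr1 uvalK. Qed.

Lemma unit_mulVK u v : (uinv v * uinv u) * (uval u * uval v) = 1.
Proof. by rewrite mulrA -(mulrA (uinv v)) uinvK mulr1 uinvK. Qed.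

Definition unit_mul u v : unit_of R := UnitOf (unit_mulK u v) (unit_mulVK u v).

Definition unit_inv u : unit_of R := UnitOf (uinvK u) (uvalK u).

Lemma unit_mulA : associative unit_mul.
Proof. by move=> u v w; apply: unit_inj; rewrite /= mulrA. Qed.
Lemma unit_mul1 : left_id unit_one unit_mul.
Proof. by move=> u; apply: unit_inj; rewrite /= mul1r. Qed.
Lemma unit_mulr1 : right_id unit_one unit_mul.
Proof. by move=> u; apply: unit_inj; rewrite /= mulr1. Qed.
Lemma unit_mulV : left_inverse unit_one unit_inv unit_mul.
Proof. by move=> u; apply: unit_inj; rewrite /= uinvK. Qed.
Lemma unit_mulrV : right_inverse unit_one unit_inv unit_mul.
Proof. by move=> u; apply: unit_inj; rewrite /= uvalK. Qed.

HB.instance Definition _ := isGroup.Build (unit_of R)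
  unit_mulA unit_mul1 unit_mulr1 unit_mulV unit_mulrV.

Lemma uvalM u v : uval (u * v)%g = uval u * uval v. Proof. by []. Qed.
Lemma uval1 : uval (1%g : unit_of R) = 1. Proof. by []. Qed.
Lemma uvalV u : uval (u^-1)%g = uinv u. Proof. by []. Qed.

End UnitGroup.

Section UnitMap.
Variables (R S : pzRingType) (f : {rmorphism R -> S}).

Lemma unit_mapK (u : unit_of R) : f (uval u) * f (uinv u) = 1.
Proof. by rewrite -rmorphM uvalK rmorph1. Qed.
Lemma unit_mapVK (u : unit_of R) : f (uinv u) * f (uval u) = 1.
Proof. by rewrite -rmorphM uinvK rmorph1. Qed.

Definition unit_map (u : unit_of R) : unit_of S :=
  UnitOf (unit_mapK u) (unit_mapVK u).

Lemma unit_mapM u v : unit_map (u * v)%g = (unit_map u * unit_map v)%g.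
Proof. by apply: unit_inj; rewrite /= rmorphM. Qed.
Lemma unit_map1 : unit_map 1%g = 1%g.
Proof. by apply: unit_inj; rewrite /= rmorph1. Qed.
Lemma unit_mapV u : unit_map (u^-1)%g = (unit_map u)^-1%g.
Proof. by apply: unit_inj. Qed.

End UnitMap.

Definition GL_map r (R S : pzRingType) (f : {rmorphism R -> S}) :
  GL r R -> GL r S := unit_map (map_mx f : {rmorphism 'M[R]_r -> 'M[S]_r}).

Section GLMap.
Variables (r : nat) (R S : pzRingType) (f : {rmorphism R -> S}).
Implicit Types g h : GL r R.
Lemma GL_mapM g h : GL_map f (g * h)%g = (GL_map f g * GL_map f h)%g.
Proof. exact: unit_mapM. Qed.
Lemma GL_map1 : GL_map f (1%g : GL r R) = 1%g.
Proof. exact: unit_map1. Qed.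
Lemma GL_mapV g : GL_map f (g^-1)%g = (GL_map f g)^-1%g.
Proof. exact: unit_mapV. Qed.
End GLMap.

Section DetUnit.
Variables (r : nat) (R : comPzRingType).

Lemma det_unitK (g : GL r R) : \det (uval g) * \det (uinv g) = 1.
Proof. by rewrite -det_mulmx (uvalK g : _ *m _ = 1%:M) det1. Qed.
Lemma det_unitVK (g : GL r R) : \det (uinv g) * \det (uval g) = 1.
Proof. by rewrite -det_mulmx (uinvK g : _ *m _ = 1%:M) det1. Qed.

Definition det_GL (g : GL r R) : unit_of R :=
  UnitOf (det_unitK g) (det_unitVK g).

Lemma det_GLM g h : det_GL (g * h)%g = (det_GL g * det_GL h)%g.
Proof. by apply: unit_inj; rewrite /= det_mulmx. Qed.
Lemma det_GL1 : det_GL 1%g = 1%g.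
Proof. by apply: unit_inj; rewrite /= det1. Qed.
Lemma det_GLV g : det_GL (g^-1)%g = (det_GL g)^-1%g.
Proof. by apply: unit_inj. Qed.
Lemma unit_mulC (u v : unit_of R) : (u * v)%g = (v * u)%g.
Proof. by apply: unit_inj; rewrite /= mulrC. Qed.

End DetUnit.

Lemma det_GL_map r (R S : comPzRingType) (f : {rmorphism R -> S}) (g : GL r R) :
  det_GL (GL_map f g) = unit_map f (det_GL g).
Proof. by apply: unit_inj; rewrite /= det_map_mx. Qed.

(** * Valuations and completions *)

(* Additive valuations; the value v(0) = +oo is encoded by the junk value 0
   together with the predicate [vge], so that equality of records is equality
   of valuations. *)
Record valuation (K : fieldType) (G : realDomainType) := Valuation {
  vfun :> K -> G;
  v0 : vfun 0 = 0;
  vM : forall x y, x != 0 -> y != 0 -> vfun (x * y) = vfun x + vfun y;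
  vD : forall x y, x != 0 -> y != 0 -> x + y != 0 ->
    Num.min (vfun x) (vfun y) <= vfun (x + y) }.

Definition vge K G (v : valuation K G) (n : G) (x : K) : Prop :=
  x = 0 \/ n <= v x.

(* Metric completion: complete, with K densely embedded and the valuation
   extended.  Only used for G = int and G = rat, where sequences suffice. *)
Record completion (K : fieldType) (G : realDomainType) (v : valuation K G) :=
  Completion {
  cfield :> fieldType;
  cemb : {rmorphism K -> cfield};
  cval : valuation cfield G;
  cval_ext : forall x, cval (cemb x) = v x;
  c_dense : forall (y : cfield) (n : G), exists x, vge cval n (y - cemb x);
  c_complete : forall u : nat -> cfield,
    (forall n : G, exists m : nat, forall i j : nat,
       (m <= i)%N -> (m <= j)%N -> vge cval n (u i - u j)) ->
    exists l, forall n : G, exists m : nat, forall i : nat,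
       (m <= i)%N -> vge cval n (u i - l) }.

Record algebraic_closure (K : fieldType) := AlgebraicClosure {
  acfield :> fieldType;
  acemb : {rmorphism K -> acfield};
  ac_closed : GRing.closed_field_axiom acfield;
  ac_algebraic : forall x, algebraicOver acemb x }.

(* The completion of an algebraic closure of a discretely valued field for
   the (rational valued) extension of its valuation. *)
Record completed_closure (K : fieldType) (v : valuation K int) :=
  CompletedClosure {
  cc_closure : algebraic_closure K;
  cc_val : valuation cc_closure rat;
  cc_val_ext : forall x, cc_val (acemb cc_closure x) = (v x)%:~R;
  cc_field :> completion cc_val }.

Section ValuationTheory.
Variables (K : fieldType) (G : realDomainType) (v : valuation K G).

Lemma v_1 : v 1 = 0.
Proof.
have := vM v (oner_neq0 K) (oner_neq0 K); rewrite mulr1 => /eqP.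
by rewrite addrC -subr_eq subrr => /eqP.
Qed.

Lemma v_N1 : v (-1) = 0.
Proof.
have n0 : (-1 : K) != 0 by rewrite oppr_eq0 oner_eq0.
have := vM v n0 n0; rewrite mulrNN mulr1 v_1 => /esym/eqP.
by rewrite -mulr2n mulrn_eq0 /= => /eqP.
Qed.

Lemma vge0_0 : vge v 0 0. Proof. by left. Qed.
Lemma vge0_1 : vge v 0 1. Proof. by right; rewrite v_1. Qed.

Lemma vge0M x y : vge v 0 x -> vge v 0 y -> vge v 0 (x * y).
Proof.
have [->|x0] := eqVneq x 0; first by rewrite mul0r; left.
have [->|y0] := eqVneq y 0; first by rewrite mulr0; left.
case=> [/eqP|hx]; first by rewrite (negPf x0).
case=> [/eqP|hy]; first by rewrite (negPf y0).
by right; rewrite vM // addr_ge0.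
Qed.

Lemma vge0B x y : vge v 0 x -> vge v 0 y -> vge v 0 (x - y).
Proof.
have [->|x0] := eqVneq x 0.
  by move=> _ hy; rewrite sub0r -mulN1r; apply: vge0M hy; right; rewrite v_N1.
have [->|y0] := eqVneq y 0; first by rewrite subr0.
case=> [/eqP|hx]; first by rewrite (negPf x0).
case=> [/eqP|hy]; first by rewrite (negPf y0).
have [->|xy0] := eqVneq (x - y) 0; first by left.
have Ny0 : - y != 0 by rewrite oppr_eq0.
right; apply: le_trans (vD v x0 Ny0 xy0).
rewrite le_min hx -mulN1r vM ?oppr_eq0 ?oner_eq0 //.
by rewrite v_N1 add0r.
Qed.

End ValuationTheory.

(** * The function field, its places and the ring A *)

Section Places.
Variable F : fieldType.

(* Normalized discrete valuations of F; they are automatically trivial on the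
   (finite) field of constants. *)
Record place := Place {
  pval :> valuation F int;
  pval_norm : exists2 x, x != 0 & pval x = 1 }.

Variable infty : place.

(* The places away from infinity; they correspond to the nonzero primes of A
   through [fprime] below. *)
Definition fplace := {p : place | p <> infty}.
HB.instance Definition _ := gen_eqMixin fplace.
HB.instance Definition _ := gen_choiceMixin fplace.

Definition regular : {pred F} :=
  [pred x | `[< forall p : place, p <> infty -> vge p 0 x >]].

Lemma regular_subring : subring_closed regular.
Proof.
split.
- by apply/asboolP => p _; exact: vge0_1.
- move=> x y /asboolP hx /asboolP hy; apply/asboolP => p hp.
  by apply: vge0B; [apply: hx | apply: hy].
- move=> x y /asboolP hx /asboolP hy; apply/asboolP => p hp.
  by apply: vge0M; [apply: hx | apply: hy].
Qed.

Record Aring := MkA { Aval :> F; AvalP : Aval \in regular }.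
HB.instance Definition _ := [isSub for Aval].
HB.instance Definition _ := [Choice of Aring by <:].
HB.instance Definition _ :=
  GRing.SubChoice_isSubComNzRing.Build F regular Aring regular_subring.

End Places.

Section Constants.
Variables (k : finFieldType) (F : fieldExtType {fraction {poly k}}).

(* k -> k[T] -> k(T) -> F *)
Definition constF (c : k) : F := (tofrac (c%:P))%:A.

Definition is_constant_field : Prop :=
  forall x : F, algebraicOver constF x -> exists c, x = constF c.

Lemma constM (c d : k) : constF (c * d) = constF c * constF d.
Proof. by rewrite /constF polyCM rmorphM /= -[LHS]in_algE rmorphM. Qed.

Lemma const1 : constF 1 = 1.
Proof. by rewrite /constF polyC1 rmorph1 scale1r. Qed.

Lemma const0 : constF 0 = 0.
Proof. by rewrite /constF polyC0 rmorph0 scale0r. Qed.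

Lemma v_const (v : valuation F int) (c : k) : v (constF c) = 0.
Proof.
have [->|c0] := eqVneq c 0; first by rewrite const0 v0.
have cn0 (d : k) : d != 0 -> constF d != 0.
  by move=> d0; apply/eqP => e; have := const1;
     rewrite -(divff d0) constM e mul0r => /esym/eqP; rewrite oner_eq0.
have vX n : v (constF (c ^+ n)) = v (constF c) *+ n.
  elim: n => [|n IH]; first by rewrite expr0 const1 v_1 mulr0n.
  by rewrite exprS constM vM ?cn0 ?expf_neq0 // IH mulrS.
have := vX #|k|; rewrite expf_card; case: #|k| (finNzRing_gt1 k) => [|[|n]] // _.
rewrite mulrS => /eqP; rewrite addrC -subr_eq subrr eq_sym mulrn_eq0 /=.
by move/eqP.
Qed.

Lemma const_regular (infty : place F) c : constF c \in regular infty.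
Proof. by apply/asboolP => p _; right; rewrite v_const. Qed.

Definition constA (infty : place F) (c : k) : Aring infty :=
  MkA (const_regular infty c).

End Constants.

(** * Finite adeles *)

Section FullProduct.
Variables (I : choiceType) (K : I -> fieldType).

Definition fullprod := forall i, K i.
HB.instance Definition _ := gen_eqMixin fullprod.
HB.instance Definition _ := gen_choiceMixin fullprod.

Definition fp_zero : fullprod := fun i => 0.
Definition fp_one : fullprod := fun i => 1.
Definition fp_opp (x : fullprod) : fullprod := fun i => - x i.
Definition fp_add (x y : fullprod) : fullprod := fun i => x i + y i.
Definition fp_mul (x y : fullprod) : fullprod := fun i => x i * y i.

Lemma fp_addA : associative fp_add.
Proof. by move=> x y z; apply: functional_extensionality_dep => i; exact: addrA. Qed.
Lemma fp_addC : commutative fp_add.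
Proof. by move=> x y; apply: functional_extensionality_dep => i; exact: addrC. Qed.
Lemma fp_add0 : left_id fp_zero fp_add.
Proof. by move=> x; apply: functional_extensionality_dep => i; exact: add0r. Qed.
Lemma fp_addN : left_inverse fp_zero fp_opp fp_add.
Proof. by move=> x; apply: functional_extensionality_dep => i; exact: addNr. Qed.
Lemma fp_mulA : associative fp_mul.
Proof. by move=> x y z; apply: functional_extensionality_dep => i; exact: mulrA. Qed.
Lemma fp_mulC : commutative fp_mul.
Proof. by move=> x y; apply: functional_extensionality_dep => i; exact: mulrC. Qed.
Lemma fp_mul1 : left_id fp_one fp_mul.
Proof. by move=> x; apply: functional_extensionality_dep => i; exact: mul1r. Qed.
Lemma fp_mulD : left_distributive fp_mul fp_add.
Proof. by move=> x y z; apply: functional_extensionality_dep => i; exact: mulrDl. Qed.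

HB.instance Definition _ :=
  GRing.isZmodule.Build fullprod fp_addA fp_addC fp_add0 fp_addN.
HB.instance Definition _ :=
  GRing.Zmodule_isComPzRing.Build fullprod fp_mulA fp_mulC fp_mul1 fp_mulD.

Variables (F : fieldType) (f : forall i, {rmorphism F -> K i}).

Definition diag_emb (x : F) : fullprod := fun i => f i x.

Lemma diagonal_zmod : zmod_morphism diag_emb.
Proof. by move=> x y; apply: functional_extensionality_dep => i; exact: rmorphB. Qed.
Lemma diagonal_monoid : monoid_morphism diag_emb.
Proof.
split=> [|x y]; apply: functional_extensionality_dep => i;
  [exact: rmorph1 | exact: rmorphM].
Qed.
HB.instance Definition _ := GRing.isZmodMorphism.Build F fullprod diag_emb diagonal_zmod.
HB.instance Definition _ := GRing.isMonoidMorphism.Build F fullprod diag_emb diagonal_monoid.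

End FullProduct.

Section Adeles.
Variables (F : fieldType) (infty : place F).
Variable Fv : forall v : place F, completion v.

Local Notation A := (Aring infty).
Local Notation P := (fullprod (fun p : fplace infty => Fv (sval p) : fieldType)).

Definition integral_at (p : fplace infty) (x : P) : Prop :=
  vge (cval (Fv (sval p))) 0 (x p).

Definition adele_pred : {pred P} :=
  [pred x : P | `[< finite_set [set p | ~ integral_at p x] >]].
Definition Ahat_pred : {pred P} :=
  [pred x : P | `[< forall p, integral_at p x >]].

Lemma integralB p x y :
  integral_at p x -> integral_at p y -> integral_at p (x - y).
Proof. exact: vge0B. Qed.
Lemma integralM p x y :
  integral_at p x -> integral_at p y -> integral_at p (x * y).
Proof. exact: vge0M. Qed.

Lemma adele_subring : subring_closed adele_pred.
Proof.
have sub2 (op : P -> P -> P) :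
    (forall p x y, integral_at p x -> integral_at p y -> integral_at p (op x y)) ->
    forall x y, x \in adele_pred -> y \in adele_pred -> op x y \in adele_pred.
  move=> hop x y /asboolP hx /asboolP hy; apply/asboolP.
  have hU : finite_set ([set p | ~ integral_at p x] `|` [set p | ~ integral_at p y]).
    by rewrite finite_setU.
  apply: sub_finite_set hU => p /= hp; apply: contrapT => /not_orP[/contrapT h1 /contrapT h2].
  by apply: hp; exact: hop.
split; [|exact: (sub2 _ integralB)|exact: (sub2 _ integralM)].
apply/asboolP; rewrite (_ : [set p | _] = set0) //.
by apply/seteqP; split=> // p /=; apply; exact: vge0_1.
Qed.

Lemma Ahat_subring : subring_closed Ahat_pred.
Proof.
split.
- by apply/asboolP => p; exact: vge0_1.
- move=> x y /asboolP hx /asboolP hy; apply/asboolP => p.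
  by apply: integralB.
- move=> x y /asboolP hx /asboolP hy; apply/asboolP => p.
  by apply: integralM.
Qed.

(* The restricted product of the F_p with respect to their valuation rings. *)
Record adele := MkAdele { adval :> P; advalP : adval \in adele_pred }.
HB.instance Definition _ := [isSub for adval].
HB.instance Definition _ := [Choice of adele by <:].
HB.instance Definition _ :=
  GRing.SubChoice_isSubComPzRing.Build P adele_pred adele adele_subring.

(* The profinite completion of A, in its usual identification with the product
   of the valuation rings of the F_p. *)
Record Ahat := MkAhat { ahval :> P; ahvalP : ahval \in Ahat_pred }.
HB.instance Definition _ := [isSub for ahval].
HB.instance Definition _ := [Choice of Ahat by <:].
HB.instance Definition _ :=
  GRing.SubChoice_isSubComPzRing.Build P Ahat_pred Ahat Ahat_subring.

Lemma Ahat_adele (x : Ahat) : ahval x \in adele_pred.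
Proof.
have /asboolP h := ahvalP x; apply/asboolP.
by rewrite (_ : [set p | _] = set0) //; apply/seteqP; split=> // p /=; apply.
Qed.

Definition ahat_adele (x : Ahat) : adele := MkAdele (Ahat_adele x).

Lemma ahat_adele_zmod : zmod_morphism ahat_adele.
Proof.
move=> x y; apply: val_inj; rewrite [RHS](raddfB (val : adele -> P)).
exact: (raddfB (val : Ahat -> P)).
Qed.
Lemma ahat_adele_monoid : monoid_morphism ahat_adele.
Proof.
split=> [|x y]; apply: val_inj.
  by rewrite [RHS](rmorph1 (val : adele -> P)); exact: (rmorph1 (val : Ahat -> P)).
rewrite [RHS](rmorphM (val : adele -> P)); exact: (rmorphM (val : Ahat -> P)).
Qed.
HB.instance Definition _ := GRing.isZmodMorphism.Build Ahat adele ahat_adele ahat_adele_zmod.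
HB.instance Definition _ := GRing.isMonoidMorphism.Build Ahat adele ahat_adele ahat_adele_monoid.

Definition advalR : {rmorphism adele -> P} := (val : adele -> P).

(* F embedded diagonally in the full product of the F_p; its image lies in the
   ring of finite adeles. *)
Definition diagF : {rmorphism F -> P} :=
  diag_emb (fun p : fplace infty => cemb (Fv (sval p))).

Lemma A_Ahat (a : A) : diagF (Aval a) \in Ahat_pred.
Proof.
apply/asboolP => p; have /asboolP/(_ (sval p) (svalP p)) := AvalP a.
case=> [->|h]; first by left; rewrite /diagF /= /diag_emb rmorph0.
by right; rewrite /= /diag_emb cval_ext.
Qed.

Definition A_to_Ahat (a : A) : Ahat := MkAhat (A_Ahat a).

Definition idele := unit_of adele.

Definition idele_val (x : idele) (p : fplace infty) : int :=
  cval (Fv (sval p)) (advalR (uval x) p).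

(** * Level structure *)

Variable N : idealr A.

(* The ideal of the profinite completion of A generated by N. *)
Definition NAhat : set Ahat :=
  [set x | exists (m : nat) (a : 'I_m -> A) (y : 'I_m -> Ahat),
     (forall i, a i \in (N : {pred A})) /\ x = \sum_i A_to_Ahat (a i) * y i].

(* The reduction map from the profinite completion of A to A/N: the class of
   any a in A congruent to x. *)
Definition reduce (x : Ahat) : {ideal_quot N} :=
  xget 0 [set c | exists2 a : A, c = \pi_{ideal_quot N} a
                               & NAhat (x - A_to_Ahat a)].

(* The kernel K(N) of GL_r(Ahat) -> GL_r(A/N), the reduction of Ahat having
   kernel NAhat. *)
Definition KN (r : nat) : set (GL r Ahat) :=
  [set g | forall i j, NAhat ((GLmx g - 1%:M) i j)].

Lemma NAhat0 : NAhat 0.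
Proof.
by exists 0%N, (fun=> 0), (fun=> 0); split; [case | rewrite big_ord0].
Qed.

Lemma NAhatD x y : NAhat x -> NAhat y -> NAhat (x + y).
Proof.
move=> [m [a [u [ha ->]]]] [n [b [v [hb ->]]]].
exists (m + n)%N, (fun i => match split i with inl j => a j | inr j => b j end).
exists (fun i => match split i with inl j => u j | inr j => v j end).
split=> [i|]; first by case: (split i).
rewrite big_split_ord /=; congr (_ + _); apply: eq_bigr => i _.
  by rewrite (unsplitK (inl i)).
by rewrite (unsplitK (inr i)).
Qed.

Lemma NAhatM z x : NAhat x -> NAhat (z * x).
Proof.
move=> [m [a [u [ha ->]]]]; exists m, a, (fun i => z * u i); split=> //.
by rewrite mulr_sumr; apply: eq_bigr => i _; rewrite mulrCA.
Qed.

Lemma NAhatN x : NAhat x -> NAhat (- x).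
Proof. by rewrite -mulN1r; exact: NAhatM. Qed.

Lemma NAhat_sum (m : nat) (f : 'I_m -> Ahat) :
  (forall i, NAhat (f i)) -> NAhat (\sum_i f i).
Proof. by move=> h; apply: big_ind => //; [exact: NAhat0 | exact: NAhatD]. Qed.

Lemma NAhat_mulmx r (B M : 'M[Ahat]_r) :
  (forall i j, NAhat (M i j)) -> forall i j, NAhat ((B *m M) i j).
Proof. by move=> h i j; rewrite mxE; apply: NAhat_sum => l; exact: NAhatM. Qed.

Lemma NAhat_mulmxr r (B M : 'M[Ahat]_r) :
  (forall i j, NAhat (M i j)) -> forall i j, NAhat ((M *m B) i j).
Proof.
by move=> h i j; rewrite mxE; apply: NAhat_sum => l; rewrite mulrC; exact: NAhatM.
Qed.

Lemma KN1 r : KN (1%g : GL r Ahat).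
Proof. by move=> i j; rewrite subrr mxE; exact: NAhat0. Qed.

Lemma KNM r (g h : GL r Ahat) : KN g -> KN h -> KN (g * h)%g.
Proof.
move=> hg hh i j.
have -> : GLmx (g * h)%g - 1%:M = GLmx g *m (GLmx h - 1%:M) + (GLmx g - 1%:M).
  by rewrite mulmxBr mulmx1 addrA subrK.
by rewrite mxE; apply: NAhatD => //; apply: NAhat_mulmx => {}i {}j; exact: hh.
Qed.

Lemma KNV r (g : GL r Ahat) : KN g -> KN (g^-1)%g.
Proof.
move=> hg i j.
have -> : GLmx (g^-1)%g - 1%:M = - (GLmx (g^-1)%g *m (GLmx g - 1%:M)).
  by rewrite mulmxBr mulmx1 [GLmx _ *m _](uinvK g) opprB.
by rewrite mxE; apply/NAhatN/NAhat_mulmx => {}i {}j; exact: hg.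
Qed.

Lemma KNJ r (g h : GL r Ahat) : KN g -> KN (h * g * h^-1)%g.
Proof.
move=> hg i j.
have -> : GLmx (h * g * h^-1)%g - 1%:M
        = GLmx h *m (GLmx g - 1%:M) *m GLmx (h^-1)%g.
  by rewrite mulmxBr mulmx1 mulmxBl [GLmx h *m GLmx (h^-1)%g](uvalK h).
by apply: NAhat_mulmxr => {}i {}j; apply: NAhat_mulmx => {}i {}j; exact: hg.
Qed.

End Adeles.

(** * Period domains *)

Record lset (G : groupType) := LSet {
  lsort :> choiceType;
  lact : G -> lsort -> lsort;
  lact1 : forall s, lact 1%g s = s;
  lactM : forall f g s, lact (f * g)%g s = lact f (lact g s) }.

Section PeriodDomains.
Variables (F : fieldType) (infty : place F) (Fi : completion infty).
Variables (C : completed_closure (cval Fi)) (r : nat).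

Definition Fi_to_C : {rmorphism Fi -> C} :=
  (cemb (cc_field C) \o acemb (cc_closure C))%FUN.
Definition F_to_C : {rmorphism F -> C} := (Fi_to_C \o cemb Fi)%FUN.

Definition Psi_pred : {pred 'rV[C]_r} :=
  [pred psi : 'rV[C]_r | `[< forall a : 'cV[Fi]_r,
     psi *m map_mx Fi_to_C a = 0 -> a = 0 >]].

Record Psi := MkPsi { psival :> 'rV[C]_r; psivalP : psival \in Psi_pred }.
HB.instance Definition _ := [isSub for psival].
HB.instance Definition _ := [Choice of Psi by <:].

Lemma Psi_act_subproof (f : GL r F) (psi : Psi) :
  psival psi *m map_mx F_to_C (GLmx (f^-1)%g) \in Psi_pred.
Proof.
apply/asboolP => a; rewrite -mulmxA.
have -> : map_mx F_to_C (GLmx (f^-1)%g)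
        = map_mx Fi_to_C (map_mx (cemb Fi) (GLmx (f^-1)%g)).
  by apply/matrixP => i j; rewrite !mxE.
rewrite -map_mxM => h; have /asboolP/(_ _ h) := psivalP psi.
move=> /(congr1 (mulmx (map_mx (cemb Fi) (GLmx f)))).
rewrite mulmx0 mulmxA -map_mxM [GLmx f *m _](uvalK f).
by rewrite (map_mx1 (cemb Fi)) mul1mx.
Qed.

Definition Psi_act (f : GL r F) (psi : Psi) : Psi :=
  MkPsi (Psi_act_subproof f psi).

Lemma Psi_act1 psi : Psi_act 1%g psi = psi.
Proof.
apply: val_inj; rewrite /= [X in _ *m X](_ : _ = 1%:M) ?mulmx1 //.
exact: (map_mx1 F_to_C).
Qed.

Lemma Psi_actM f g psi : Psi_act (f * g)%g psi = Psi_act f (Psi_act g psi).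
Proof.
by apply: val_inj; rewrite /= -mulmxA -(map_mxM F_to_C).
Qed.

(* The left action f.psi = psi f^-1 of GL_r(F). *)
Definition Psi_lset : lset (GL r F) := LSet Psi_act1 Psi_actM.

Definition homothetic : rel Psi :=
  fun psi psi' => `[< exists2 l : C, l != 0 & psival psi' = l *: psival psi >].

Lemma homothetic_equiv : equiv_class_of homothetic.
Proof.
split=> [x|x y|y x z].
- by apply/asboolP; exists 1; rewrite ?oner_neq0 ?scale1r.
- apply/asboolP/asboolP => -[l l0 e]; exists l^-1; rewrite ?invr_eq0 //;
    by rewrite e scalerA mulVf ?scale1r.
- move=> /asboolP[l l0 e] /asboolP[m m0 e']; apply/asboolP.
  by exists (m * l); rewrite ?mulf_neq0 // e' e scalerA.
Qed.

Canonical homothetic_equiv_rel := EquivRelPack homothetic_equiv.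

Definition Omega := {eq_quot homothetic}.
HB.instance Definition _ := Choice.on Omega.

Definition Omega_act (f : GL r F) (w : Omega) : Omega :=
  \pi_Omega (Psi_act f (repr w)).

Lemma Omega_act_pi f psi : Omega_act f (\pi_Omega psi) = \pi_Omega (Psi_act f psi).
Proof.
rewrite /Omega_act; apply/eqmodP/asboolP.
have /eqmodP/asboolP[l l0 e] : psi = repr (\pi_Omega psi) %[mod Omega].
  by rewrite reprK.
exists l^-1; first by rewrite invr_eq0.
by rewrite /= e -scalemxAl scalerA mulVf ?scale1r.
Qed.

Lemma Omega_act1 w : Omega_act 1%g w = w.
Proof. by rewrite /Omega_act Psi_act1 reprK. Qed.

Lemma Omega_actM f g w : Omega_act (f * g)%g w = Omega_act f (Omega_act g w).
Proof. by rewrite {3}/Omega_act Omega_act_pi -Psi_actM. Qed.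

Definition Omega_lset : lset (GL r F) := LSet Omega_act1 Omega_actM.

End PeriodDomains.

(** * Double coset spaces and their irreducible components *)

Section Moduli.
Variables (F : fieldType) (infty : place F).
Variable Fv : forall v : place F, completion v.
Variables (N : idealr (Aring infty)) (r : nat).

Local Notation A := (Aring infty).
Local Notation adele := (adele infty Fv).
Local Notation Ahat := (Ahat infty Fv).
Local Notation idele := (idele infty Fv).
Local Notation P := (fullprod (fun p : fplace infty => Fv (sval p) : fieldType)).
Local Notation diagF := (diagF infty Fv).
Local Notation advalR := (advalR infty Fv).

Definition Ahat_to_adele : {rmorphism Ahat -> adele} := @ahat_adele F infty Fv.

Variable S : lset (GL r F).

(* (s, g) ~ f (s, g) k = (f s, f g k); the identity of the adelic components is
   one of matrices over the full product of the F_p. *)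
Definition dcoset_rel : rel (S * GL r adele) := fun x y =>
  `[< exists f : GL r F, exists2 k : GL r Ahat, KN N k &
      y.1 = lact f x.1 /\
      GL_map advalR y.2
      = (GL_map diagF f * GL_map advalR (x.2 * GL_map Ahat_to_adele k))%g >].

Lemma dcoset_equiv : equiv_class_of dcoset_rel.
Proof.
have refl : reflexive dcoset_rel.
  move=> x; apply/asboolP; exists 1%g, 1%g; first exact: KN1.
  by rewrite lact1 !GL_map1 mulg1 mul1g.
have sym x y : dcoset_rel x y -> dcoset_rel y x.
  move=> /asboolP[f [k hk [e1 e2]]]; apply/asboolP.
  exists (f^-1)%g, (k^-1)%g; first exact: KNV.
  split; first by rewrite e1 -lactM mulVg lact1.
  rewrite [in RHS]GL_mapM e2 !GL_mapM !GL_mapV.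
  by rewrite -!mulgA mulgV mulg1 mulKg.
split=> // [x y|y x z]; first by apply/idP/idP; exact: sym.
move=> /asboolP[f [k hk [e1 e2]]] /asboolP[g [l hl [e3 e4]]]; apply/asboolP.
exists (g * f)%g, (k * l)%g; first exact: KNM.
split; first by rewrite e3 e1 lactM.
by rewrite e4 [in LHS]GL_mapM e2 !GL_mapM !mulgA.
Qed.

Canonical dcoset_equiv_rel := EquivRelPack dcoset_equiv.

(* GL_r(F) \ (S x GL_r(adeles) / K(N)) *)
Definition moduli := {eq_quot dcoset_rel}.
HB.instance Definition _ := Choice.on moduli.

Definition level_act (gamma : GL r Ahat) (c : moduli) : moduli :=
  \pi_moduli ((repr c).1, ((repr c).2 * GL_map Ahat_to_adele gamma^-1)%g).

Lemma level_act_pi gamma s g :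
  level_act gamma (\pi_moduli (s, g))
  = \pi_moduli (s, (g * GL_map Ahat_to_adele gamma^-1)%g).
Proof.
rewrite /level_act; apply/esym/eqmodP/asboolP.
have /eqmodP/asboolP[f [k hk [e1 e2]]] :
    (s, g) = repr (\pi_moduli (s, g)) %[mod moduli] by rewrite reprK.
exists f, (gamma * k * gamma^-1)%g; first exact: KNJ.
split; first exact: e1.
rewrite /= [in LHS]GL_mapM e2 !GL_mapM !GL_mapV.
by rewrite -!mulgA; rewrite mulKg.
Qed.

Lemma level_act_KN k c : KN N k -> level_act k c = c.
Proof.
move=> hk; rewrite -[in RHS](reprK c); apply/esym/eqmodP/asboolP.
exists 1%g, (k^-1)%g; first exact: KNV.
by rewrite lact1 GL_map1 mul1g.
Qed.

Lemma level_actM gamma delta c :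
  level_act (gamma * delta)%g c = level_act gamma (level_act delta c).
Proof.
rewrite {3}/level_act level_act_pi /level_act invgM.
by rewrite GL_mapM mulgA.
Qed.

(* F^x \ ideles / det K(N) *)
Definition idele_rel : rel idele := fun x y =>
  `[< exists f : unit_of F, exists2 k : GL r Ahat, KN N k &
      unit_map advalR y
      = (unit_map diagF f
         * unit_map advalR (x * unit_map Ahat_to_adele (det_GL k)))%g >].

Lemma idele_equiv : equiv_class_of idele_rel.
Proof.
have refl : reflexive idele_rel.
  move=> x; apply/asboolP; exists 1%g, 1%g; first exact: KN1.
  by rewrite det_GL1 !unit_map1 mulg1 mul1g.
have sym x y : idele_rel x y -> idele_rel y x.
  move=> /asboolP[f [k hk e]]; apply/asboolP.
  exists (f^-1)%g, (k^-1)%g; first exact: KNV.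
  rewrite unit_mapM e det_GLV !unit_mapM !unit_mapV.
  by rewrite -!mulgA mulgV mulg1 mulKg.
split=> // [x y|y x z]; first by apply/idP/idP; exact: sym.
move=> /asboolP[f [k hk e]] /asboolP[g [l hl e']]; apply/asboolP.
exists (g * f)%g, (k * l)%g; first exact: KNM.
by rewrite e' [in LHS]unit_mapM e det_GLM !unit_mapM !mulgA.
Qed.

Canonical idele_equiv_rel := EquivRelPack idele_equiv.

Definition idele_class := {eq_quot idele_rel}.
HB.instance Definition _ := Choice.on idele_class.

Definition icl (x : idele) : idele_class := \pi_idele_class x.

Lemma icl_mul x x' y y' :
  icl x = icl x' -> icl y = icl y' -> icl (x * y)%g = icl (x' * y')%g.
Proof.
move=> /eqmodP/asboolP[f [k hk e]] /eqmodP/asboolP[g [l hl e']].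
apply/eqmodP/asboolP; exists (f * g)%g, (k * l)%g; first exact: KNM.
rewrite [LHS]unit_mapM e e' det_GLM !unit_mapM.
set a := unit_map _ f; set b := unit_map _ x; set c := unit_map _ (unit_map _ _).
set d := unit_map _ g; set m := unit_map _ y; set n := unit_map _ (unit_map _ _).
have ac (u v w : unit_of P) : (u * (v * w) = v * (u * w))%g.
  by rewrite !mulgA (unit_mulC u).
by rewrite -!mulgA (ac d b) (ac m c) (ac d c).
Qed.

Lemma icl_inv x x' : icl x = icl x' -> icl x^-1%g = icl x'^-1%g.
Proof.
move=> /eqmodP/asboolP[f [k hk e]]; apply/eqmodP/asboolP.
exists (f^-1)%g, (k^-1)%g; first exact: KNV.
rewrite [LHS]unit_mapV e det_GLV !unit_mapM !unit_mapV !invgM.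
by rewrite unit_mulC; congr (_ * _)%g; rewrite unit_mulC.
Qed.

Definition idele_class_mul (a b : idele_class) := icl (repr a * repr b)%g.
Definition idele_class_inv (a : idele_class) := icl (repr a)^-1%g.

Lemma icl_repr x : icl (repr (icl x)) = icl x. Proof. exact: reprK. Qed.

Lemma iclM x y : icl (x * y)%g = idele_class_mul (icl x) (icl y).
Proof. by apply: icl_mul; rewrite icl_repr. Qed.

Lemma idele_class_mulA : associative idele_class_mul.
Proof.
move=> a b c; rewrite -[a]reprK -[b]reprK -[c]reprK.
by rewrite -![\pi _]/(icl _) -!iclM mulgA.
Qed.
Lemma idele_class_mul1 : left_id (icl 1%g) idele_class_mul.
Proof. by move=> a; rewrite -[a]reprK -![\pi _]/(icl _) -iclM mul1g. Qed.
Lemma idele_class_mulr1 : right_id (icl 1%g) idele_class_mul.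
Proof. by move=> a; rewrite -[a]reprK -![\pi _]/(icl _) -iclM mulg1. Qed.
Lemma idele_class_mulV : left_inverse (icl 1%g) idele_class_inv idele_class_mul.
Proof.
move=> a; rewrite -[in X in idele_class_mul _ X](reprK a) -[\pi _]/(icl _) -iclM.
by rewrite mulVg.
Qed.
Lemma idele_class_mulrV : right_inverse (icl 1%g) idele_class_inv idele_class_mul.
Proof.
move=> a; rewrite -[in X in idele_class_mul X _](reprK a) -[\pi _]/(icl _) -iclM.
by rewrite mulgV.
Qed.

HB.instance Definition _ := isGroup.Build idele_class idele_class_mulA
  idele_class_mul1 idele_class_mulr1 idele_class_mulV idele_class_mulrV.

Definition det_class (c : moduli) : idele_class := icl (det_GL (repr c).2).

Lemma det_class_pi s g : det_class (\pi_moduli (s, g)) = icl (det_GL g).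
Proof.
rewrite /det_class; apply/esym/eqmodP/asboolP.
have /eqmodP/asboolP[f [k hk [_ /= e]]] :
    (s, g) = repr (\pi_moduli (s, g)) %[mod moduli] by rewrite reprK.
exists (det_GL f), k => //.
by rewrite -!det_GL_map e !GL_mapM !det_GLM unit_mapM !det_GL_map.
Qed.

(* An irreducible component: a (nonempty) fibre of the determinant map. *)
Record component := Component {
  cset :> set moduli;
  csetP : exists c, cset = [set c' | det_class c' = det_class c] }.

Definition comp_det (D : component) : idele_class :=
  det_class (sval (cid (csetP D))).

Lemma comp_detE (D : component) c : cset D c -> det_class c = comp_det D.
Proof. by rewrite /comp_det; case: cid => c' /= ->. Qed.

(** * Ideal classes *)

Definition fprime (p : fplace infty) : set F :=
  [set x | x \in regular infty /\ vge (sval p) 1 x].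

Definition fid_mul (I J : set F) : set F :=
  [set x | exists (m : nat) (a b : 'I_m -> F),
     (forall i, I (a i) /\ J (b i)) /\ x = \sum_i a i * b i].

Definition fid_one : set F := [set x | x \in regular infty].

Definition fid_inv (I : set F) : set F :=
  [set x | forall y, I y -> x * y \in regular infty].

Definition fid_pow (I : set F) (n : int) : set F :=
  match n with
  | Posz m => iter m (fid_mul I) fid_one
  | Negz m => iter m.+1 (fid_mul (fid_inv I)) fid_one
  end.

Definition fprincipal (f : F) : set F := [set f * a | a in fid_one].

(* prod_p p^(v_p(x)) *)
Definition idele_ideal (x : idele) : set F :=
  \big[fid_mul/fid_one]_(p \in [set: fplace infty]) fid_pow (fprime p) (idele_val x p).

(* The class of a fractional ideal I in Cl(F), as the coset of I modulo the
   nonzero principal fractional ideals. *)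
Definition ideal_class (I : set F) : set (set F) :=
  [set J | exists2 f : F, f != 0 & J = fid_mul (fprincipal f) I].

Definition pi_N (D : component) : set (set F) :=
  ideal_class (idele_ideal (repr (comp_det D))).

End Moduli.

(* Main.v *)
Require Import Defs.
From HB Require Import structures.
From mathcomp Require Import all_boot all_order all_algebra all_field.
From mathcomp Require Import fraction generic_quotient ring_quotient.
From mathcomp Require Import boolp classical_sets cardinality fsbigop.
From mathcomp Require Import zify ring.

(** Each [gamma] multiplies the determinant of a point of the moduli space by
    [det gamma^-1], so it carries the fibre over [d] onto the fibre over
    [d * [det gamma^-1]] ([translate_fibre]).  Everything therefore reduces to
    two questions about the image of the integral unit [u = det gamma^-1] in
    the idele class group modulo [det K(N)]: when is it trivial, and what does
    it do to the ideal of an idele.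

    The class of [u] is trivial iff [u = f w] with [f] in [F^x] and [w] in
    [det K(N)]; the latter is the group of integral units congruent to 1 modulo
    N, as diagonal matrices show ([det_KN_onto]) and as reduction modulo N
    commutes with determinants ([KN_det]).  Then [f] has valuation 0 at every
    place but infinity.  If it were not constant, [f] and [f^-1] would both
    have a pole ([regular_everywhere]), necessarily at infinity, which is
    absurd.  So the trivial classes are those of the constants modulo N
    ([cls_unit_trivial]).  Multiplying an idele by [u] leaves its valuations
    unchanged, so two representatives of the old and of the new determinant
    have valuations differing by those of an element of [F^x], and ideals
    differing by a principal one ([ideal_class_idele]).  That every unit of A/N
    comes from an integral unit is [unit_lift], and that there are components
    at all is [Psi_nonempty].

    These arguments rest on the arithmetic of [F], developed from the axioms of
    places alone.  The source of all finiteness is [bounded_dim]: for each [x]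
    there is a bound on the size of a family independent over [k[x]], by
    counting the elements of [F] with polynomial coordinates of bounded degree
    over [k(T)].  A family that is k-independent modulo [y R], for a k-subalgebra
    [R] containing [y], is independent over [k[y]] ([indep_mod]).  With different
    rings [R] this shows that an element has finitely many zeros ([finite_zeros]), that residue
    fields are algebraic over [k] ([residue_root_of_unity]), that the maximal
    subalgebras containing [y] but not [y^-1] are discrete valuation rings
    (hence [exists_zero]), and it bounds the poles away from infinity well
    enough to produce, by the pigeonhole principle, an element whose only pole
    is infinity ([exists_pole_only_at_infty]).  From the latter and weak
    approximation follows [strong_approximation]: prescribed values at finitely
    many places, integrality at all others but infinity.

    Strong approximation replaces the theory of Dedekind domains.  It makes
    membership in [N] and in its closure in the integral adeles one and the
    same system of local inequalities ([ideal_local]), whence [reduce] is a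
    ring morphism onto A/N with the expected kernel; and it shows that
    fractional ideals given by exponents multiply by adding the exponents
    ([ideal_of_mul]), whence the ideal of an idele is the set of elements with
    at least its valuations ([idele_idealE]). *)

Set Implicit Arguments.
Unset Strict Implicit.
Unset Printing Implicit Defensive.

Import Order.TTheory GRing.Theory Num.Theory.

Local Open Scope classical_set_scope.
Local Open Scope quotient_scope.
Local Open Scope ring_scope.

(** * Valuations *)

Section Valuations.
Variables (K : fieldType) (G : realDomainType) (v : valuation K G).
Implicit Types (x y : K) (a b : G).

(** The strict counterpart of [vge]: 0 has infinite valuation. *)
Definition vgt a x := x = 0 \/ a < v x.

Lemma vgeE a x : x != 0 -> vge v a x -> a <= v x.
Proof. by move=> x0 [/eqP|//]; rewrite (negPf x0). Qed.

Lemma vgtE a x : x != 0 -> vgt a x -> a < v x.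
Proof. by move=> x0 [/eqP|//]; rewrite (negPf x0). Qed.

Lemma vge_le a b x : a <= b -> vge v b x -> vge v a x.
Proof. by move=> ab [->|/(le_trans ab)]; [left | right]. Qed.

Lemma vgt_ge a b x : a < b -> vge v b x -> vgt a x.
Proof. by move=> ab [->|/(lt_le_trans ab)]; [left | right]. Qed.

Lemma vge_v x : vge v (v x) x. Proof. by right. Qed.

Lemma vN x : v (- x) = v x.
Proof.
have [->|x0] := eqVneq x 0; first by rewrite oppr0.
by rewrite -mulN1r vM ?oppr_eq0 ?oner_eq0 // v_N1 add0r.
Qed.

Lemma vgeN a x : vge v a x -> vge v a (- x).
Proof. by case=> [->|h]; [left; rewrite oppr0 | right; rewrite vN]. Qed.

Lemma vgeD a x y : vge v a x -> vge v a y -> vge v a (x + y).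
Proof.
case=> [->|hx]; first by rewrite add0r.
case=> [->|hy]; first by rewrite addr0; right.
have [->|x0] := eqVneq x 0; first by rewrite add0r; right.
have [->|y0] := eqVneq y 0; first by rewrite addr0; right.
have [->|xy0] := eqVneq (x + y) 0; first by left.
by right; apply: le_trans (vD v x0 y0 xy0); rewrite le_min hx.
Qed.

Lemma vgeB a x y : vge v a x -> vge v a y -> vge v a (x - y).
Proof. by move=> hx /vgeN; exact: vgeD. Qed.

Lemma vgtD a x y : vgt a x -> vgt a y -> vgt a (x + y).
Proof.
case=> [->|hx]; first by rewrite add0r.
case=> [->|hy]; first by rewrite addr0; right.
have [->|x0] := eqVneq x 0; first by rewrite add0r; right.
have [->|y0] := eqVneq y 0; first by rewrite addr0; right.
have [->|xy0] := eqVneq (x + y) 0; first by left.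
by right; apply: lt_le_trans (vD v x0 y0 xy0); rewrite lt_min hx.
Qed.

Lemma vgtN a x : vgt a x -> vgt a (- x).
Proof. by case=> [->|h]; [left; rewrite oppr0 | right; rewrite vN]. Qed.

Lemma vgeM a b x y : vge v a x -> vge v b y -> vge v (a + b) (x * y).
Proof.
have [->|x0] := eqVneq x 0; first by rewrite mul0r; left.
have [->|y0] := eqVneq y 0; first by rewrite mulr0; left.
by move=> /(vgeE x0) hx /(vgeE y0) hy; right; rewrite vM // lerD.
Qed.

Lemma vgeMl a x y : vge v 0 x -> vge v a y -> vge v a (x * y).
Proof. by move=> hx hy; rewrite -[a]add0r; exact: vgeM. Qed.

Lemma vgeMr a x y : vge v a x -> vge v 0 y -> vge v a (x * y).
Proof. by move=> hx hy; rewrite -[a]addr0; exact: vgeM. Qed.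

Lemma vX x n : x != 0 -> v (x ^+ n) = v x *+ n.
Proof.
move=> x0; elim: n => [|n IH]; first by rewrite expr0 v_1 mulr0n.
by rewrite exprS vM ?expf_neq0 // IH mulrS.
Qed.

Lemma vgeX a x n : vge v a x -> (0 < n)%N -> vge v (a *+ n) (x ^+ n).
Proof.
have [->|x0] := eqVneq x 0.
  by move=> _; case: n => // n _; rewrite expr0n; left.
by move=> /(vgeE x0) h _; right; rewrite vX // lerMn2r h orbT.
Qed.

Lemma vge0X x n : vge v 0 x -> vge v 0 (x ^+ n).
Proof.
case: n => [|n] h; first by right; rewrite expr0 v_1.
by rewrite -(mul0rn _ n.+1); exact: vgeX.
Qed.

Lemma vV x : x != 0 -> v x^-1 = - v x.
Proof.
move=> x0; apply/eqP; rewrite -addr_eq0 addrC -vM ?invr_eq0 //.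
by rewrite divff // v_1.
Qed.

Lemma vge_sum (I : Type) (s : seq I) (P : pred I) (f : I -> K) a :
  (forall i, P i -> vge v a (f i)) -> vge v a (\sum_(i <- s | P i) f i).
Proof. by move=> h; apply: big_ind => //; [left | exact: vgeD]. Qed.

Lemma vge_sum_seq (I : eqType) (s : seq I) (P : pred I) (f : I -> K) a :
  (forall i, i \in s -> P i -> vge v a (f i)) ->
  vge v a (\sum_(i <- s | P i) f i).
Proof.
by move=> h; rewrite big_seq_cond; apply: vge_sum => i /andP[]; exact: h.
Qed.

Lemma vgt_sum (I : Type) (s : seq I) (P : pred I) (f : I -> K) a :
  (forall i, P i -> vgt a (f i)) -> vgt a (\sum_(i <- s | P i) f i).
Proof. by move=> h; apply: big_ind => //; [left | exact: vgtD]. Qed.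

Lemma v_dom x y : x != 0 -> vgt (v x) y -> x + y != 0 /\ v (x + y) = v x.
Proof.
move=> x0 [->|h]; first by rewrite addr0.
have [->|y0] := eqVneq y 0; first by rewrite addr0.
have xy0 : x + y != 0.
  by apply: contraTneq h => /eqP; rewrite addr_eq0 => /eqP->; rewrite vN ltxx.
split=> //; apply/le_anti/andP; split; last first.
  by apply: le_trans (vD v x0 y0 xy0); rewrite le_min lexx ltW.
rewrite leNgt; apply/negP => h2.
have : vgt (v x) ((x + y) - y) by apply: vgtD; [right | apply: vgtN; right].
by rewrite addrK => /(vgtE x0); rewrite ltxx.
Qed.

Lemma sum_dom (I : finType) (f : I -> K) (i : I) :
  f i != 0 -> (forall j, j != i -> vgt (v (f i)) (f j)) ->
  \sum_j f j != 0 /\ v (\sum_j f j) = v (f i).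
Proof. by move=> fi0 h; rewrite (bigD1 i) //=; apply: v_dom => //; exact: vgt_sum. Qed.

End Valuations.

(** * Finiteness of F over k(x) *)

(** The relational form of the principle: [R] need not be the graph of a
    function, which spares choosing normal forms. *)
Lemma pigeonhole (X Z : finType) (R : X -> Z -> Prop) :
  (forall x, exists z, R x z) -> (#|Z| < #|X|)%N ->
  exists a b z, [/\ a != b, R a z & R b z].
Proof.
move=> /choice[f hf] lt; apply: contrapT => h.
have /leq_card : injective f.
  move=> a b e; apply/eqP; apply: contrapT => /negP ab; apply: h.
  by exists a, b, (f a); split=> //; rewrite e.
by rewrite leqNgt lt.
Qed.

Section Constants.
Variables (k : finFieldType) (F : fieldExtType {fraction {poly k}}).

Fact constF_zmod_morphism : zmod_morphism (@constF k F).
Proof. by move=> c d; rewrite /constF polyCB !rmorphB /= scalerBl. Qed.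
Fact constF_monoid_morphism : monoid_morphism (@constF k F).
Proof. by split; [exact: const1 | exact: constM]. Qed.

HB.instance Definition _ :=
  GRing.isZmodMorphism.Build k F (@constF k F) constF_zmod_morphism.
HB.instance Definition _ :=
  GRing.isMonoidMorphism.Build k F (@constF k F) constF_monoid_morphism.

End Constants.

Section FiniteDegree.
Variables (k : finFieldType) (F : fieldExtType {fraction {poly k}}).

(** The value at [y] of a polynomial over the field of constants. *)
Definition ev (y : F) (g : {poly k}) : F := (map_poly (@constF k F) g).[y].

Lemma evD y g h : ev y (g + h) = ev y g + ev y h.
Proof. by rewrite /ev rmorphD hornerD. Qed.
Lemma evN y g : ev y (- g) = - ev y g.
Proof. by rewrite /ev rmorphN hornerN. Qed.
Lemma evB y g h : ev y (g - h) = ev y g - ev y h.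
Proof. by rewrite evD evN. Qed.
Lemma evM y g h : ev y (g * h) = ev y g * ev y h.
Proof. by rewrite /ev rmorphM hornerM. Qed.
Lemma evC y c : ev y c%:P = constF F c.
Proof. by rewrite /ev map_polyC hornerC. Qed.
Lemma evX y : ev y 'X = y.
Proof. by rewrite /ev map_polyX hornerX. Qed.
Lemma ev0 y : ev y 0 = 0. Proof. by rewrite /ev rmorph0 horner0. Qed.
Lemma ev1 y : ev y 1 = 1. Proof. by rewrite /ev rmorph1 hornerC. Qed.
Lemma evXn y n : ev y 'X^n = y ^+ n.
Proof. by rewrite /ev map_polyXn hornerXn. Qed.

Lemma ev_rVpoly y n (u : 'rV[k]_n) :
  ev y (rVpoly u) = \sum_i constF F (u 0 i) * y ^+ i.
Proof.
rewrite /ev /rVpoly; have e : size (map_poly (@constF k F) (rVpoly u)) = size (rVpoly u).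
  exact: size_map_poly.
rewrite (@horner_coef_wide _ n).
  by apply: eq_bigr => i _; rewrite coef_map coef_rVpoly_ord.
by rewrite e size_poly.
Qed.

Local Notation D := (\dim {:F}).
Local Notation w := (vbasis {:F}).

(** Finite pieces of the [k[T]]-lattice spanned by a basis of [F] over [k(T)],
    parametrized by matrices so that their elements can be counted. *)
Definition box (n : nat) : set F :=
  [set z | exists A : 'M[k]_(D, n), z = \sum_l tofrac (rVpoly (row l A)) *: w`_l].

Lemma boxP n z : box n z <-> exists p : 'I_D -> {poly k},
  (forall l, (size (p l) <= n)%N) /\ z = \sum_l tofrac (p l) *: w`_l.
Proof.
split=> [[A ->]|[p [hp ->]]].
  by exists (fun l => rVpoly (row l A)); split=> // l; exact: size_poly.
exists (\matrix_(l, i) (p l)`_i); apply: eq_bigr => l _; congr (tofrac _ *: _).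
apply/polyP => i; rewrite coef_rVpoly; case: insubP => [j _ e|].
  by rewrite !mxE e.
by rewrite -leqNgt => hi; apply/leq_sizeP: hi; exact: hp.
Qed.

Lemma box_le n m z : (n <= m)%N -> box n z -> box m z.
Proof.
move=> nm /boxP[p [hp ->]]; apply/boxP; exists p; split=> // l.
exact: leq_trans nm.
Qed.

Lemma boxD n z z' : box n z -> box n z' -> box n (z + z').
Proof.
move=> /boxP[p [hp ->]] /boxP[q [hq ->]]; apply/boxP.
exists (fun l => p l + q l); split=> [l|].
  by apply: leq_trans (size_polyD _ _) _; rewrite geq_max hp hq.
by rewrite -big_split; apply: eq_bigr => l _; rewrite rmorphD scalerDl.
Qed.

Lemma box_sum n (I : Type) (s : seq I) (P : pred I) (f : I -> F) :
  (forall i, P i -> box n (f i)) -> box n (\sum_(i <- s | P i) f i).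
Proof.
move=> h; apply: big_ind => //; last exact: boxD.
apply/boxP; exists (fun=> 0); split=> [l|]; first by rewrite size_poly0.
by rewrite big1 // => l _; rewrite rmorph0 scale0r.
Qed.

Lemma boxZ n (q : {poly k}) z : box n z -> box (n + (size q).-1) (tofrac q *: z).
Proof.
move=> /boxP[p [hp ->]]; apply/boxP; exists (fun l => q * p l); split=> [l|].
  have [->|q0] := eqVneq q 0; first by rewrite mul0r size_poly0.
  apply: leq_trans (size_polyMleq _ _) _; have := hp l.
  by move: q0; rewrite -size_poly_eq0; lia.
by rewrite scaler_sumr; apply: eq_bigr => l _; rewrite scalerA -rmorphM.
Qed.

Lemma fracP (a : {fraction {poly k}}) :
  exists2 d : {poly k}, d != 0 & exists p, tofrac d * a = tofrac p.
Proof.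
elim/quotW: a => r; exists \d_r; first exact: denom_ratioP.
exists \n_r; unlock FracField.tofrac; rewrite -[LHS]FracField.pi_mul.
apply/eqmodP; rewrite /= FracField.equivfE.
rewrite /FracField.mulf !numden_Ratio ?mulf_neq0 ?oner_neq0 ?denom_ratioP //.
by rewrite mulr1 mul1r mulrC.
Qed.

Lemma fracsP (I : finType) (a : I -> {fraction {poly k}}) :
  exists2 d : {poly k}, d != 0 & exists p, forall i, tofrac d * a i = tofrac (p i).
Proof.
have /choice[d hd] : forall i, exists d : {poly k},
    d != 0 /\ exists p, tofrac d * a i = tofrac p.
  by move=> i; have [d d0 hp] := fracP (a i); exists d.
have /choice[p hp] : forall i, exists p, tofrac (d i) * a i = tofrac p.
  by move=> i; have [] := hd i.
exists (\prod_i d i); first by apply/prodf_neq0 => i _; have [] := hd i.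
exists (fun i => \prod_(j | j != i) d j * p i) => i.
by rewrite (bigD1 i) //= !rmorphM /= -mulrA mulrC -mulrA [a i * _]mulrC hp.
Qed.

Lemma common_denominator (I : finType) (z : I -> F) :
  exists2 d : {poly k}, d != 0 &
  exists n, forall i, box n (tofrac d *: z i).
Proof.
have [d d0 [p hp]] :=
  fracsP (fun il : I * 'I_D => coord w il.2 (z il.1)).
exists d => //; exists (\sum_il size (p il))%N => i; apply/boxP.
exists (fun l => p (i, l)); split=> [l|]; first by rewrite (bigD1 (i, l)) //= leq_addr.
rewrite {1}(coord_vbasis (memvf (z i))) scaler_sumr; apply: eq_bigr => l _.
by rewrite scalerA (hp (i, l)).
Qed.

(** The number of dimensions gained when multiplying by [x] does not depend on
    the element multiplied: this makes growth linear in the power of [x]. *)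
Lemma box_mul (x : F) : exists2 d : {poly k}, d != 0 &
  exists h, (size d <= h)%N /\ forall n z, box n z -> box (n + h) (tofrac d *: (x * z)).
Proof.
have [d d0 [h hh]] := common_denominator (fun l : 'I_D => x * w`_l).
exists d => //; exists (maxn (size d) h); split=> [|n z]; first by lia.
move=> /boxP[p [hp ->]]; rewrite mulr_sumr scaler_sumr; apply: box_sum => l _.
rewrite -scalerAr scalerA mulrC -scalerA.
apply: box_le (boxZ (p l) (hh l)); have := hp l; lia.
Qed.

(** Once a common denominator is cleared, the products [x ^ i * u j] with [i < L]
    lie in a box of size about [D * h * L], while they have [m * L] coefficients;
    so for [m > D * h] and [L] large two linear combinations agree. *)
Lemma bounded_dim (x : F) : exists n, forall m (u : 'I_m -> F), (n < m)%N ->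
  exists2 g : 'I_m -> {poly k}, exists j, g j != 0 & \sum_j ev x (g j) * u j = 0.
Proof.
have [d d0 [h [sd hh]]] := box_mul x.
exists (D * h)%N => m u mD.
have [e e0 [c0 hc]] := common_denominator u.
pose L := (D * c0).+1.
have hb i (j : 'I_m) : box (c0 + i * h) (tofrac (d ^+ i * e) *: (x ^+ i * u j)).
  elim: i => [|i IH]; first by rewrite !expr0 !mul1r addn0.
  have -> : tofrac (d ^+ i.+1 * e) *: (x ^+ i.+1 * u j)
          = tofrac d *: (x * (tofrac (d ^+ i * e) *: (x ^+ i * u j))).
    by rewrite -scalerAr scalerA -rmorphM !exprS !mulrA.
  by rewrite mulSn addnCA addnC; apply: hh.
have hb' i (j : 'I_m) : (i <= L)%N ->
    box (c0 + L * h) (tofrac (d ^+ L * e) *: (x ^+ i * u j)).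
  move=> iL; rewrite -(subnKC iL) exprD -mulrA mulrCA rmorphM /= -scalerA.
  have -> : (c0 + (i + (L - i)) * h = (c0 + i * h) + (L - i) * h)%N by lia.
  elim: (L - i)%N => [|l IH]; first by rewrite expr0 rmorph1 scale1r addn0; exact: hb.
  rewrite exprS rmorphM /= -scalerA mulSn.
  by apply: box_le (boxZ d IH); lia.
pose S (C : 'M[k]_(m, L)) := \sum_j ev x (rVpoly (row j C)) * u j.
have hS C : box (c0 + L * h) (tofrac (d ^+ L * e) *: S C).
  rewrite /S scaler_sumr; apply: box_sum => j _.
  rewrite ev_rVpoly mulr_suml scaler_sumr; apply: box_sum => i _.
  rewrite /constF -mulrA mulr_algl scalerA mulrC -scalerA.
  apply: box_le (boxZ _ (hb' i j (ltnW (ltn_ord i)))).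
  by have := size_polyC_leq1 (C j i); rewrite !mxE; lia.
(* L was chosen so that D * (c0 + L * h) < m * L *)
have := @pigeonhole 'M[k]_(m, L) 'M[k]_(D, c0 + L * h)
  (fun C z => tofrac (d ^+ L * e) *: S C = \sum_l tofrac (rVpoly (row l z)) *: w`_l) hS.
rewrite !card_mx ltn_exp2l; last exact: finNzRing_gt1.
case=> [|A [B [z [AB ea eb]]]].
  apply: (@leq_trans ((D * h).+1 * L)); last by rewrite leq_mul2r mD orbT.
  by rewrite /L; nia.
have [j [i cji]] : exists j i, (A - B) j i != 0.
  apply: contrapT => h0; move/eqP: AB; apply; apply/matrixP => j i.
  apply/eqP; rewrite -subr_eq0; apply: contrapT => /negP h1; apply: h0.
  by exists j, i; rewrite !mxE.
exists (fun j => rVpoly (row j (A - B))); first (exists j).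
  apply: contra cji => /eqP/(congr1 (fun g : {poly k} => g`_i)).
  by rewrite coef_rVpoly_ord coef0 !mxE => ->.
have de0 : tofrac (d ^+ L * e) != 0 :> {fraction {poly k}}.
  by rewrite tofrac_eq0 mulf_neq0 ?expf_neq0.
apply: (scalerI de0); rewrite scaler0 -[RHS](subrr (tofrac (d ^+ L * e) *: S A)).
rewrite {2}ea -eb -scalerBr -sumrB; congr (_ *: _); apply: eq_bigr => l _.
by rewrite -mulrBl !raddfB /= evB.
Qed.

Definition indep (y : F) m (u : 'I_m -> F) := forall g : 'I_m -> {poly k},
  \sum_j ev y (g j) * u j = 0 -> forall j, g j = 0.

Lemma indep_bounded y : exists n, forall m (u : 'I_m -> F), indep y u -> (m <= n)%N.
Proof.
have [n hn] := bounded_dim y; exists n => m u hu; rewrite leqNgt; apply/negP.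
by move=> /(hn _ u)[g [j gj] /hu/(_ j)/eqP]; rewrite (negPf gj).
Qed.

Lemma max_indep y : exists n, (exists w : 'I_n -> F, indep y w) /\
  forall m (u : 'I_m -> F), indep y u -> (m <= n)%N.
Proof.
have [n hn] := indep_bounded y.
pose P m := `[< exists w : 'I_m -> F, indep y w >].
have ex : exists m, P m.
  by exists 0%N; apply/asboolP; exists (fun=> 0) => g _ [].
have le m : P m -> (m <= n)%N by move=> /asboolP[u]; exact: hn.
case: (ex_maxnP ex le) => m /asboolP hm mx; exists m; split=> // m' u hu.
by apply: mx; apply/asboolP; exists u.
Qed.

Definition subalgebra (R : set F) :=
  [/\ forall c, R (constF F c), forall a b, R a -> R b -> R (a + b)
    & forall a b, R a -> R b -> R (a * b)].

Lemma subalg_sum (R : set F) (I : Type) (s : seq I) (P : pred I) (f : I -> F) :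
  subalgebra R -> (forall i, P i -> R (f i)) -> R (\sum_(i <- s | P i) f i).
Proof.
move=> [hc hD _] h; by apply: big_ind => //; rewrite -(const0 F); apply: hc.
Qed.

Lemma subalg_ev R y g : subalgebra R -> R y -> R (ev y g).
Proof.
move=> sR hy; have [hc hD hM] := sR; elim/poly_ind: g => [|g c IH].
  by rewrite ev0 -(const0 F); apply: hc.
by rewrite evD evM evX evC; apply: hD => //; exact: hM.
Qed.

(** Reduce a relation modulo [y R] to see that all its constant coefficients
    vanish, divide it by [y], and start again: by induction on the degrees the
    relation is trivial. *)
Lemma indep_mod (R : set F) y m (u : 'I_m -> F) :
  subalgebra R -> R y -> y != 0 -> (forall j, R (u j)) ->
  (forall c : 'I_m -> k, (exists2 z, R z & \sum_j constF F (c j) * u j = y * z) ->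
     forall j, c j = 0) ->
  indep y u.
Proof.
move=> sR hy y0 hu hc; have [Rc RD RM] := sR.
have step n : forall g : 'I_m -> {poly k}, (forall j, size (g j) <= n)%N ->
    \sum_j ev y (g j) * u j = 0 -> forall j, g j = 0.
  elim: n => [|n IH] g sg e j; first by apply/eqP; rewrite -size_poly_leq0.
  pose h j := drop_poly 1 (g j).
  have gE i : g i = ((g i)`_0)%:P + h i * 'X.
    rewrite -{1}(poly_take_drop 1 (g i)) expr1; congr (_ + _).
    by apply/polyP => l; rewrite coef_take_poly coefC; case: l.
  have eE : \sum_j ev y (g j) * u j
      = \sum_j constF F (g j)`_0 * u j + y * \sum_j ev y (h j) * u j.
    rewrite mulr_sumr -big_split; apply: eq_bigr => i _ /=.
    by rewrite {1}gE evD evC evM evX mulrDl; congr (_ + _); rewrite mulrA (mulrC y).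
  have g0 : forall i, (g i)`_0 = 0.
    apply: hc; exists (constF F (-1) * \sum_j ev y (h j) * u j).
      apply: (RM) => //; apply: subalg_sum => // i _; apply: (RM) => //.
      exact: subalg_ev.
    apply/eqP; rewrite rmorphN1 mulN1r mulrN -addr_eq0 -eE e eqxx //.
  have h0 : forall i, h i = 0.
    apply: IH => [i|]; first by rewrite size_drop_poly leq_subLR add1n.
    apply: (mulfI y0); rewrite mulr0 -[RHS]e eE [X in _ = X + _]big1 ?add0r // => i _.
    by rewrite g0 rmorph0 mul0r.
  by rewrite gE g0 h0 mul0r addr0.
by move=> g; apply: (step (\max_j size (g j))) => j; exact: leq_bigmax.
Qed.

Lemma alg_dep (y z : F) : exists m, exists2 g : 'I_m -> {poly k},
  exists j, g j != 0 & \sum_j ev y (g j) * z ^+ j = 0.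
Proof.
have [n hn] := bounded_dim y; exists n.+1.
exact: (hn _ (fun j : 'I_n.+1 => z ^+ j)).
Qed.

End FiniteDegree.

Lemma finite_set_seq (T : choiceType) (A : set T) : finite_set A ->
  exists s : seq T, forall x, x \in s <-> A x.
Proof.
by move=> /finite_seqP[s ->]; exists s.
Qed.

Lemma infinite_uniq (T : choiceType) (A : set T) : ~ finite_set A ->
  forall n, exists s : seq T, [/\ uniq s, size s = n & forall x, x \in s -> A x].
Proof.
move=> hA; elim=> [|n [s [us ss hs]]]; first by exists [::].
have [x [Ax xs]] : exists x, A x /\ x \notin s.
  apply: contrapT => h; apply: hA; apply: (@sub_finite_set _ A [set` s]) => [x Ax|].
    by apply: contrapT => /negP xs; apply: h; exists x.
  exact: finite_seq.
exists (x :: s); split=> [||y]; rewrite /= ?xs ?ss //.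
by rewrite inE => /orP[/eqP->|/hs].
Qed.

(** * Weak approximation *)

Section WeakApproximation.
Variable F : fieldType.
Implicit Types (p q : place F) (s : seq (place F)).

HB.instance Definition _ := gen_eqMixin (place F).
HB.instance Definition _ := gen_choiceMixin (place F).

Lemma valuation_ext (G : realDomainType) (v w : valuation F G) :
  (forall x, v x = w x) -> v = w.
Proof.
case: v w => [f f0 fM fD] [g g0 gM gD] /= /funext e; subst g.
by congr Valuation; exact: Prop_irrelevance.
Qed.

Lemma place_ext p q : (forall x, p x = q x) -> p = q.
Proof.
case: p q => [v hv] [w hw] /= /valuation_ext e; subst w.
by congr Place; exact: Prop_irrelevance.
Qed.

Lemma vXz (v : valuation F int) x (n : int) : x != 0 -> v (x ^ n) = v x * n.
Proof.
move=> x0; case: n => n; first by rewrite -exprnP vX // pmulrn mulrzz.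
by rewrite NegzE -exprnN vV ?expf_neq0 // vX // pmulrn mulrzz mulrN.
Qed.

(** If the valuation ring of [p] were contained in that of [q], units of the
    first would be units of the second, so [q] would be a multiple of [p]; both
    being normalized, the factor would be 1. *)
Lemma place_neq p q : p <> q -> exists x, [/\ x != 0, 0 <= p x & q x < 0].
Proof.
move=> pq; apply: contrapT => h; apply: pq; apply: place_ext.
have ge x : x != 0 -> 0 <= p x -> 0 <= q x.
  by move=> x0 px; rewrite leNgt; apply/negP => qx; apply: h; exists x.
have eq0 x : x != 0 -> p x = 0 -> q x = 0.
  move=> x0 px; apply/le_anti/andP; split; last by apply: ge; rewrite ?px.
  by have := ge x^-1; rewrite !vV // px oppr0 oppr_ge0 invr_eq0; apply.
have [u u0 pu] := pval_norm p; have [w w0 qw] := pval_norm q.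
have qE x : x != 0 -> q x = q u * p x.
  move=> x0; have : q (x / u ^ p x) = 0.
    apply: eq0; first by rewrite mulf_neq0 ?invr_eq0 ?expfz_neq0.
    by rewrite vM ?invr_eq0 ?expfz_neq0 // vV ?expfz_neq0 // vXz // pu mul1r subrr.
  rewrite vM ?invr_eq0 ?expfz_neq0 // vV ?expfz_neq0 // vXz //.
  by move=> /eqP; rewrite subr_eq0 => /eqP.
have qu : q u = 1.
  have := qE w w0; rewrite qw; have : 0 <= q u by apply: ge; rewrite ?pu.
  move: (q u) (p w) => a b a0 /(congr1 absz)/esym/eqP.
  by rewrite abszM muln_eq1 => /andP[/eqP a1 _]; rewrite -(gez0_abs a0) a1.
move=> x; have [->|x0] := eqVneq x 0; first by rewrite !v0.
by rewrite qE // qu mul1r.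
Qed.

Lemma place_sep2 p q : p <> q -> exists x, [/\ x != 0, 0 < p x & q x < 0].
Proof.
move=> pq; have [x [x0 px qx]] := place_neq pq.
have [y [y0 qy py]] := place_neq (fun e => pq (esym e)).
exists (x / y); split; first by rewrite mulf_neq0 ?invr_eq0.
  rewrite vM ?invr_eq0 // vV //; lia.
rewrite vM ?invr_eq0 // vV //; lia.
Qed.

(** Induction on [s]: an element [z] that fails only at the new place [q] is
    corrected by adding to a high power of it an element [w] separating [p] and
    [q]; the power dominates [w] at the old places and is dominated at [q]. *)
Lemma place_sep p s : p \notin s ->
  exists x, [/\ x != 0, 0 < p x & forall q, q \in s -> q x < 0].
Proof.
elim: s => [_|q s IH].
  by have [x x0 px] := pval_norm p; exists x; split=> //; rewrite px.
rewrite inE negb_or => /andP[pq /IH[z [z0 pz hz]]].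
have [qz|qz] := ltP (q z) 0.
  by exists z; split=> // q'; rewrite inE => /orP[/eqP->//|]; exact: hz.
have [w [w0 pw qw]] := place_sep2 (fun e => negP pq (introT eqP e)).
pose M := \sum_(q' <- s) `|q' w|%N.
have hM q' : q' \in s -> (`|q' w| <= M)%N.
  by move=> hq; rewrite /M (big_rem q') //= leq_addr.
pose n := M.+1.
have zn0 : z ^+ n != 0 by rewrite expf_neq0.
have [wz0 qwz] : w + z ^+ n != 0 /\ q (w + z ^+ n) = q w.
  by apply: v_dom => //; right; rewrite vX //; apply: lt_le_trans qw _; rewrite mulrn_wge0.
exists (w + z ^+ n); split=> //.
  have := vgtE wz0 (@vgtD _ _ p 0 w (z ^+ n) (or_intror pw) (or_intror _)).
  by apply; rewrite vX // pmulrn_lgt0.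
move=> q'; rewrite inE => /orP[/eqP->|hq]; first by rewrite qwz.
have lt : vgt q' (q' (z ^+ n)) w.
  right; rewrite vX // pmulrn mulrzz /n; have := hM _ hq; have := hz _ hq; nia.
rewrite addrC (v_dom zn0 lt).2 vX // pmulrn mulrzz; have := hz _ hq; rewrite /n; nia.
Qed.

(** The approximate idempotent is [(1 + z ^ m)^-1], with [z] small at [p] and
    large at the places of [s]. *)
Lemma place_idem p s (n : nat) : p \notin s ->
  exists e, vge p n%:Z (e - 1) /\ forall q, q \in s -> vge q n%:Z e.
Proof.
move=> /place_sep[z [z0 pz hz]]; pose m := n.+1.
have zm0 : z ^+ m != 0 by rewrite expf_neq0.
have [t0 pt] : 1 + z ^+ m != 0 /\ p (1 + z ^+ m) = p 1.
  apply: v_dom; rewrite ?oner_neq0 //; right.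
  by rewrite v_1 vX // pmulrn_lgt0.
exists (1 + z ^+ m)^-1; split=> [|q hq].
  have -> : (1 + z ^+ m)^-1 - 1 = - (z ^+ m / (1 + z ^+ m)).
    by apply: (mulIf t0); rewrite mulrBl mulVf // mulNr divfK // mul1r opprD addrA subrr add0r.
  apply: vgeN; right; rewrite vM ?invr_eq0 // vV // pt v_1 subr0 vX //.
  rewrite pmulrn mulrzz /m; nia.
have lt : vgt q (q (z ^+ m)) 1.
  by right; rewrite v_1 vX // pmulrn_llt0 // hz.
right; rewrite vV // addrC (v_dom zm0 lt).2 vX // pmulrn mulrzz /m.
have := hz _ hq; nia.
Qed.

Theorem weak_approximation s (x : place F -> F) (n : int) :
  exists b, forall p, p \in s -> vge p n (b - x p).
Proof.
wlog us : s / uniq s => [W|].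
  have [b hb] := W _ (undup_uniq s); exists b => p hp.
  by apply: hb; rewrite mem_undup.
pose M := (`|n| + \sum_(p <- s) \sum_(q <- s) `|q (x p)|)%N.
have hM p q : p \in s -> q \in s -> (`|n| + `|q (x p)| <= M)%N.
  move=> hp hq; rewrite leq_add2l (big_rem p) //= (big_rem q) //=.
  by rewrite -addnA leq_addr.
have /choice[e he] : forall p, exists e, p \in s ->
    vge p M%:Z (e - 1) /\ forall q, q \in s -> q != p -> vge q M%:Z e.
  move=> p; have [e [h1 h2]] := @place_idem p (rem p s) M (negbT (mem_rem_uniqF p us)).
  exists e => _; split=> // q qs qp; apply: h2; rewrite mem_rem_uniq //.
  by rewrite !inE qp.
have hx p q : p \in s -> q \in s -> vge q (n - M%:Z) (x p).
  by move=> hp hq; right; have := hM _ _ hp hq; lia.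
have nM : n = M%:Z + (n - M%:Z) by lia.
exists (\sum_(p <- s) e p * x p) => p hp; rewrite (bigD1_seq p) //= addrAC.
apply: vgeD.
  rewrite -[X in _ - X]mul1r -mulrBl nM; apply: vgeM; last exact: hx.
  by have [] := he _ hp.
apply: vge_sum_seq => q hq qp; rewrite nM; apply: vgeM; last exact: hx.
by have [_] := he _ hq; apply; rewrite // eq_sym.
Qed.

End WeakApproximation.

(** * Zeros and residue fields *)

Section FunctionField.
Variables (k : finFieldType) (F : fieldExtType {fraction {poly k}}).
Implicit Types (p q : place F) (s : seq (place F)) (x y : F).

Lemma constF_eq0 (c : k) : (constF F c == 0) = (c == 0).
Proof. exact: fmorph_eq0. Qed.

Lemma vge_const p c : vge p 0 (constF F c).
Proof. by right; rewrite v_const. Qed.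

Lemma vge_const_gt0 p c (a : int) : 0 < a -> vge p a (constF F c) -> c = 0.
Proof.
move=> a0; have [->//|c0] := eqVneq c 0; rewrite -(constF_eq0) in c0.
by move=> /(vgeE c0); rewrite v_const leNgt a0.
Qed.

Lemma ring_of_places (P : set (place F)) :
  subalgebra [set x : F | forall p, P p -> vge p 0 x].
Proof.
split=> [c p _|a b ha hb p hp|a b ha hb p hp]; first exact: vge_const.
  by apply: vgeD; [exact: ha | exact: hb].
by apply: vge0M; [exact: ha | exact: hb].
Qed.

Lemma vge_ev p x g : vge p 0 x -> vge p 0 (ev x g).
Proof.
move=> hx; have := subalg_ev g (ring_of_places [set p]) (R := _).
by apply=> // _ ->.
Qed.

(** Approximate idempotents at distinct zeros of [y] are k-independent modulo
    [y R], [R] being the ring of functions regular at these zeros.  So there are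
    at most as many zeros as the dimension of [F] over [k(y)]. *)
Lemma finite_zeros y : y != 0 -> finite_set [set p : place F | 0 < p y].
Proof.
move=> y0; apply: contrapT => inf; have [n hn] := indep_bounded y.
have [s [us ss hs]] := infinite_uniq inf n.+1.
have /choice[e he] p : exists e, forall q, q \in s -> vge q 1 (e - (q == p)%:R).
  exact: weak_approximation.
pose P (j : 'I_(size s)) := tnth (in_tuple s) j.
have Ps j : P j \in s by exact: mem_tnth.
have eR j q : q \in s -> vge q 0 (e (P j)).
  move=> hq; rewrite -[e _](subrK (q == P j)%:R); apply: vgeD.
    exact: vge_le (he _ _ hq).
  by case: eqP; [right; rewrite v_1 | left].
suff : indep y (fun j => e (P j)) by move=> /hn; rewrite ss ltnn.
apply: (@indep_mod _ _ [set x : F | forall q, q \in s -> vge q 0 x]) => //.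
- exact: ring_of_places.
- by move=> q /hs/ltW; right.
move=> c [z hz ez] j; apply: (@vge_const_gt0 (P j) _ 1) => //.
have -> : constF F (c j) = y * z - \sum_i constF F (c i) * (e (P i) - (i == j)%:R).
  under eq_bigr do rewrite mulrBr.
  rewrite sumrB ez subKr (bigD1 j) //= eqxx mulr1 big1 ?addr0 // => i /negPf->.
  by rewrite mulr0.
apply: vgeB.
  by rewrite -[1]addr0; apply: vgeM; [have := hs _ (Ps j); right | exact: hz].
apply: vge_sum => i _; rewrite -[1]add0r; apply: vgeM; first exact: vge_const.
have -> : (i == j) = (P j == P i); last exact: he.
by rewrite /P !(tnth_nth (P j)) nth_uniq // eq_sym.
Qed.

Lemma finite_nonunits y : y != 0 -> finite_set [set p : place F | p y != 0].
Proof.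
move=> y0; have yV0 : y^-1 != 0 by rewrite invr_eq0.
have hU : finite_set ([set p : place F | 0 < p y] `|` [set p : place F | 0 < p y^-1]).
  by rewrite finite_setU; split; exact: finite_zeros.
apply: sub_finite_set hU => p /=; rewrite vV // oppr_gt0 => py.
by move: py; rewrite neq_lt => /orP[]; [right | left].
Qed.

(** Independence of all powers of [x] modulo a uniformizer would contradict
    [indep_bounded]; so [x] satisfies an equation in the residue field, the
    remainders of its powers are finitely many, and two of them coincide. *)
Lemma residue_root_of_unity p x : x != 0 -> p x = 0 ->
  exists2 n, (0 < n)%N & vge p 1 (x ^+ n - 1).
Proof.
move=> x0 px; have [u u0 pu] := pval_norm p.
have xR : vge p 0 x by right; rewrite px.
have [g g0 hg] : exists2 g : {poly k}, g != 0 & vge p 1 (ev x g).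
  have [n hn] := indep_bounded u; apply: contrapT => h.
  suff : indep u (fun j : 'I_n.+1 => x ^+ j) by move=> /hn; rewrite ltnn.
  apply: (@indep_mod _ _ [set z : F | forall q, q = p -> vge q 0 z]) => //.
  - exact: ring_of_places.
  - by move=> _ ->; right; rewrite pu.
  - by move=> j _ ->; exact: vge0X.
  move=> c [z hz ez] j.
  have [e|c0] := eqVneq (\row_i c i) 0; first by move/rowP/(_ j): e; rewrite !mxE.
  case: h; exists (rVpoly (\row_i c i)).
    by apply: contra c0 => /eqP e; rewrite -[\row_i _]rVpolyK e linear0.
  rewrite ev_rVpoly; under eq_bigr do rewrite mxE.
  rewrite {}ez -[1]addr0; apply: vgeM; last exact: hz.
  by right; rewrite pu.
(* one more power than there are remainders modulo g *)
pose N := (#|{: 'rV[k]_(size g)}|).+1.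
have := @pigeonhole 'I_N 'rV[k]_(size g)
  (fun i a => vge p 1 (x ^+ i - ev x (rVpoly a))).
case=> [i||i [j [a [ij hi hj]]]].
- exists (poly_rV ('X^i %% g)).
  rewrite poly_rV_K; last by rewrite ltnW // ltn_modp.
  rewrite -evXn -evB {1}(divp_eq 'X^i g) addrK evM.
  by rewrite -[1]add0r; apply: vgeM => //; exact: vge_ev.
- by rewrite card_ord.
wlog lt : i j hi hj ij / (i < j)%N.
  move=> W; move: (ij); rewrite neq_ltn => /orP[lt|lt]; first exact: (W i j).
  by apply: (W j i); rewrite // eq_sym.
exists (j - i)%N; first by rewrite subn_gt0.
have -> : x ^+ (j - i) - 1 = x ^- i * (x ^+ j - x ^+ i).
  rewrite mulrBr mulVf ?expf_neq0 // -{2}(subnK (ltnW lt)) exprD.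
  by rewrite mulrCA mulVf ?mulr1 ?expf_neq0.
rewrite -[1]add0r; apply: vgeM.
  by right; rewrite vV ?expf_neq0 // vX // px mul0rn oppr0.
have -> : x ^+ j - x ^+ i = (x ^+ j - ev x (rVpoly a)) - (x ^+ i - ev x (rVpoly a)).
  by rewrite opprB addrA subrK.
exact: vgeB.
Qed.

(** A product of powers of [x] and of [x ^ n - 1], [n] being given by
    [residue_root_of_unity].  The pole [p0] ensures that these factors are nonzero. *)
Lemma vanishing_element x (p0 : place F) s (M : nat) : p0 x < 0 ->
  (forall p, p \in s -> vge p 0 x) ->
  exists2 h, h != 0 & (forall p, p \in s -> vge p M%:Z h) /\
    (forall p, vge p 0 x -> vge p 0 h).
Proof.
move=> p0x; have x0 : x != 0 by apply: contraTneq p0x => ->; rewrite v0 ltxx.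
elim: s => [_|p s IH hs].
  by exists 1; rewrite ?oner_neq0 //; split=> // p _; exact: vge0_1.
have [|h h0 [h1 h2]] := IH; first by move=> q qs; apply: hs; rewrite inE qs orbT.
have [g g0 [pg hg]] : exists2 g, g != 0 & vge p 1 g /\
    forall q, vge q 0 x -> vge q 0 g.
  have px : vge p 0 x by apply: hs; rewrite mem_head.
  have [pxE|px0] := eqVneq (p x) 0; last first.
    exists x => //; split=> //; right; move: (vgeE x0 px); rewrite le_eqVlt eq_sym.
    by rewrite (negPf px0).
  have [n n0 hn] := residue_root_of_unity x0 pxE.
  exists (x ^+ n - 1).
    apply: contraTneq p0x => /eqP; rewrite subr_eq0 => /eqP/(congr1 p0).
    rewrite vX // v_1 => /eqP; rewrite mulrn_eq0 => /orP[/eqP e|/eqP->]; last by rewrite ltxx.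
    by rewrite e in n0.
  split=> // q hq; apply: vgeB; [exact: vge0X | exact: vge0_1].
exists (g ^+ M * h); first by rewrite mulf_neq0 ?expf_neq0.
split=> [q|q hq]; last by apply: vge0M; [apply: vge0X; exact: hg | exact: h2].
have gM0 q' : vge q' 0 x -> vge q' 0 (g ^+ M) by move=> /hg; exact: vge0X.
rewrite inE => /orP[/eqP->|hq].
  rewrite -[M%:Z]addr0; apply: vgeM; last by apply: h2; apply: hs; rewrite mem_head.
  right; rewrite vX // pmulrn mulrzz; have := vgeE g0 pg; nia.
by apply: vgeMl; [apply: gM0; apply: hs; rewrite inE hq orbT | exact: h1].
Qed.

End FunctionField.

(** * Existence of places *)

(** A subalgebra maximal among those containing [y] but not [y^-1] is a valuation
    ring of [F], by Chevalley's argument, and it is discrete since [F] is finite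
    over [k(y)]. *)
Section PlaceExistence.
Variables (k : finFieldType) (F : fieldExtType {fraction {poly k}}).
Variables (y : F) (R : set F).
Hypotheses (sR : subalgebra R) (Ry : R y) (y0 : y != 0) (RyV : ~ R y^-1).
Hypothesis maxR : forall B : set F, subalgebra B -> R `<=` B -> ~ B y^-1 ->
  B `<=` R.

Let RC c : R (constF F c). Proof. by have [h _ _] := sR. Qed.
Let RD a b : R a -> R b -> R (a + b). Proof. by have [_ h _] := sR; exact: h. Qed.
Let RM a b : R a -> R b -> R (a * b). Proof. by have [_ _ h] := sR; exact: h. Qed.
Let R0 : R 0. Proof. by rewrite -(const0 F). Qed.
Let R1 : R 1. Proof. by rewrite -(const1 F). Qed.
Let RN a : R a -> R (- a).
Proof. by move=> ha; rewrite -mulN1r -(const1 F) -rmorphN; apply: RM => //; exact: RC. Qed.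
Let RX a n : R a -> R (a ^+ n).
Proof. by move=> ha; elim: n => [|n IH]; rewrite ?expr0 // exprS; exact: RM. Qed.

Let Rsum n (f : 'I_n -> F) : (forall i, R (f i)) -> R (\sum_i f i).
Proof. by move=> h; apply: subalg_sum. Qed.

(** Inverting all the [1 + y * b] does not bring [y^-1] into the ring, hence by
    maximality changes nothing. *)
Lemma one_plus_unit a : R a -> 1 + y * a != 0 /\ R (1 + y * a)^-1.
Proof.
move=> Ra; have ne b : R b -> 1 + y * b != 0.
  move=> Rb; apply/negP => /eqP e; apply: RyV; rewrite (_ : y^-1 = - b); first exact: RN.
  by apply: (mulfI y0); rewrite mulfV // mulrN; apply/eqP; rewrite -addr_eq0 e.
split; first exact: ne.
pose B : set F := [set z | exists b r, [/\ R b, R r & z * (1 + y * b) = r]].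
apply: (maxR (B := B)); last 1 first.
- by exists a, 1; split=> //; rewrite mulVf // ne.
- split=> [c|z w [b [r [Rb Rr ez]]] [d [s [Rd Rs ew]]]|
           z w [b [r [Rb Rr ez]]] [d [s [Rd Rs ew]]]].
  + by exists 0, (constF F c); split=> //; rewrite mulr0 addr0 mulr1.
  + exists (b + d + y * (b * d)), (r * (1 + y * d) + s * (1 + y * b)); split.
    * by apply: RD; [exact: RD | apply: RM => //; exact: RM].
    * by apply: RD; apply: RM => //; apply: RD => //; exact: RM.
    * by rewrite -ez -ew; ring.
  + exists (b + d + y * (b * d)), (r * s); split.
    * by apply: RD; [exact: RD | apply: RM => //; exact: RM].
    * exact: RM.
    * by rewrite -ez -ew; ring.
- by move=> z Rz; exists 0, z; split=> //; rewrite mulr0 addr0 mulr1.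
- move=> [b [r [Rb Rr e]]]; apply: RyV; rewrite (_ : y^-1 = r - b).
    by apply: RD => //; exact: RN.
  by rewrite -e mulrDr mulr1 mulKf // addrK.
Qed.

(** The relations expressing that [y^-1] lies in [R[z]]. *)
Let rel z n := exists p : {poly F},
  [/\ (size p <= n)%N, forall i, R p`_i & y * p.[z] = 1].

Lemma rel_adjoin z : ~ R z -> exists n, rel z n.
Proof.
move=> Rz; pose B : set F := [set w | exists2 p : {poly F}, (forall i, R p`_i) & w = p.[z]].
have [|nB] := pselect (B y^-1).
  by move=> [p hp e]; exists (size p), p; split=> //; rewrite -e mulfV.
case: Rz; apply: (maxR (B := B)) => //; last first.
- by exists 'X; rewrite ?hornerX // => i; rewrite coefX; case: eqP.
- by move=> w Rw; exists w%:P; rewrite ?hornerC // => i; rewrite coefC; case: eqP.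
split=> [c|_ _ [p hp ->] [q hq ->]|_ _ [p hp ->] [q hq ->]].
- by exists (constF F c)%:P; rewrite ?hornerC // => i; rewrite coefC; case: eqP.
- by exists (p + q); rewrite ?hornerD // => i; rewrite coefD; exact: RD.
- exists (p * q); rewrite ?hornerM // => i; rewrite coefM.
  by apply: Rsum => j; exact: RM.
Qed.

(** Of two relations for [z] and [z^-1], the one of lower degree, normalized by
    [one_plus_unit] to have no constant term, eliminates the leading term of the
    other one.  The descent ends with an empty relation. *)
Lemma rel_absurd N (z : F) n m : (n + m <= N)%N -> z != 0 -> rel z n -> rel z^-1 m -> False.
Proof.
elim: N z n m => [|N IH] z n m nm z0 hz hzV.
  have n0 : n = 0%N by lia.
  move: hz; rewrite n0 => -[p []]; rewrite leqn0 size_poly_eq0 => /eqP-> _.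
  by rewrite horner0 mulr0 => /eqP; rewrite eq_sym oner_eq0.
wlog le : z n m nm z0 hz hzV / (m <= n)%N.
  move=> W; have [mn|/ltnW nm'] := leqP m n; first exact: (W z n m).
  by apply: (W z^-1 m n) => //; rewrite ?invr_eq0 ?invrK // addnC.
case: n nm le hz => [|n] nm le hz.
  case: hz => p []; rewrite leqn0 size_poly_eq0 => /eqP-> _.
  by rewrite horner0 mulr0 => /eqP; rewrite eq_sym oner_eq0.
apply: (IH z n m) => //.
case: hz => p [sp Rp ep]; case: hzV => q [sq Rq eq].
pose q1 := drop_poly 1 q; have [u0 Ru] := one_plus_unit (RN (Rq 0%N)).
set u := (1 + y * - q`_0) in u0 Ru.
have eu : u = y * (z^-1 * q1.[z^-1]).
  rewrite /u mulrN -{1}eq -mulrBr; congr (_ * _).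
  rewrite -{1}(poly_take_drop 1 q) hornerD expr1 hornerMX.
  have -> : take_poly 1 q = (q`_0)%:P.
    by apply/polyP => l; rewrite coef_take_poly coefC; case: l.
  by rewrite hornerC addrAC subrr add0r mulrC.
pose a := p`_n.
exists (take_poly n p + (u^-1 * y * a) *: \poly_(l < n) q1`_(n.-1 - l)); split.
- rewrite (leq_trans (size_polyD _ _)) // geq_max size_take_poly.
  by rewrite (leq_trans (size_scale_leq _ _)) // size_poly.
- move=> i; rewrite coefD coefZ coef_take_poly coef_poly; apply: RD.
    by case: ifP.
  apply: RM; first by apply: RM; [exact: RM | exact: Rp].
  by case: ifP => // _; rewrite coef_drop_poly.
rewrite -ep; congr (_ * _).
rewrite hornerD -[in RHS](poly_take_drop n p) hornerD; congr (_ + _).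
have -> : drop_poly n p = a%:P.
  apply/polyP => l; rewrite coef_drop_poly coefC; case: l => [|l]; first by rewrite add0n.
  by rewrite nth_default // (leq_trans sp) // addSn ltnS leq_addl.
rewrite hornerM hornerC hornerXn hornerZ horner_poly.
have sq1 : (size q1 <= n)%N by rewrite size_drop_poly leq_subLR; lia.
have -> : \sum_(i < n) q1`_(n.-1 - i) * z ^+ i = z ^+ n * (z^-1 * q1.[z^-1]).
  rewrite (horner_coef_wide _ sq1) (reindex_inj rev_ord_inj) /= !mulr_sumr.
  apply: eq_bigr => i _; rewrite mulrCA [in RHS]mulrA mulrCA.
  have -> : (n.-1 - (n - i.+1) = i)%N by have := ltn_ord i; lia.
  congr (_ * _); have e : z ^+ n = z ^+ (n - i.+1) * z ^+ i.+1.
    by rewrite -exprD subnK.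
  by rewrite [in RHS]e exprVn exprS mulrCA mulKf // mulfK ?expf_neq0.
have -> : u^-1 * y * a * (z ^+ n * (z^-1 * q1.[z^-1]))
    = u^-1 * (y * (z^-1 * q1.[z^-1])) * (a * z ^+ n).
  by ring.
by rewrite -eu mulVf // mul1r.
Qed.

Lemma val_ring z : ~ R z -> R z^-1.
Proof.
move=> Rz; apply: contrapT => RzV.
have z0 : z != 0 by apply/eqP => e; apply: Rz; rewrite e.
have [n hn] := rel_adjoin Rz; have [m hm] := rel_adjoin RzV.
exact: (rel_absurd (leqnn _) z0 hn hm).
Qed.

(** The maximal ideal of [R]; that it lies in [R] is [val_ring]. *)
Let mx z := z = 0 \/ ~ R z^-1.

Lemma mxR z : mx z -> R z.
Proof. by case=> [->//|/val_ring]; rewrite invrK. Qed.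

Lemma mxN z : ~ mx z -> R z^-1.
Proof. by move=> /not_orP[_ /contrapT]. Qed.

Lemma mxM r z : R r -> mx z -> mx (r * z).
Proof.
move=> Rr; have [->|r0] := eqVneq r 0; first by left; rewrite mul0r.
case=> [->|h]; first by left; rewrite mulr0.
right=> Rrz; apply: h; rewrite (_ : z^-1 = r * (r * z)^-1); first exact: RM.
by rewrite invfM mulrA mulfV // mul1r.
Qed.

Lemma mxD a b : mx a -> mx b -> mx (a + b).
Proof.
have [->|a0] := eqVneq a 0; first by rewrite add0r.
have [->|b0] := eqVneq b 0; first by rewrite addr0.
have W a' b' : b' != 0 -> mx b' -> R (a' / b') -> mx (a' + b').
  move=> b'0 mb h; rewrite (_ : a' + b' = (a' / b' + 1) * b').
    by apply: mxM => //; exact: RD.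
  by rewrite mulrDl mul1r divfK.
move=> ma mb; have [h|/val_ring] := pselect (R (a / b)); first exact: W.
by rewrite invf_div addrC; exact: W.
Qed.

Lemma mx_sum (I : Type) (s : seq I) (P : pred I) (f : I -> F) :
  (forall i, P i -> mx (f i)) -> mx (\sum_(i <- s | P i) f i).
Proof. by move=> h; apply: big_ind => //; [left | exact: mxD]. Qed.

Lemma mx_const c : mx (constF F c) -> c = 0.
Proof. by case=> [/eqP|[]]; [rewrite constF_eq0 => /eqP | rewrite -fmorphV; exact: RC]. Qed.

(** Elements with distinct nonnegative valuations, all smaller than that of [y],
    are k-independent modulo [y R], as the term of least valuation dominates a
    linear combination.  So there are at most [n] of them. *)
Lemma mx_chain_bounded n (f : nat -> F) :
  (forall m (u : 'I_m -> F), indep y u -> (m <= n)%N) ->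
  (forall i, (i <= n)%N -> f i != 0 /\ mx (y / f i)) ->
  (forall i, (i <= n)%N -> R (f i)) ->
  ~ (forall i j, (i < j <= n)%N -> mx (f i / f j)).
Proof.
move=> hn hf Rf hm; suff : indep y (fun i : 'I_n.+1 => f i) by move/hn; rewrite ltnn.
apply: (indep_mod sR) => // [i|c [z Rz e]]; first by apply: Rf; rewrite -ltnS.
apply: contrapT => /existsNP[j0 /eqP cj0].
case: (@arg_maxnP _ j0 (fun j => c j != 0) (fun j => j : nat) cj0) => j cj hj.
have jn : (j <= n)%N by rewrite -ltnS.
have [fj0 myj] := hf _ jn.
move/eqP: cj; apply; apply: mx_const.
have -> : constF F (c j) = z * (y / f j) - \sum_(i | i != j) constF F (c i) * (f i / f j).
  rewrite mulrA [z * y]mulrC -e (bigD1 j) //= mulrDl mulfK // mulr_suml.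
  rewrite [X in _ + _ - X](_ : _ = \sum_(i | i != j) constF F (c i) * f i / f j).
    by rewrite addrK.
  by apply: eq_bigr => i _; rewrite mulrA.
apply: mxD; first exact: mxM.
rewrite -mulN1r -(const1 F) -rmorphN; apply: mxM; [exact: RC | apply: mx_sum => i ij].
have [->|ci] := eqVneq (c i) 0; first by left; rewrite const0 mul0r.
apply: mxM; [exact: RC | apply: hm; rewrite jn andbT ltn_neqAle].
by have /= -> := hj _ ci; rewrite andbT; exact: ij.
Qed.

Lemma mx_y : mx y. Proof. by right. Qed.

(** Otherwise each element of the maximal ideal is a strict multiple of another
    one, and descending from [y] gives an arbitrarily long chain. *)
Lemma mx_generator : exists2 t, mx t /\ t != 0 & forall w, mx w -> R (w / t).
Proof.
have [n hn] := indep_bounded y.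
apply: contrapT => h.
have /choice[f hf] w : exists w', mx w -> w != 0 -> [/\ mx w', w' != 0 & mx (w / w')].
  have [mw|nmw] := pselect (mx w); last by exists 0.
  have [w0|] := eqVneq w 0; first by exists 0 => _; rewrite w0 eqxx.
  move=> w0; apply: contrapT => hw; apply: h; exists w => // w' mw'.
  apply: contrapT => hR; apply: hw; exists w' => _ _; split=> //.
    by apply/eqP => e; apply: hR; rewrite e mul0r.
  by right; rewrite invf_div.
pose g i := iter i f y.
have hg i : mx (g i) /\ g i != 0.
  elim: i => [|i [mi i0]]; first by split=> //; exact: mx_y.
  by have [] := hf _ mi i0.
have hS i : mx (g i / g i.+1) by have [mi i0] := hg i; have [] := hf _ mi i0.
have hlt d i : mx (g i / g (i + d).+1).
  elim: d => [|d IH]; first by rewrite addn0.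
  rewrite addnS (_ : g i / _ = (g i / g (i + d).+1) * (g (i + d).+1 / g (i + d).+2)).
    by apply: mxM; [exact: mxR | exact: hS].
  by rewrite mulrA divfK // (hg _).2.
apply: (@mx_chain_bounded n (fun i => g i.+1)) => //.
- by move=> i _; split; [exact: (hg _).2 | exact: (hlt i 0%N)].
- by move=> i _; apply: mxR; exact: (hg _).1.
- move=> i j /andP[ij _]; have -> : j = (i.+1 + (j - i.+1))%N by lia.
  exact: hlt.
Qed.

Let unitR (z : F) := [/\ z != 0, R z & R z^-1].

Lemma unitRM a b : unitR a -> unitR b -> unitR (a * b).
Proof.
by move=> [a0 Ra RVa] [b0 Rb RVb]; split; rewrite ?mulf_neq0 ?invfM //; exact: RM.
Qed.

Lemma unitRV a : unitR a -> unitR a^-1.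
Proof. by move=> [a0 Ra RVa]; split; rewrite ?invr_eq0 ?invrK. Qed.

Lemma mx_unit a : mx a -> ~ unitR a.
Proof. by move=> ma [a0 _ RVa]; case: ma => // /eqP; rewrite (negPf a0). Qed.

Lemma unit_ev (g : {poly k}) : g`_0 != 0 -> unitR (ev y g).
Proof.
move=> c0.
have gE : ev y g = constF F (g`_0) * (1 + y * ev y ((g`_0)^-1 *: drop_poly 1 g)).
  rewrite -{1}(poly_take_drop 1 g) expr1.
  have -> : take_poly 1 g = (g`_0)%:P.
    by apply/polyP => l; rewrite coef_take_poly coefC; case: l.
  rewrite evD evC evM evX mulrDr mulr1; congr (_ + _).
  rewrite -mul_polyC evM evC fmorphV [y * (_ * _)]mulrCA mulVKf ?constF_eq0 //.
  exact: mulrC.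
have [|n0 RV] := @one_plus_unit (ev y ((g`_0)^-1 *: drop_poly 1 g)).
  exact: subalg_ev.
split; first by rewrite gE mulf_neq0 // constF_eq0.
  exact: subalg_ev.
by rewrite gE invfM -fmorphV; apply: RM => //; exact: RC.
Qed.

(** In an algebraic equation of [z] over [k[y]] the term of lowest degree in [z] is
    minus the sum of the others, so [z] divides its coefficient, which is a power
    of [y] up to a unit. *)
Lemma divides_y_pow z : R z -> z != 0 -> exists a, R (y ^+ a / z).
Proof.
move=> Rz z0; have [m [g [j0 gj0] hg]] := alg_dep y z.
case: (@arg_minnP _ j0 (fun j => g j != 0) (fun j => j : nat) gj0) => j gj hj.
have [a [h h0 gE]] := multiplicity_XsubC (g j) 0.
move: h0 gE; rewrite gj /= subr0 /root horner_coef0 => h0 gE.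
have [u0 Ru RVu] := unit_ev h0.
exists a; pose w := \sum_(i < m | i != j) ev y (g i) * z ^+ (i - j.+1).
have Rw : R w by apply: subalg_sum => // i _; apply: RM; [exact: subalg_ev | exact: RX].
have e : ev y (g j) * z ^+ j = - (w * z ^+ j.+1).
  apply/eqP; rewrite -addr_eq0 -hg (bigD1 j) //= mulr_suml; apply/eqP; congr (_ + _).
  apply: eq_bigr => i ij; have [->|gi] := eqVneq (g i) 0; first by rewrite ev0 !mul0r.
  rewrite -mulrA -exprD subnK // ltn_neqAle; have /= -> := hj _ gi.
  by rewrite andbT eq_sym; exact: ij.
have {}e : y ^+ a * ev y h = - (w * z).
  apply: (mulIf (expf_neq0 j z0)); rewrite mulNr -[in RHS]mulrA -exprS -e gE.
  by rewrite evM evXn; congr (_ * _); rewrite mulrC.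
rewrite (_ : y ^+ a / z = - w * (ev y h)^-1); first by apply: RM => //; exact: RN.
by apply: (mulIf u0); rewrite mulrAC e -mulNr mulfK // divfK.
Qed.

Lemma power_of_generator t : mx t -> t != 0 -> (forall w, mx w -> R (w / t)) ->
  exists n, unitR (y / t ^+ n).
Proof.
move=> mt t0 ht; have [n hn] := indep_bounded y.
have ex : exists e, `[< ~ mx (y / t ^+ e) >].
  apply: contrapT => h.
  have my e : mx (y / t ^+ e) by apply: contrapT => he; apply: h; exists e; apply/asboolP.
  apply: (@mx_chain_bounded n (fun i => t ^+ (n - i))) => //.
  - by move=> i _; rewrite expf_neq0.
  - by move=> i _; apply: RX; exact: mxR.
  - move=> i j /andP[ij jn].
    have -> : t ^+ (n - i) / t ^+ (n - j) = t ^+ (j - i).-1 * t.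
      apply: (mulIf (expf_neq0 (n - j) t0)); rewrite divfK ?expf_neq0 //.
      by rewrite -exprSr -exprD; congr (_ ^+ _); lia.
    by apply: mxM => //; apply: RX; exact: mxR.
case: (ex_minnP ex) => e /asboolP he hmin; exists e.
have e0 : (0 < e)%N.
  by case: e he {hmin} => // he; case: he; rewrite expr0 divr1; exact: mx_y.
have m1 : mx (y / t ^+ e.-1).
  apply: contrapT => h; have := hmin e.-1 (introT (asboolP _) h).
  by rewrite leqNgt prednK // leqnn.
split; [by rewrite mulf_neq0 ?invr_eq0 ?expf_neq0 | | exact: mxN].
have := ht _ m1; rewrite -mulrA -invfM.
by rewrite -exprSr prednK.
Qed.

Lemma unit_times_power t : mx t -> t != 0 -> (forall w, mx w -> R (w / t)) ->
  forall z, z != 0 -> exists j : int, unitR (z * t ^ (- j)).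
Proof.
move=> mt t0 ht; have [n [yn0 Ryn RynV]] := power_of_generator mt t0 ht.
have W z : z != 0 -> R z -> exists j : int, unitR (z * t ^ (- j)).
  move=> z0 Rz; have [a Rya] := divides_y_pow Rz z0.
  have ex : exists j, `[< R (t ^+ j / z) >].
    exists (n * a)%N; apply/asboolP.
    rewrite (_ : t ^+ (n * a) / z = (y / t ^+ n)^-1 ^+ a * (y ^+ a / z)).
      by apply: RM => //; exact: RX.
    by rewrite invf_div expr_div_n -exprM mulrA divfK // expf_neq0.
  case: (ex_minnP ex) => j /asboolP hj hmin; exists j%:Z.
  rewrite -exprnN; split; [by rewrite mulf_neq0 ?invr_eq0 ?expf_neq0 | | by rewrite invf_div].
  case: j hj hmin => [|j] hj hmin; first by rewrite expr0 divr1.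
  have m1 : mx (z / t ^+ j).
    right; rewrite invf_div => h; have := hmin j (introT (asboolP _) h).
    by rewrite ltnn.
  by have := ht _ m1; rewrite -mulrA -invfM -exprSr.
move=> z z0; have [Rz|Rz] := pselect (R z); first exact: W.
have [|j /unitRV] := W z^-1 _ (val_ring Rz); first by rewrite invr_eq0.
by rewrite invfM invrK invr_expz => h; exists (- j).
Qed.

(** The valuation of [z] is the exponent [j] for which [z * t ^ (- j)] is a unit,
    [t] being a generator of the maximal ideal. *)
Lemma exists_place_of_ring : exists p : place F, 0 < p y.
Proof.
have [t [mt t0] ht] := mx_generator.
have /choice[f0 hf0] z : exists j : int, z != 0 -> unitR (z * t ^ (- j)).
  have [->|z0] := eqVneq z 0; first by exists 0.
  by have [j hj] := unit_times_power mt t0 ht z0; exists j.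
pose f z := if z == 0 then 0 else f0 z.
have hf z : z != 0 -> unitR (z * t ^ (- f z)).
  by move=> z0; rewrite /f (negPf z0); exact: hf0.
have tn0 j : t ^ j != 0 by rewrite expfz_neq0.
have Rt (n : nat) : R (t ^+ n) by apply: RX; exact: mxR.
have nonunit (j : int) s : 0 < j -> R s -> ~ unitR (s * t ^ j).
  case: j => // -[//|j] _ Rs; apply: mx_unit; rewrite -exprnP exprSr mulrA.
  by apply: mxM => //; exact: RM.
have uniq_unit i j z : unitR (z * t ^ i) -> unitR (z * t ^ j) -> i = j.
  wlog : i j / i <= j => [W|ij] hi hj.
    by have [ij|/ltW ij] := leP i j; [exact: W | apply/esym/W].
  apply/eqP; rewrite eq_le ij /= leNgt; apply/negP => lt.
  apply: (@nonunit (j - i) 1) => //; first by rewrite subr_gt0.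
  have := unitRM hj (unitRV hi); have [_ _] := hi.
  have z0 : z != 0 by have [] := hi; rewrite mulf_eq0 negb_or => /andP[].
  rewrite (_ : z * t ^ j * _ = 1 * t ^ (j - i)) //.
  by rewrite invfM mulrACA mulfV // invr_expz expfzDr.
have fE z j : unitR (z * t ^ (- j)) -> f z = j.
  move=> h; have z0 : z != 0 by have [] := h; rewrite mulf_eq0 negb_or => /andP[].
  by apply: oppr_inj; apply: uniq_unit h; exact: hf.
have f_0 : f 0 = 0 by rewrite /f eqxx.
have f_M a b : a != 0 -> b != 0 -> f (a * b) = f a + f b.
  move=> a0 b0; apply: fE; rewrite opprD expfzDr // mulrACA.
  by apply: unitRM; exact: hf.
have f_R s : s != 0 -> R s -> 0 <= f s.
  move=> s0 Rs; rewrite leNgt; apply/negP => lt.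
  by apply: (@nonunit (- f s) s) => //; [rewrite oppr_gt0 | exact: hf].
have f_ge0 s : s != 0 -> 0 <= f s -> R s.
  move=> s0 fs; have [_ h _] := hf _ s0.
  rewrite (_ : s = s * t ^ (- f s) * t ^ f s); last first.
    by rewrite -mulrA -expfzDr // addNr expr0z mulr1.
  by case: (f s) fs h => // n _ h; apply: RM => //; exact: (Rt n).
have f_t j : f (t ^ j) = j.
  apply: fE; rewrite -expfzDr // subrr expr0z; split; [exact: oner_neq0 | exact: R1 |].
  by rewrite invr1; exact: R1.
have f_D a b : a != 0 -> b != 0 -> a + b != 0 -> Num.min (f a) (f b) <= f (a + b).
  wlog le : a b / f a <= f b => [W|] a0 b0 ab0.
    have [h|/ltW h] := leP (f a) (f b).
      by apply: le_trans (W _ _ h a0 b0 ab0); rewrite le_min lexx.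
    by rewrite addrC; apply: le_trans (W _ _ h b0 a0 _); rewrite ?le_min ?lexx 1?addrC.
  have fa : f (a + b) = f ((a + b) * t ^ (- f a)) + f a.
    by rewrite f_M // f_t subrK.
  rewrite fa; apply: (@le_trans _ _ (f a)); first by rewrite ge_min lexx.
  rewrite lerDr; apply: f_R; first by rewrite mulf_neq0.
  rewrite mulrDl; apply: RD; first by have [] := hf _ a0.
  by apply: f_ge0; [rewrite mulf_neq0 | rewrite f_M // f_t subr_ge0].
pose v := Valuation f_0 f_M f_D.
have v1 : exists2 x, x != 0 & v x = 1 by exists (t ^ 1); rewrite // [LHS]f_t.
exists (Place v1) => /=; rewrite lt_neqAle f_R // andbT eq_sym; apply/eqP => e.
by have := hf _ y0; rewrite e oppr0 expr0z mulr1 => -[].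
Qed.

End PlaceExistence.

Section PoleExistence.
Variables (k : finFieldType) (F : fieldExtType {fraction {poly k}}).
Hypothesis k_const : is_constant_field F.

Lemma nonconstant_transcendental (x : F) (g : {poly k}) :
  (forall c, x <> constF F c) -> ev x g = 0 -> g = 0.
Proof.
move=> hx e; apply/eqP; apply: contrapT => /negP g0.
have [|c /hx//] := k_const (x := x).
by exists g => //; apply/rootP.
Qed.

(** Zorn's lemma provides the maximal subalgebra.  The predicate [P] speaks of
    the union with [k[y]] so that the empty chain, too, has an upper bound. *)
Lemma exists_zero (y : F) : (forall c, y <> constF F c) ->
  exists p : place F, 0 < p y.
Proof.
move=> hy; have y0 : y != 0 by apply/eqP => e; apply: (hy 0); rewrite const0.
pose B0 : set F := [set z | exists g, z = ev y g].
have B0P B : subalgebra B -> B y -> B0 `<=` B.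
  by move=> sB By z [g ->]; exact: subalg_ev.
pose P (A : set F) := subalgebra (A `|` B0) /\ ~ (A `|` B0) y^-1.
have sB0 : subalgebra B0.
  split=> [c|_ _ [g ->] [h ->]|_ _ [g ->] [h ->]]; first by exists c%:P; rewrite evC.
    by exists (g + h); rewrite evD.
  by exists (g * h); rewrite evM.
have nB0 : ~ B0 y^-1.
  move=> [g e]; have : ev y ('X * g - 1) = 0.
    by rewrite evB evM evX ev1 -e mulfV // subrr.
  move=> /(nonconstant_transcendental hy)/(congr1 (fun p : {poly k} => p`_0)).
  rewrite coefB coefXM coef1 coef0 /= sub0r => /eqP; by rewrite oppr_eq0 oner_eq0.
have [A [[sA nA] mA]] : exists A, P A /\ forall B, A `<` B -> ~ P B.
  apply: Zorn_bigcup => C CP tot; split; last first.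
    move=> [[X CX Xy]|//]; have [_ []] := CP _ CX; by left.
  have dir a b : ((\bigcup_(X in C) X) `|` B0) a -> ((\bigcup_(X in C) X) `|` B0) b ->
      B0 a /\ B0 b \/ exists X, [/\ C X, (X `|` B0) a & (X `|` B0) b].
    case=> [[X CX Xa]|Ba]; case=> [[Y CY Yb]|Bb]; last by left.
    - have [XY|YX] := tot _ _ CX CY; right.
        by exists Y; split=> //; left => //; exact: XY.
      by exists X; split=> //; left => //; exact: YX.
    - by right; exists X; split=> //; [left | right].
    - by right; exists Y; split=> //; [right | left].
  have up X : C X -> X `|` B0 `<=` (\bigcup_(X in C) X) `|` B0.
    by move=> CX z [Xz|Bz]; [left; exists X | right].
  have [B0C B0D B0M] := sB0.
  split=> [c|a b ha hb|a b ha hb]; first by right; exact: B0C.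
  - have [[Ba Bb]|[X [CX Xa Xb]]] := dir _ _ ha hb; first by right; exact: B0D.
    by apply: (up _ CX); have [[_ h _] _] := CP _ CX; exact: h.
  - have [[Ba Bb]|[X [CX Xa Xb]]] := dir _ _ ha hb; first by right; exact: B0M.
    by apply: (up _ CX); have [[_ _ h] _] := CP _ CX; exact: h.
apply: (@exists_place_of_ring _ _ y (A `|` B0)) => //.
  by right; exists 'X; rewrite evX.
move=> B sB AB nB; have By : B y by apply: AB; right; exists 'X; rewrite evX.
have BB0 : B `|` B0 = B by apply/seteqP; split=> [z [//|]|z Bz]; [exact: B0P | left].
apply: contrapT => BA; apply: (mA B); last by rewrite /P BB0.
split; last by move=> BA'; apply: BA => z /BA' Az; left.
by move=> z Az; apply: AB; left.
Qed.

Lemma regular_everywhere (x : F) : (forall p : place F, vge p 0 x) ->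
  exists c, x = constF F c.
Proof.
move=> hx; apply: contrapT => nx.
have x0 : x != 0 by apply/eqP => e; apply: nx; exists 0; rewrite const0.
have [c e|p] := @exists_zero x^-1.
  by apply: nx; exists c^-1; rewrite -[x]invrK e fmorphV.
by rewrite vV // oppr_gt0 ltNge (vgeE x0 (hx p)).
Qed.

End PoleExistence.

(** * Strong approximation *)

Section Riemann.
Variables (k : finFieldType) (F : fieldExtType {fraction {poly k}}).
Hypothesis k_const : is_constant_field F.
Variable infty : place F.
Implicit Types (p q : place F) (s : seq (place F)) (x y z : F).

Section ResidueSpace.
Variables (y : F) (hy : infty y = 1).

Let y0 : y != 0.
Proof. by apply: contra_eq_neq hy => ->; rewrite v0. Qed.

(** The zeros of [y] other than [infty] are those where poles must be removed. *)
Let Raway : set F := [set z | forall p, p <> infty /\ 0 < p y -> vge p 0 z].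
Let Rall : set F := [set z | forall p, 0 < p y -> vge p 0 z].

Let sRaway : subalgebra Raway. Proof. exact: ring_of_places. Qed.
Let sRall : subalgebra Rall. Proof. exact: ring_of_places. Qed.
Let Rawayy : Raway y. Proof. by move=> p [_ /ltW]; right. Qed.
Let Rally : Rall y. Proof. by move=> p /ltW; right. Qed.

Let free d (u : 'I_d -> F) := (forall j, Raway (u j)) /\
  (forall c : 'I_d -> k, (exists2 z, Raway z & \sum_j constF F (c j) * u j = y * z) ->
     forall j, c j = 0).

(** Families independent modulo [y Raway] have bounded size, so there is a maximal
    one. *)
Lemma residue_basis : exists d (u : 'I_d -> F), free u /\
  forall z, Raway z -> exists (c : 'I_d -> k), exists2 r, Raway r &
    z = \sum_j constF F (c j) * u j + y * r.
Proof.
have [n hn] := indep_bounded y.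
pose P d := `[< exists u : 'I_d -> F, free u >].
have ex : exists d, P d.
  by exists 0%N; apply/asboolP; exists (fun=> 0); split=> [[]|c _ []].
have le d : P d -> (d <= n)%N.
  by move=> /asboolP[u [hu fu]]; apply: hn; exact: (indep_mod sRaway Rawayy y0 hu fu).
case: (ex_maxnP ex le) => d /asboolP[u [hu fu]] mx; exists d, u; split=> // z Rz.
apply: contrapT => hz; suff : (d.+1 <= d)%N by rewrite ltnn.
apply: mx; apply/asboolP.
exists (fun i => if unlift ord0 i is Some j then u j else z); split=> [i|c].
  by case: (unlift ord0 i).
rewrite big_ord_recl unlift_none; under eq_bigr do rewrite liftK.
case=> r Rr e; have [_ _ RM] := sRaway; have [RC RD _] := sRaway.
have c0 : c ord0 = 0.
  apply/eqP; apply: contrapT => /negP c0; apply: hz.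
  exists (fun j => - (c ord0)^-1 * c (lift ord0 j)), (constF F (c ord0)^-1 * r).
    by apply: RM.
  have cF0 : constF F (c ord0) != 0 by rewrite constF_eq0.
  apply: (mulfI cF0); rewrite mulrDr [constF F (c ord0) * (y * _)]mulrCA.
  rewrite fmorphV mulVKf // -e addrC -addrA mulr_sumr -big_split /= big1 ?addr0 // => i _.
  by rewrite mulNr rmorphN rmorphM /= fmorphV mulNr mulrN -mulrA mulVKf // subrr.
move=> i; case: (unliftP ord0 i) => [j|] -> //; apply: (fu (fun j => c (lift ord0 j))).
by exists r; rewrite // -e c0 const0 mul0r add0r.
Qed.

Lemma residue_expansion d (u : 'I_d -> F) :
  (forall z, Raway z -> exists (c : 'I_d -> k), exists2 r, Raway r &
    z = \sum_j constF F (c j) * u j + y * r) ->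
  forall N z, Raway z -> exists C : 'M[k]_(d, N), exists2 r, Raway r &
    z = \sum_j ev y (rVpoly (row j C)) * u j + y ^+ N * r.
Proof.
move=> hu N z Rz.
have [p [sp [r Rr ->]]] : exists p : 'I_d -> {poly k}, (forall j, size (p j) <= N)%N /\
    exists2 r, Raway r & z = \sum_j ev y (p j) * u j + y ^+ N * r.
  elim: N z Rz => [|N IH] z Rz.
    exists (fun=> 0); split=> [j|]; first by rewrite size_poly0.
    by exists z; rewrite // expr0 mul1r big1 ?add0r // => j _; rewrite ev0 mul0r.
  have [c [r Rr ->]] := hu z Rz; have [p [sp [r' Rr' ->]]] := IH r Rr.
  exists (fun j => p j * 'X + (c j)%:P); split=> [j|].
    rewrite size_MXaddC; case: ifP => // _; exact: sp.
  exists r' => //; rewrite mulrDr exprS mulrA addrA; congr (_ + _).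
  rewrite mulr_sumr -big_split; apply: eq_bigr => j _ /=.
  by rewrite evD evM evX evC; ring.
exists (\matrix_(j, i) (p j)`_i), r => //; congr (_ + _); apply: eq_bigr => j _.
congr (ev y _ * _); apply/polyP => i; rewrite coef_rVpoly.
case: insubP => [l _ e|]; first by rewrite !mxE e.
by rewrite -leqNgt => hi; apply/leq_sizeP: hi; exact: sp.
Qed.

(** Weak approximation changes the family [u] modulo [y] so that it vanishes at
    [infty], and provides one more element, equal to 1 at [infty] and to 0 at the
    other zeros of [y].  The [d + 1] elements are independent modulo [y Rall]. *)
Lemma residue_dim d (u : 'I_d -> F) n : free u ->
  (forall m (w : 'I_m -> F), indep y w -> (m <= n)%N) -> (d < n)%N.
Proof.
move=> [hu fu] hn.
have [s hs] := finite_set_seq (finite_zeros y0).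
pose M := (\sum_(p <- s) `|p y|)%N.
have hM p : 0 < p y -> p y <= M%:Z.
  by move=> /hs ps; rewrite /M (big_rem p) //=; lia.
have M1 : 1 <= M%:Z by rewrite -hy; apply: hM; rewrite hy.
have /choice[b hb] : forall i : 'I_d.+1, exists b, forall p, p \in s ->
    vge p M%:Z (b - (if unlift ord0 i is Some j then
                       if p == infty then 0 else u j
                     else (p == infty)%:R)).
  by move=> i; exact: (weak_approximation _ (fun p => _)).
have hinf : infty \in s by apply/hs; rewrite /= hy.
have b0 : vge infty 1 (b ord0 - 1).
  by have := hb ord0 _ hinf; rewrite unlift_none eqxx; exact: vge_le.
have bj j : vge infty 1 (b (lift ord0 j)).
  have := hb (lift ord0 j) _ hinf; rewrite liftK eqxx subr0; exact: vge_le.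
have bu j p : p <> infty -> 0 < p y -> vge p (p y) (b (lift ord0 j) - u j).
  move=> pi py; have := hb (lift ord0 j) p ((hs p).2 py).
  by rewrite liftK; move/eqP/negPf: pi => ->; apply: vge_le; exact: hM.
suff : indep y b by exact: hn.
apply: (indep_mod sRall) => // [i p py|c [z Rz e]].
  have [->|pi] := eqVneq p infty.
    case: (unliftP ord0 i) => [j|] ->; first by apply: vge_le (bj j).
    by rewrite -[b _](subrK 1); apply: vgeD; [apply: vge_le b0 | exact: vge0_1].
  have ps := (hs p).2 py; have := hb i p ps.
  have MZ : 0 <= M%:Z by lia.
  move=> /(vge_le MZ); set bi := (if unlift _ _ is Some _ then _ else _) => h.
  rewrite -[b i](subrK bi); apply: vgeD h _; rewrite /bi.
  rewrite (negPf pi); case: (unlift ord0 i) => [j|]; last by left.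
  by apply: hu; split=> //; apply/eqP.
rewrite big_ord_recl in e.
have c0 : c ord0 = 0.
  apply: (@vge_const_gt0 _ _ infty _ 1) => //.
  have -> : constF F (c ord0) = y * z
      - \sum_(j < d) constF F (c (lift ord0 j)) * b (lift ord0 j)
      - constF F (c ord0) * (b ord0 - 1).
    by rewrite -e addrK mulrBr mulr1 subKr.
  apply: vgeB.
    apply: vgeB.
      by rewrite -[1]addr0; apply: vgeM; [right; rewrite hy | apply: Rz; rewrite hy].
    by apply: vge_sum => j _; apply: vgeMl => //; exact: vge_const.
  by apply: vgeMl => //; exact: vge_const.
move=> i; case: (unliftP ord0 i) => [j|] -> //; move: j.
apply: (fu (fun j => c (lift ord0 j))).
have RM : forall a b, Raway a -> Raway b -> Raway (a * b) by have [] := sRaway.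
exists (z - \sum_(j < d) constF F (c (lift ord0 j)) * ((b (lift ord0 j) - u j) / y)).
  move=> p [pi py]; apply: vgeB; first exact: Rz.
  apply: vge_sum => j _; apply: vgeMl; first exact: vge_const.
  by rewrite -(subrr (p y)); apply: vgeM; [exact: bu | right; rewrite vV].
rewrite mulrBr -e c0 const0 mul0r add0r mulr_sumr -sumrB; apply: eq_bigr => j _.
by rewrite [y * _]mulrCA [y * _]mulrC divfK // -mulrBr subKr.
Qed.

End ResidueSpace.

(** A single multiplier clears all the poles, so independence is preserved. *)
Lemma regularized_family n (w : 'I_n -> F) y : infty y = 1 -> indep y w ->
  exists w' : 'I_n -> F, indep y w' /\
    forall j p, p y <= 0 -> vge p 0 (w' j).
Proof.
move=> hy hw; have y0 : y != 0 by apply: contra_eq_neq hy => ->; rewrite v0.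
have /choice[f hf] j : exists s : seq (place F), forall p, p (w j) != 0 -> p \in s.
  have [->|w0] := eqVneq (w j) 0; first by exists [::] => p; rewrite v0 eqxx.
  have [s hs] := finite_set_seq (finite_nonunits w0).
  by exists s => p hp; apply/hs.
pose s := [seq p : place F <- flatten [seq f j | j <- enum 'I_n] | pval p y <= 0].
pose M := (\sum_(p <- s) \sum_j `|p (w j)|)%N.
have hM p j : p \in s -> (`|p (w j)| <= M)%N.
  by move=> ps; rewrite /M (big_rem p) //= (bigD1 j) //= -addnA leq_addr.
have [||h h0 [h1 h2]] := @vanishing_element _ _ y^-1 infty s M.
- by rewrite vV // hy.
- by move=> p; rewrite mem_filter => /andP[py _]; right; rewrite vV // oppr_ge0.
exists (fun j => h * w j); split.
  move=> g e; apply: hw; apply: (mulfI h0); rewrite mulr0 mulr_sumr -[RHS]e.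
  by apply: eq_bigr => j _; rewrite mulrCA.
move=> j p py; have hp : vge p 0 h by apply: h2; right; rewrite vV // oppr_ge0.
have [e|pw] := eqVneq (p (w j)) 0; first by apply: vge0M => //; right; rewrite e.
have ps : p \in s.
  rewrite mem_filter py; apply/flattenP; exists (f j); last exact: hf.
  by apply/mapP; exists j; rewrite ?mem_enum.
rewrite -(subrr M%:Z); apply: vgeM; first exact: h1.
by right; have := hM _ j ps; lia.
Qed.

(** A form of Riemann's inequality.  There are [q ^ (n * N)] combinations
    [z = \sum_j ev y (g j) * w j] with [g j] of degree less than [N], where [n] is
    the dimension of [F] over [k(y)].  Multiplied by a fixed power [y ^ c0] they
    are regular at the zeros of [y] other than [infty], and fall there into
    [q ^ (d * (N + c0))] classes modulo [y ^ (N + c0)], with [d < n]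
    ([residue_dim]).  For large [N] two of them are congruent, and their
    difference divided by [y ^ N] is regular away from [infty].  It vanishes at
    the poles of [y], so it is not constant and must have a pole at [infty]. *)
Theorem exists_pole_only_at_infty : exists t : F, infty t < 0 /\
  forall p, p <> infty -> vge p 0 t.
Proof.
have [y y0 hy] := pval_norm infty.
have [n [[w0 iw0] hn]] := max_indep y.
have [w [iw hw]] := regularized_family hy iw0.
have [d [u [fu hu]]] := residue_basis hy.
have dn := residue_dim hy fu hn.
have [s hs] := finite_set_seq (finite_zeros y0).
pose c0 := (\sum_(p <- s) \sum_j `|p (w j)|)%N.
have hc0 j p : p <> infty /\ 0 < p y -> vge p 0 (y ^+ c0 * w j).
  move=> [_ py]; rewrite -(subrr c0%:Z); apply: vgeM.
    by right; rewrite vX // pmulrn mulrzz; nia.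
  right; have /hs ps := py; have : (`|p (w j)| <= c0)%N; last by lia.
  by rewrite /c0 (big_rem p) //= (bigD1 j) //= -addnA leq_addr.
(* the least N with d * (N + c0) < (d + 1) * N *)
pose N := (d * c0).+1.
pose S (A : 'M[k]_(n, N)) := \sum_j ev y (rVpoly (row j A)) * w j.
pose Raway := [set z : F | forall p, p <> infty /\ 0 < p y -> vge p 0 z].
have sRaway : subalgebra Raway by exact: ring_of_places.
have := @pigeonhole 'M[k]_(n, N) 'M[k]_(d, N + c0) (fun A E => exists2 r, Raway r &
     y ^+ c0 * S A = \sum_j ev y (rVpoly (row j E)) * u j + y ^+ (N + c0) * r).
case=> [A||A [B [E [AB [r Rr eA] [r' Rr' eB]]]]].
- apply: (residue_expansion hu); rewrite /S mulr_sumr.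
  apply: subalg_sum => // j _ p py; rewrite mulrCA; apply: vge0M; last exact: hc0.
  by apply: vge_ev; right; case: py => _ /ltW.
- rewrite !card_mx ltn_exp2l; last exact: finNzRing_gt1.
  by apply: (@leq_trans (d.+1 * N)); [rewrite /N; nia | rewrite leq_mul2r dn orbT].
pose t := r - r'.
have yN0 m : y ^+ m != 0 by rewrite expf_neq0.
have tE : S (A - B) = y ^+ N * t.
  apply: (mulfI (yN0 c0)); rewrite mulrA -exprD addnC mulrBr.
  have -> : S (A - B) = S A - S B.
    by rewrite /S -sumrB; apply: eq_bigr => j _; rewrite !raddfB /= evB mulrBl.
  by rewrite mulrBr eA eB opprD addrACA subrr add0r.
have t0 : t != 0.
  apply: contraNneq AB => t0; move: tE; rewrite t0 mulr0 => /iw h.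
  rewrite -subr_eq0; apply/eqP/row_matrixP => j; rewrite row0.
  by apply: (can_inj (@rVpolyK _ N)); rewrite h linear0.
(* every term has a positive power of y^-1 *)
have t_E : t = \sum_j (\sum_i constF F ((A - B) j i) * (y^-1 ^+ (N - i))) * w j.
  apply: (mulfI (yN0 N)); rewrite -tE /S mulr_sumr; apply: eq_bigr => j _.
  rewrite mulrA ev_rVpoly mulr_sumr; congr (_ * _); apply: eq_bigr => i _.
  rewrite [in RHS]mulrCA mxE; congr (_ * _).
  by rewrite -{2}(subnK (ltnW (ltn_ord i))) exprD mulrAC -exprMn mulfV // expr1n mul1r.
have t_reg p : p <> infty -> vge p 0 t.
  move=> pi; have [py|py] := ltP 0 (p y).
    by apply: vgeB; [apply: Rr | apply: Rr'].
  rewrite t_E; apply: vge_sum => j _; apply: vge0M; last exact: hw.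
  apply: vge_sum => i _; apply: vge0M; first exact: vge_const.
  by apply: vge0X; right; rewrite vV // oppr_ge0.
exists t; split=> //; rewrite ltNge; apply/negP => ti.
have [|c tc] := @regular_everywhere _ _ k_const t.
  by move=> p; have [->|/eqP] := eqVneq p infty; [right | exact: t_reg].
have [c'|p] := exists_zero k_const (y := y^-1).
  by move=> /(congr1 infty); rewrite vV // hy v_const.
rewrite vV // oppr_gt0 => py; have py' : p y <= 0 by exact: ltW.
suff /(vgeE t0) : vge p 1 t by rewrite tc v_const.
rewrite t_E; apply: vge_sum => j _; rewrite -[1]addr0; apply: vgeM; last exact: hw.
apply: vge_sum => i _; apply: vgeMl; first exact: vge_const.
right; rewrite vX ?invr_eq0 // vV // pmulrn mulrzz; have := ltn_ord i; nia.
Qed.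

Lemma common_root_of_unity s x : x != 0 -> (forall p, p \in s -> p x = 0) ->
  exists2 n, (0 < n)%N & forall p, p \in s -> vge p 1 (x ^+ n - 1).
Proof.
move=> x0; elim: s => [_|p s IH hs]; first by exists 1%N.
have [|n n0 hn] := IH; first by move=> q qs; apply: hs; rewrite inE qs orbT.
have px : p x = 0 by apply: hs; rewrite mem_head.
have [m m0 hm] := residue_root_of_unity x0 px.
have W q a b : q x = 0 -> vge q 1 (x ^+ a - 1) -> vge q 1 (x ^+ (a * b) - 1).
  move=> qx h; rewrite exprM subrX1; apply: vgeMr => //.
  by apply: vge_sum => i _; do 2!apply: vge0X; right; rewrite qx.
exists (n * m)%N; first by rewrite muln_gt0 n0.
move=> q; rewrite inE => /orP[/eqP->|qs]; first by rewrite mulnC; exact: W.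
by apply: W; [apply: hs; rewrite inE qs orbT | exact: hn].
Qed.

(** Weak approximation gives [b0], correct at [s] and integral at the set [S] of
    zeros of some [g] regular away from [infty] and vanishing at [s].  At the other
    finite poles of [b0], forming [T], [g] is a unit, hence a root of unity in the residue
    fields.  So some [h = (1 - g ^ (n * B)) ^ B] vanishes to a high order at [T],
    while it is close to 1 at [S]; then [b0 * h] is the solution. *)
Theorem strong_approximation s (x : place F -> F) (M : int) :
  exists b, (forall p, p \in s -> p <> infty -> vge p M (b - x p)) /\
    forall p, p <> infty -> p \notin s -> vge p 0 b.
Proof.
have [t [ti ht]] := exists_pole_only_at_infty.
pose s1 := [seq p <- s | p != infty].
have s1i p : p \in s1 -> p <> infty by rewrite mem_filter => /andP[/eqP].
have [g g0 [gs gA]] := vanishing_element (s := s1) 1 ti (fun p hp => ht p (s1i p hp)).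
have {}gA p : p <> infty -> vge p 0 g by move=> /ht; exact: gA.
have [S0 hS0] := finite_set_seq (finite_zeros g0).
pose S := [seq p <- S0 | p != infty].
have hS p : p \in S <-> p <> infty /\ 0 < p g.
  rewrite mem_filter; split=> [/andP[/eqP h /hS0]//|[h /hS0 hp]].
  by rewrite hp andbT; apply/eqP.
have sS p : p \in s -> p <> infty -> p \in S.
  move=> ps pi; apply/hS; split=> //; have ps1 : p \in s1.
    by rewrite mem_filter ps andbT; apply/eqP.
  by have := vgeE g0 (gs _ ps1).
have [b0 hb0] := weak_approximation S (fun p => if p \in s then x p else 0) `|M|%:Z.
have [T hT] : exists T : seq (place F), forall p, p \in T <->
    [/\ p <> infty, p \notin S & p b0 < 0].
  apply: (@finite_set_seq _ [set p : place F | [/\ p <> infty, p \notin S & p b0 < 0]]).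
  have [->|b00] := eqVneq b0 0.
    rewrite (_ : [set p | _] = set0); first exact: finite_set0.
    by apply/seteqP; split=> // p [_ _]; rewrite v0 ltxx.
  by apply: sub_finite_set (finite_nonunits b00) => p [_ _] /=; rewrite lt_neqAle => /andP[].
have gT p : p \in T -> p g = 0.
  move=> /hT[pi /negP pS _]; apply/eqP; rewrite eq_le (vgeE g0 (gA _ pi)) andbT.
  by rewrite leNgt; apply/negP => h; apply: pS; apply/hS.
have [n n0 hn] := common_root_of_unity g0 gT.
(* B exceeds all the orders to be corrected, at S and at T *)
pose B := (`|M| + \sum_(p <- S ++ T) `|p b0|)%N.
have hB p : p \in S ++ T -> (`|M| + `|p b0| <= B)%N.
  by move=> hp; rewrite /B (big_rem p) //= leq_add2l leq_addr.
pose h := (1 - g ^+ (n * B)) ^+ B.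
have hA p : p <> infty -> vge p 0 h.
  by move=> pi; apply: vge0X; apply: vgeB; [exact: vge0_1 | exact: vge0X (gA _ pi)].
have hST p : p \in S -> vge p (- p b0 + `|M|%:Z) (h - 1).
  move=> pS; have [pi pg] := (hS p).1 pS.
  rewrite /h subrX1 addrAC subrr add0r; apply: vgeMr; last first.
    apply: vge_sum => i _; apply: vge0X; apply: vgeB; first exact: vge0_1.
    exact: vge0X (gA _ pi).
  apply: vgeN; right; rewrite vX // pmulrn mulrzz.
  have := hB p; rewrite mem_cat pS => /(_ isT) pB.
  apply: (@le_trans _ _ (n * B)%N%:Z); last by rewrite ler_peMl // -gtz0_ge1.
  by have := leq_pmull B n0; move: (n * B)%N => nB; lia.
have hTB p : p \in T -> vge p (- p b0) h.
  move=> pT; have := hB p; rewrite mem_cat pT orbT => /(_ isT) pB.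
  have h1 : vge p 1 (1 - g ^+ (n * B)).
    rewrite -opprB; apply: vgeN; rewrite exprM subrX1; apply: vgeMr; first exact: hn.
    by apply: vge_sum => i _; do 2!apply: vge0X; right; rewrite gT.
  have [B0|B0] := posnP B; first by right; rewrite /h B0 expr0 v_1; lia.
  by apply: vge_le (vgeX h1 B0); rewrite pmulrn mulrzz; lia.
have hb p : p \in S -> vge p `|M|%:Z (b0 * h - if p \in s then x p else 0).
  move=> pS; have := hb0 p pS; set xp := (if _ then _ else _) => hp.
  have -> : b0 * h - xp = b0 * (h - 1) + (b0 - xp) by ring.
  apply: vgeD hp; have [->|b00] := eqVneq b0 0; first by left; rewrite mul0r.
  have -> : `|M|%:Z = p b0 + (- p b0 + `|M|%:Z) by lia.
  by apply: vgeM; [right | exact: hST].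
exists (b0 * h); split=> [p ps pi|p pi ps].
  by have := hb p (sS p ps pi); rewrite ps; apply: vge_le; lia.
have [pS|pS] := boolP (p \in S).
  by have := hb p pS; rewrite (negPf ps) subr0; apply: vge_le; lia.
have [pb|pb] := leP 0 (p b0); first by apply: vge0M; [right | exact: hA].
rewrite -(subrr (p b0)); apply: vgeM; first by right.
by apply: hTB; apply/hT.
Qed.

End Riemann.

(** * Integral adeles and reduction modulo N *)

Lemma uval_map (R S : pzRingType) (f : {rmorphism R -> S}) (u : unit_of R) :
  uval (unit_map f u) = f (uval u).
Proof. by []. Qed.

Section IntegralAdeles.
Variables (F : fieldType) (infty : place F).
Variable Fv : forall v : place F, completion v.
Local Notation A := (Aring infty).
Local Notation Ahat := (Ahat infty Fv).
Local Notation P := (fullprod (fun p : fplace infty => Fv (sval p) : fieldType)).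
Local Notation vp p := (cval (Fv (sval p))).

Lemma ahval_inj (x y : Ahat) : (forall p, Defs.ahval x p = Defs.ahval y p) -> x = y.
Proof. by move=> e; apply: val_inj; apply: functional_extensionality_dep. Qed.

Lemma ahvalD (x y : Ahat) p : Defs.ahval (x + y) p = Defs.ahval x p + Defs.ahval y p.
Proof. exact: (congr1 (fun f : P => f p) (raddfD (val : Ahat -> P) x y)). Qed.
Lemma ahvalB (x y : Ahat) p : Defs.ahval (x - y) p = Defs.ahval x p - Defs.ahval y p.
Proof. exact: (congr1 (fun f : P => f p) (raddfB (val : Ahat -> P) x y)). Qed.
Lemma ahvalM (x y : Ahat) p : Defs.ahval (x * y) p = Defs.ahval x p * Defs.ahval y p.
Proof. exact: (congr1 (fun f : P => f p) (rmorphM (val : Ahat -> P) x y)). Qed.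
Lemma ahval1 p : Defs.ahval (1 : Ahat) p = 1.
Proof. exact: (congr1 (fun f : P => f p) (rmorph1 (val : Ahat -> P))). Qed.
Lemma ahval0 p : Defs.ahval (0 : Ahat) p = 0.
Proof. exact: (congr1 (fun f : P => f p) (raddf0 (val : Ahat -> P))). Qed.
Lemma ahval_sum (I : Type) (s : seq I) (Q : pred I) (f : I -> Ahat) p :
  Defs.ahval (\sum_(i <- s | Q i) f i) p = \sum_(i <- s | Q i) Defs.ahval (f i) p.
Proof.
by apply: (big_morph (fun x => Defs.ahval x p)) => [x y|];
  [exact: ahvalD | exact: ahval0].
Qed.
Lemma ahval_A (a : A) p : Defs.ahval (A_to_Ahat Fv a) p = cemb (Fv (sval p)) (Aval a).
Proof. by []. Qed.

Lemma AhatP (x : Ahat) p : vge (vp p) 0 (Defs.ahval x p).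
Proof. by have /asboolP := ahvalP x; apply. Qed.

Lemma Ahat_of (f : forall p : fplace infty, Fv (sval p)) :
  (forall p, vge (vp p) 0 (f p)) -> exists x : Ahat, forall p, Defs.ahval x p = f p.
Proof.
move=> hf; have fP : (f : P) \in @Ahat_pred F infty Fv by apply/asboolP.
by exists (MkAhat fP).
Qed.

Lemma AvalB (a b : A) : Aval (a - b) = Aval a - Aval b.
Proof. exact: (raddfB (val : A -> F)). Qed.
Lemma AvalD (a b : A) : Aval (a + b) = Aval a + Aval b.
Proof. exact: (raddfD (val : A -> F)). Qed.
Lemma AvalM (a b : A) : Aval (a * b) = Aval a * Aval b.
Proof. exact: (rmorphM (val : A -> F)). Qed.
Lemma Aval_inj (a b : A) : Aval a = Aval b -> a = b.
Proof. exact: (@val_inj _ _ A). Qed.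
Lemma Aval1 : Aval (1 : A) = 1.
Proof. exact: (rmorph1 (val : A -> F)). Qed.
Lemma Aval0 : Aval (0 : A) = 0.
Proof. exact: (raddf0 (val : A -> F)). Qed.
Lemma Aval_sum (I : Type) (s : seq I) (Q : pred I) (f : I -> A) :
  Aval (\sum_(i <- s | Q i) f i) = \sum_(i <- s | Q i) Aval (f i).
Proof. exact: (raddf_sum (val : A -> F)). Qed.

Lemma A_to_AhatB (a b : A) : A_to_Ahat Fv (a - b) = A_to_Ahat Fv a - A_to_Ahat Fv b.
Proof. by apply: ahval_inj => p; rewrite ahvalB !ahval_A AvalB rmorphB. Qed.
Lemma A_to_AhatM (a b : A) : A_to_Ahat Fv (a * b) = A_to_Ahat Fv a * A_to_Ahat Fv b.
Proof. by apply: ahval_inj => p; rewrite ahvalM !ahval_A AvalM rmorphM. Qed.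
Lemma A_to_Ahat1 : A_to_Ahat Fv (1 : A) = 1.
Proof. by apply: ahval_inj => p; rewrite ahval1 ahval_A Aval1 rmorph1. Qed.

Lemma AregP (a : A) p : p <> infty -> vge p 0 (Aval a).
Proof. by have /asboolP := AvalP a; apply. Qed.

Lemma A_of (x : F) : (forall p, p <> infty -> vge p 0 x) -> exists a : A, Aval a = x.
Proof.
move=> hx; have xP : x \in regular infty by apply/asboolP.
by exists (MkA xP).
Qed.

Lemma vge_cemb (v : place F) n x : vge (cval (Fv v)) n (cemb (Fv v) x) <-> vge v n x.
Proof.
split=> [[/eqP|h]|[->|h]].
- by rewrite fmorph_eq0 => /eqP; left.
- by right; rewrite -(cval_ext (Fv v)).
- by left; rewrite rmorph0.
- by right; rewrite cval_ext.
Qed.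

Lemma Ahat_unit_val (u : unit_of Ahat) p :
  Defs.ahval (uval u) p != 0 /\ vp p (Defs.ahval (uval u) p) = 0.
Proof.
have e : Defs.ahval (uval u) p * Defs.ahval (uinv u) p = 1.
  by rewrite -ahvalM uvalK ahval1.
have [x0 y0] : Defs.ahval (uval u) p != 0 /\ Defs.ahval (uinv u) p != 0.
  by apply/andP; rewrite -negb_or -mulf_eq0 e oner_eq0.
split=> //; have := congr1 (vp p) e; rewrite vM // v_1.
have := vgeE x0 (AhatP _ p); have := vgeE y0 (AhatP _ p).
move: (vp p _) (vp p _) => a b; lia.
Qed.

Lemma fullprodM (x y : P) p : (x * y) p = x p * y p. Proof. by []. Qed.

Lemma adval_Ahat (x : Ahat) p :
  advalR infty Fv (Ahat_to_adele infty Fv x) p = Defs.ahval x p.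
Proof. by []. Qed.

Lemma adval_mul (x y : adele infty Fv) p :
  advalR infty Fv (x * y) p = advalR infty Fv x p * advalR infty Fv y p.
Proof. by rewrite rmorphM fullprodM. Qed.

Lemma diagF_at (x : F) p : diagF infty Fv x p = cemb (Fv (sval p)) x.
Proof. by []. Qed.

End IntegralAdeles.

Section Reduction.
Variables (k : finFieldType) (F : fieldExtType {fraction {poly k}}).
Hypothesis k_const : is_constant_field F.
Variables (infty : place F) (Fv : forall v : place F, completion v).
Local Notation A := (Aring infty).
Local Notation Ahat := (Ahat infty Fv).
Local Notation vp p := (cval (Fv (sval p))).
Variable N : idealr A.
Hypothesis N_neq0 : exists2 a : A, a \in (N : {pred A}) & a != 0.

Lemma Aval_eq0 (a : A) : (Aval a == 0) = (a == 0).
Proof.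
by apply/eqP/eqP => [e|->]; [apply: Aval_inj; rewrite e Aval0 | exact: Aval0].
Qed.

Lemma idealM (a b : A) : b \in (N : {pred A}) -> a * b \in (N : {pred A}).
Proof. exact: idealMr. Qed.

Lemma v_ge0 p (a : A) : p <> infty -> Aval a != 0 -> 0 <= p (Aval a).
Proof. by move=> pi a0; apply: vgeE => //; exact: AregP. Qed.

Lemma minimal_at p : p <> infty -> exists m : A,
  [/\ m \in (N : {pred A}), Aval m != 0 &
      forall n : A, n \in (N : {pred A}) -> vge p (p (Aval m)) (Aval n)].
Proof.
move=> pi; have [n0 Nn0 n00] := N_neq0.
pose Q j := `[< exists m : A, [/\ m \in (N : {pred A}), Aval m != 0 & p (Aval m) = j%:Z] >].
have ex : exists j, Q j.
  exists `|p (Aval n0)|%N; apply/asboolP; exists n0; rewrite Aval_eq0; split=> //.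
  by rewrite gez0_abs // v_ge0 ?Aval_eq0.
case: (ex_minnP ex) => j /asboolP[m [Nm m0 pm]] hmin; exists m; split=> // n Nn.
have [->|nn0] := eqVneq (Aval n) 0; first by left.
right; rewrite pm -(gez0_abs (v_ge0 pi nn0)) lez_nat; apply: hmin; apply/asboolP.
by exists n; split=> //; rewrite gez0_abs // v_ge0.
Qed.

(** Combine elements minimal at each place with coefficients in A that are close to
    1 at one of the places and to 0 at the others. *)
Lemma minimal_element (s : seq (place F)) : exists m : A,
  [/\ m \in (N : {pred A}), Aval m != 0 & forall p, p \in s -> p <> infty ->
      forall n : A, n \in (N : {pred A}) -> vge p (p (Aval m)) (Aval n)].
Proof.
wlog [us si] : s / uniq s /\ forall p, p \in s -> p <> infty => [W|].
  have [|m [Nm m0 hm]] := W (undup [seq p <- s | p != infty]).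
    by rewrite undup_uniq; split=> // p; rewrite mem_undup mem_filter => /andP[/eqP].
  exists m; split=> // p ps pi; apply: hm => //.
  by rewrite mem_undup mem_filter ps andbT; apply/eqP.
case: s us si => [_ _|p0 s' us si].
  by have [n0 Nn0 n00] := N_neq0; exists n0; rewrite Aval_eq0.
move: (p0 :: s') us si (mem_head p0 s') => s us si p0s.
have /choice[m hm] p : exists m : A, p <> infty ->
  [/\ m \in (N : {pred A}), Aval m != 0 &
      forall n : A, n \in (N : {pred A}) -> vge p (p (Aval m)) (Aval n)].
  have [->|/eqP pi] := eqVneq p infty; first by exists 0.
  by have [m hm] := minimal_at pi; exists m.
pose M := (\sum_(p <- s) `|p (Aval (m p))|).+1.
have hM p : p \in s -> p (Aval (m p)) < M%:Z.
  by move=> ps; rewrite /M (big_rem p) //=; lia.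
have /choice[c hc] p : exists c : A, forall q, q \in s ->
    vge q M%:Z (Aval c - (q == p)%:R).
  have [b [hb1 hb2]] := strong_approximation k_const infty s (fun q => (q == p)%:R) M.
  have [|c ec] := @A_of _ infty b.
    move=> q qi; have [qs|qs] := boolP (q \in s); last exact: hb2.
    rewrite -[b](subrK (q == p)%:R); apply: vgeD; first exact: vge_le (hb1 q qs qi).
    by case: eqP => _; [exact: vge0_1 | left].
  by exists c => q qs; rewrite ec; apply: hb1 => //; exact: si.
pose n1 := \sum_(p <- s) c p * m p.
have hn1 q : q \in s -> Aval n1 != 0 /\ q (Aval n1) = q (Aval (m q)).
  move=> qs; have qi := si _ qs; have [Nm m0 hmq] := hm _ qi.
  have -> : Aval n1 = Aval (m q) + ((Aval (c q) - 1) * Aval (m q) +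
      \sum_(p <- s | p != q) Aval (c p) * Aval (m p)).
    rewrite /n1 Aval_sum (bigD1_seq q) // AvalM addrA; congr (_ + _); first by ring.
  apply: v_dom => //; apply: vgt_ge (hM _ qs) _; apply: vgeD.
    by apply: vgeMr; [have := hc q q qs; rewrite eqxx | exact: AregP].
  apply: vge_sum => p pq; apply: vgeMr; last exact: AregP.
  by have := hc p q qs; rewrite eq_sym (negPf pq) subr0.
exists n1; split; last 1 first.
- by move=> p ps pi n Nn; rewrite (hn1 _ ps).2; have [_ _] := hm _ pi; exact.
- rewrite /n1 big_seq; apply: rpred_sum => p ps; apply: idealM.
  by have [] := hm _ (si _ ps).
- exact: (hn1 _ p0s).1.
Qed.

(** With [n0] nonzero in [N] and [n1] in [N] of least valuation at the places
    where [n0] vanishes, [n0] and [n1] generate [N]: if [a] satisfies the local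
    conditions, choose [z] in A so close to [a / n1] at these places that [n0]
    divides [a - n1 * z].  In the closure of [N], the coefficients of [n0] and
    [n1] may even be chosen place by place. *)
Lemma ideal_local : exists b : place F -> int, exists s : seq (place F),
  [/\ forall p, p <> infty -> 0 <= b p,
      forall p, p <> infty -> p \notin s -> b p = 0,
      forall a : A, a \in (N : {pred A}) <-> forall p, p <> infty -> vge p (b p) (Aval a)
    & forall x : Ahat, NAhat N x <-> forall p, vge (vp p) (b (sval p)) (Defs.ahval x p)].
Proof.
have [n0 Nn0] := N_neq0; rewrite -Aval_eq0 => n00.
have [s hs] := finite_set_seq (finite_nonunits n00).
have [n1 [Nn1 n10 hn1]] := minimal_element s.
pose b p := if p \in s then p (Aval n1) else 0.
have n0s p : p \notin s -> p (Aval n0) = 0.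
  by move=> ps; apply/eqP; apply: contraNT ps => h; apply/hs.
have Nb (a : A) : a \in (N : {pred A}) -> forall p, p <> infty -> vge p (b p) (Aval a).
  by move=> Na p pi; rewrite /b; case: ifP => ps; [exact: hn1 | exact: AregP].
exists b, s; split=> [p pi|p pi|a|x].
- by rewrite /b; case: ifP => // _; exact: v_ge0.
- by rewrite /b => /negPf->.
- split=> [|ha]; first exact: Nb.
  pose M := (\sum_(p <- s) `|p (Aval n0)|)%N.
  have hM p : p \in s -> p (Aval n0) <= M%:Z.
    by move=> ps; rewrite /M (big_rem p) //=; lia.
  have [z [hz1 hz2]] := strong_approximation k_const infty s (fun=> Aval a / Aval n1) M.
  have z_int p : p <> infty -> vge p 0 z.
    move=> pi; have [ps|ps] := boolP (p \in s); last exact: hz2.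
    rewrite -[z](subrK (Aval a / Aval n1)); apply: vgeD; first exact: vge_le (hz1 p ps pi).
    rewrite -(subrr (p (Aval n1))); apply: vgeM; last by right; rewrite vV.
    by have := ha _ pi; rewrite /b ps.
  have [z' ez] := A_of z_int.
  have [|y ey] := @A_of _ infty ((Aval a - Aval n1 * z) / Aval n0).
    move=> p pi; have [ps|ps] := boolP (p \in s).
      have -> : Aval a - Aval n1 * z = - (Aval n1 * (z - Aval a / Aval n1)).
        by rewrite mulrBr [Aval n1 * (_ / _)]mulrC divfK // opprB.
      rewrite -(subrr (p (Aval n0))); apply: vgeM; last by right; rewrite vV.
      apply: vgeN; apply: vgeMl; first exact: AregP.
      by apply: vge_le (hz1 p ps pi); exact: hM.
    apply: vge0M; last by right; rewrite vV // n0s.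
    by apply: vgeB; [exact: AregP | apply: vge0M; [exact: AregP | exact: z_int]].
  have -> : a = z' * n1 + y * n0.
    apply: Aval_inj; rewrite AvalD !AvalM ez ey divfK //.
    by rewrite [z * _]mulrC addrC subrK.
  by apply: rpredD; exact: idealM.
split=> [[m [a [y [Na ->]]]] p|hx].
  rewrite ahval_sum; apply: vge_sum => i _; rewrite ahvalM ahval_A.
  by apply: vgeMr; [apply/vge_cemb; exact: Nb (svalP p) | exact: AhatP].
have emb0 (a : A) p : Aval a != 0 -> cemb (Fv p) (Aval a) != 0 by rewrite fmorph_eq0.
have [|y0 hy0] := @Ahat_of _ infty Fv
    (fun p => if sval p \in s then 0 else Defs.ahval x p / cemb _ (Aval n0)).
  move=> p; case: ifP => ps; first by left.
  apply: vge0M; first exact: AhatP.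
  by right; rewrite vV ?emb0 // cval_ext n0s ?ps // oppr0.
have [|y1 hy1] := @Ahat_of _ infty Fv
    (fun p => if sval p \in s then Defs.ahval x p / cemb _ (Aval n1) else 0).
  move=> p; case: ifP => ps; last by left.
  rewrite -(subrr (sval p (Aval n1))); apply: vgeM; last by right; rewrite vV ?emb0 // cval_ext.
  by have := hx p; rewrite /b ps.
exists 2%N, (fun i => if i == ord0 then n0 else n1), (fun i => if i == ord0 then y0 else y1).
split=> [i|]; first by case: ifP.
apply: ahval_inj => p; rewrite 2!big_ord_recl big_ord0 addr0 ahvalD !ahvalM !ahval_A /= hy0 hy1.
case: ifP => ps; rewrite mulr0 ?add0r ?addr0 mulrC divfK // emb0 //.
Qed.

(** By [ideal_local], closeness modulo N is a condition of finite order at finitely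
    many places and integrality elsewhere. *)
Lemma Ahat_dense (x : Ahat) : exists a : A, NAhat N (x - A_to_Ahat Fv a).
Proof.
have [b [s [b0 bs hA hx]]] := ideal_local.
pose M := (\sum_(p <- s) `|b p|)%N.
have hM p : p \in s -> b p <= M%:Z.
  by move=> ps; rewrite /M (big_rem p) //=; lia.
have /choice[z hz] p : exists z : F, forall h : p <> infty,
    vge (cval (Fv p)) M (Defs.ahval x (exist _ p h) - cemb (Fv p) z).
  have [->|/eqP pi] := eqVneq p infty; first by exists 0.
  have [z hz] := c_dense (Defs.ahval x (exist _ p pi)) M.
  by exists z => h; rewrite (Prop_irrelevance h pi).
have [c [hc1 hc2]] := strong_approximation k_const infty s z M.
have xc p : sval p \in s -> vge (vp p) M (Defs.ahval x p - cemb (Fv (sval p)) c).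
  move=> ps; case: p ps => p pi /= ps.
  rewrite -[Defs.ahval x _](subrK (cemb (Fv p) (z p))) -addrA -rmorphB.
  apply: vgeD; first exact: hz.
  by apply/vge_cemb; rewrite -opprB; apply: vgeN; exact: hc1.
have [|a ea] := @A_of _ infty c.
  move=> p pi; have [ps|ps] := boolP (p \in s); last exact: hc2.
  apply/(@vge_cemb _ Fv).
  have := xc (exist _ p pi) ps; set X := Defs.ahval x _ => h.
  rewrite -[cemb _ c](subKr X); apply: vgeB; first exact: (AhatP x (exist _ p pi)).
  by apply: vge_le h.
exists a; apply/hx => p; rewrite ahvalB ahval_A ea.
have [ps|ps] := boolP (sval p \in s); first by apply: vge_le (xc _ ps); exact: hM.
rewrite bs //; last exact: (svalP p).
by apply: vgeB; [exact: AhatP | rewrite -ea -ahval_A; exact: AhatP].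
Qed.

Lemma NAhat_A (a : A) : NAhat N (A_to_Ahat Fv a) <-> a \in (N : {pred A}).
Proof.
have [b [s [b0 bs hA hx]]] := ideal_local; split.
  move=> /hx h; apply/hA => p pi; have := h (exist _ p pi).
  by rewrite ahval_A => /vge_cemb.
by move=> /hA h; apply/hx => p; rewrite ahval_A; apply/vge_cemb; exact: h (svalP p).
Qed.

Lemma pi_eqP (a b : A) : \pi_{ideal_quot N} a = \pi_{ideal_quot N} b <->
  a - b \in (N : {pred A}).
Proof. by rewrite Quotient.idealrBE; split=> [->|/eqP]. Qed.

Lemma reduceE (x : Ahat) (a : A) : NAhat N (x - A_to_Ahat Fv a) ->
  reduce N x = \pi_{ideal_quot N} a.
Proof.
move=> h; apply: xget_unique; first by exists a.
move=> _ [b -> hb]; apply/pi_eqP; apply/NAhat_A; rewrite A_to_AhatB.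
rewrite (_ : _ - _ = (x - A_to_Ahat Fv a) - (x - A_to_Ahat Fv b)); last by ring.
by apply: NAhatD => //; exact: NAhatN.
Qed.

Lemma reduce_A (a : A) : reduce N (A_to_Ahat Fv a) = \pi_{ideal_quot N} a.
Proof. by apply: reduceE; rewrite subrr; exact: NAhat0. Qed.

Lemma reduce_lift (x : Ahat) : exists2 a : A, reduce N x = \pi_{ideal_quot N} a &
  NAhat N (x - A_to_Ahat Fv a).
Proof. by have [a ha] := Ahat_dense x; exists a => //; exact: reduceE. Qed.

Fact reduce_zmod_morphism : zmod_morphism (reduce N : Ahat -> {ideal_quot N}).
Proof.
move=> x y; have [a -> ha] := reduce_lift x; have [b -> hb] := reduce_lift y.
rewrite -(rmorphB (\pi_{ideal_quot N})); apply: reduceE; rewrite A_to_AhatB.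
rewrite (_ : _ - _ = (x - A_to_Ahat Fv a) - (y - A_to_Ahat Fv b)); last by ring.
by apply: NAhatD => //; exact: NAhatN.
Qed.

Fact reduce_monoid_morphism : monoid_morphism (reduce N : Ahat -> {ideal_quot N}).
Proof.
split=> [|x y]; first by rewrite -A_to_Ahat1 reduce_A rmorph1.
have [a -> ha] := reduce_lift x; have [b -> hb] := reduce_lift y.
rewrite -(rmorphM (\pi_{ideal_quot N})); apply: reduceE; rewrite A_to_AhatM.
rewrite (_ : _ - _ = y * (x - A_to_Ahat Fv a) + A_to_Ahat Fv a * (y - A_to_Ahat Fv b)).
  by apply: NAhatD; exact: NAhatM.
by ring.
Qed.

(** [reduce] is defined by a choice, so its morphism structure depends on the
    hypotheses of this section. *)
Definition reduceR : {rmorphism Ahat -> {ideal_quot N}} :=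
  HB.pack (reduce N : Ahat -> {ideal_quot N})
    (GRing.isZmodMorphism.Build _ _ _ reduce_zmod_morphism)
    (GRing.isMonoidMorphism.Build _ _ _ reduce_monoid_morphism).

Lemma reduceRE x : reduceR x = reduce N x. Proof. by []. Qed.

Lemma reduceM (x y : Ahat) : reduce N (x * y) = reduce N x * reduce N y.
Proof. exact: reduce_monoid_morphism.2. Qed.

Lemma reduce1 : reduce N (1 : Ahat) = 1.
Proof. exact: reduce_monoid_morphism.1. Qed.

Lemma reduce_unitV (x : unit_of Ahat) :
  reduce N (uval x) * reduce N (uval x^-1%g) = 1.
Proof. by rewrite -reduceM (uvalK x) reduce1. Qed.

Lemma reduce_eq0 (x : Ahat) : reduce N x = 0 <-> NAhat N x.
Proof.
split=> [|h]; last first.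
  rewrite -(rmorph0 (\pi_{ideal_quot N})); apply: reduceE.
  by rewrite (_ : A_to_Ahat Fv 0 = 0) ?subr0 // -(subrr 0) A_to_AhatB subrr.
have [a -> ha] := reduce_lift x; rewrite -(rmorph0 (\pi_{ideal_quot N})).
move=> /pi_eqP; rewrite subr0 => /(@NAhat_A) Na.
by rewrite -[x](subrK (A_to_Ahat Fv a)); exact: NAhatD.
Qed.

Lemma reduce_eq (x y : Ahat) : reduce N x = reduce N y <-> NAhat N (x - y).
Proof.
rewrite -reduce_eq0 -!reduceRE rmorphB; split=> [->|/eqP]; first by rewrite subrr.
by rewrite subr_eq0 => /eqP.
Qed.

Lemma KN_det r (g : GL r Ahat) : KN N g -> NAhat N (uval (det_GL g) - 1).
Proof.
move=> hg; apply/reduce_eq; rewrite -!reduceRE -[uval _]/(\det (GLmx g)) -det_map_mx rmorph1.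
rewrite (_ : map_mx _ _ = 1%:M) ?det1 //; apply/matrixP => i j.
have := hg i j; rewrite !mxE => /reduce_eq.
by rewrite -!reduceRE => ->; rewrite rmorphMn rmorph1.
Qed.

(** An element of A that is invertible modulo N has valuation 0 at the places
    dividing N.  Replacing it by 1 wherever its valuation is positive makes it an
    integral unit without changing its class. *)
Lemma unit_lift (u : unit_of {ideal_quot N}) :
  exists x : unit_of Ahat, reduce N (uval x) = uval u.
Proof.
have [b [s [b0 bs hA hx]]] := ideal_local.
have [a ea] : exists a, uval u = \pi_{ideal_quot N} a.
  by exists (repr (uval u)); rewrite reprK.
have [c ec] : exists a, uinv u = \pi_{ideal_quot N} a.
  by exists (repr (uinv u)); rewrite reprK.
have Nac : a * c - 1 \in (N : {pred A}).
  apply/pi_eqP; rewrite rmorphM rmorph1.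
  by have := uvalK u; rewrite ea ec.
have key p : p <> infty -> vge p 1 (Aval a) -> b p = 0.
  move=> pi pa; apply/eqP; rewrite eq_le b0 // andbT leNgt; apply/negP => bp.
  have h1 : vge p 1 (Aval a * Aval c - 1).
    by have /hA/(_ p pi) := Nac; rewrite AvalB AvalM Aval1; apply: vge_le; lia.
  have h2 : vge p 1 (Aval a * Aval c) by apply: vgeMr => //; exact: AregP.
  have := vgeB h2 h1; rewrite subKr => /(vgeE (oner_neq0 F)).
  by rewrite v_1.
pose f (p : fplace infty) : F := if (Aval a != 0) && (sval p (Aval a) == 0) then Aval a else 1.
have f0 p : f p != 0 by rewrite /f; case: ifP => [/andP[]//|_]; exact: oner_neq0.
have pf (p : fplace infty) : sval p (f p) = 0.
  by rewrite /f; case: ifP => [/andP[_ /eqP]//|_]; rewrite v_1.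
have [|x hxf] := @Ahat_of _ infty Fv (fun p => cemb _ (f p)).
  by move=> p; right; rewrite cval_ext pf.
have [|y hyf] := @Ahat_of _ infty Fv (fun p => cemb _ (f p)^-1).
  by move=> p; right; rewrite cval_ext vV // pf oppr0.
have xy : x * y = 1.
  by apply: ahval_inj => p; rewrite ahvalM hxf hyf -rmorphM mulfV // rmorph1 ahval1.
have yx : y * x = 1 by rewrite mulrC.
exists (UnitOf xy yx); rewrite ea; apply: reduceE; rewrite -[uval _]/x; apply/hx => p.
rewrite ahvalB ahval_A hxf -rmorphB; apply/vge_cemb; rewrite /f.
case: ifPn => [_|]; first by rewrite subrr; left.
move=> h; rewrite key; last 2 first.
- exact: (svalP p).
- have [->|a0] := eqVneq (Aval a) 0; first by left.
  right; move: h; rewrite a0 /=; have := vgeE a0 (AregP a (svalP p)).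
  by case: (sval p (Aval a)) => // -[|].
by apply: vgeB; [exact: vge0_1 | exact: AregP (svalP p)].
Qed.

End Reduction.

(** * Determinants of integral matrices *)

Section DiagonalUnit.
Variables (R : comPzRingType) (r : nat) (i0 : 'I_r).

(** Diagonal matrices with a single entry other than 1 realize all
    determinants. *)
Definition diag1 (x : R) : 'M[R]_r := diag_mx (\row_j if j == i0 then x else 1).

Lemma diag1M x y : diag1 x *m diag1 y = diag1 (x * y).
Proof.
rewrite mulmx_diag; congr diag_mx; apply/rowP => j; rewrite !mxE.
by case: eqP => // _; rewrite mulr1.
Qed.

Lemma diag1_1 : diag1 1 = 1%:M.
Proof.
rewrite -diag_const_mx; congr diag_mx; apply/rowP => j; rewrite !mxE.
by case: eqP.
Qed.

Lemma det_diag1 x : \det (diag1 x) = x.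
Proof.
rewrite det_diag (bigD1 i0) //= mxE eqxx big1 ?mulr1 // => j ji.
by rewrite mxE (negPf ji).
Qed.

Lemma diag1_unit (u : unit_of R) : exists g : GL r R,
  uval g = diag1 (uval u) /\ det_GL g = u.
Proof.
have h1 : (diag1 (uval u) : 'M_r) * diag1 (uinv u) = 1.
  by rewrite [LHS]diag1M uvalK diag1_1.
have h2 : (diag1 (uinv u) : 'M_r) * diag1 (uval u) = 1.
  by rewrite [LHS]diag1M uinvK diag1_1.
by exists (UnitOf h1 h2); split=> //; apply: unit_inj; rewrite /= det_diag1.
Qed.

End DiagonalUnit.

Lemma det_KN_onto (F : fieldType) (infty : place F) (Fv : forall v : place F, completion v)
  (N : idealr (Aring infty)) r (r_gt0 : (0 < r)%N) (x : unit_of (Ahat infty Fv)) :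
  NAhat N (uval x - 1) -> exists2 g : GL r (Ahat infty Fv), KN N g & det_GL g = x.
Proof.
move=> hx; have [g [ge gd]] := diag1_unit (Ordinal r_gt0) x.
exists g => // i j; rewrite /GLmx ge !mxE; case: (i == j); last first.
  by rewrite !mulr0n subr0; exact: NAhat0.
by rewrite !mulr1n; case: eqP => // _; rewrite subrr; exact: NAhat0.
Qed.

(** * Fractional ideals as systems of exponents *)

Section FractionalIdeals.
Variables (k : finFieldType) (F : fieldExtType {fraction {poly k}}).
Hypothesis k_const : is_constant_field F.
Variable infty : place F.
Implicit Types (n m : place F -> int) (s : seq (place F)).

Definition ideal_of n : set F := [set a | forall p, p <> infty -> vge p (n p) a].

Definition supported s n := forall p, p <> infty -> p \notin s -> n p = 0.

(** Approximate powers of uniformizers.  When [s] consists of [infty] alone the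
    approximating element could be 0, and 1 is the answer. *)
Lemma exact_element s n : supported s n -> exists a, [/\ a != 0,
  ideal_of n a & forall p, p \in s -> p <> infty -> p a = n p].
Proof.
move=> hs; have [e|] := boolP (all (pred1 infty) s).
  exists 1; split=> [|p pi|p /(allP e)/= /eqP//]; first exact: oner_neq0.
  rewrite hs //; first exact: vge0_1.
  by apply/negP => /(allP e)/= /eqP.
move=> /allPn[p0 p0s /= /eqP p0i].
have /choice[u hu] (p : place F) : exists x, x != 0 /\ p x = n p.
  have [x x0 px] := pval_norm p; exists (x ^ n p); split; first by rewrite expfz_neq0.
  by rewrite vXz // px mul1r.
pose M := (\sum_(p <- s) `|n p|).+1.
have hM p : p \in s -> n p < M%:Z by move=> ps; rewrite /M (big_rem p) //=; lia.
have [b [hb1 hb2]] := strong_approximation k_const infty s u M.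
have ex p : p \in s -> p <> infty -> b != 0 /\ p b = n p.
  move=> ps pi; have [u0 pu] := hu p; rewrite -{1 2}[b](subrK (u p)) addrC -pu.
  apply: v_dom => //; apply: vgt_ge (hb1 p ps pi); rewrite pu; exact: hM.
exists b; split=> [|p pi|p ps pi]; first exact: (ex p0 p0s p0i).1.
  have [ps|ps] := boolP (p \in s); first by right; rewrite (ex p ps pi).2.
  by rewrite hs //; exact: hb2.
exact: (ex p ps pi).2.
Qed.

Lemma ideal_of_le n m s : supported s n -> ideal_of n `<=` ideal_of m ->
  forall p, p <> infty -> m p <= n p.
Proof.
move=> hs hnm p pi; have hs' : supported (p :: s) n.
  by move=> q qi; rewrite inE negb_or => /andP[_]; exact: hs.
have [a [a0 /hnm ha he]] := exact_element hs'.
by rewrite -(he p) ?mem_head //; apply: vgeE => //; exact: ha.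
Qed.

(** Let [a] and [a'] lie in the first ideal, [a] having the exact exponents at [s],
    [a'] at [s] and at the extra zeros of [a].  Given [c] in the right hand side,
    choose [b] so close to [c / a'] at all these places that [a] divides
    [c - a' * b]. *)
Lemma ideal_of_mul s n m : supported s n -> supported s m ->
  fid_mul (ideal_of n) (ideal_of m) = ideal_of (fun p => n p + m p).
Proof.
move=> hn hm; apply/seteqP; split=> [x [l [a [b [hab ->]]]] p pi|c hc].
  by apply: vge_sum => i _; have [ha hb] := hab i; apply: vgeM; [exact: ha | exact: hb].
have [a [a0 ha _]] := exact_element hn.
have [s' hs'] := finite_set_seq (finite_nonunits a0).
pose s1 := s ++ s'.
have n1 : supported s1 n by move=> p pi; rewrite mem_cat negb_or => /andP[h _]; exact: hn.
have m1 : supported s1 m by move=> p pi; rewrite mem_cat negb_or => /andP[h _]; exact: hm.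
have a1 : supported s1 (fun p => p a).
  move=> p pi; rewrite mem_cat negb_or => /andP[_ h].
  by apply/eqP; apply: contraNT h => h; apply/hs'.
have [a' [a'0 ha' he]] := exact_element n1.
pose M := (\sum_(p <- s1) (`|m p| + `|(p a + m p - n p)%R|))%N.
have hM p : p \in s1 -> m p <= M%:Z /\ p a + m p <= n p + M%:Z.
  by move=> ps; rewrite /M (big_rem p) //=; lia.
have [b [hb1 hb2]] := strong_approximation k_const infty s1 (fun=> c / a') M.
have mb : ideal_of m b.
  move=> p pi; have [ps|ps] := boolP (p \in s1); last by rewrite m1 //; exact: hb2.
  rewrite -[b](subrK (c / a')); apply: vgeD.
    by apply: vge_le (hb1 p ps pi); exact: (hM p ps).1.
  have -> : m p = (n p + m p) + (- n p) by lia.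
  by apply: vgeM; [exact: hc | right; rewrite vV // he].
have mb' : ideal_of m ((c - a' * b) / a).
  move=> p pi; have -> : m p = (p a + m p) + (- p a) by lia.
  apply: vgeM; last by right; rewrite vV.
  have [ps|ps] := boolP (p \in s1).
    have -> : c - a' * b = - (a' * (b - c / a')).
      by rewrite mulrBr [a' * (_ / _)]mulrC divfK // opprB.
    apply: vgeN; apply: vge_le (hM p ps).2 _; apply: vgeM; last exact: hb1.
    exact: ha'.
  have := hc p pi; rewrite (a1 p) // n1 // m1 // => c0; apply: vgeB => //.
  by apply: vge0M; [have := ha' p pi; rewrite n1 | exact: hb2].
exists 2%N, (fun i => if i == ord0 then a' else a),
  (fun i => if i == ord0 then b else (c - a' * b) / a).
split=> [i|]; first by case: ifP.
rewrite 2!big_ord_recl big_ord0 addr0 /= [a * _]mulrC divfK //.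
by rewrite addrC subrK.
Qed.

Lemma fid_oneE : fid_one infty = ideal_of (fun=> 0).
Proof. by apply/seteqP; split=> x; [move=> /asboolP | move=> h; apply/asboolP]. Qed.

Definition delta (q p : place F) : int := (p == q)%:Z.

Lemma supported_delta q (c : int) : supported [:: q] (fun p => c * delta q p).
Proof. by move=> p _; rewrite inE /delta => /negPf->; rewrite mulr0. Qed.

Lemma fprimeE (p : fplace infty) : fprime p = ideal_of (delta (sval p)).
Proof.
apply/seteqP; split=> [x [/asboolP hx px] q qi|x hx].
  by rewrite /delta; case: eqP => [->|_] //; exact: hx.
split; last by have := hx (sval p) (svalP p); rewrite /delta eqxx.
apply/asboolP => q qi; have := hx q qi; apply: vge_le; rewrite /delta.
by case: eqP.
Qed.

Lemma fid_invE q : fid_inv infty (ideal_of (delta q)) = ideal_of (fun p => - delta q p).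
Proof.
apply/seteqP; split=> [x hx p pi|x hx y hy]; last first.
  apply/asboolP => p pi; rewrite -(addNr (delta q p)).
  by apply: vgeM; [exact: hx | exact: hy].
have [->|x0] := eqVneq x 0; first by left.
have sd : supported [:: p; q] (delta q).
  by move=> p' _; rewrite !inE /delta negb_or => /andP[_ /negPf->].
have [y [y0 hy he]] := exact_element sd.
have /asboolP/(_ p pi) := hx y hy; have xy0 : x * y != 0 by rewrite mulf_neq0.
move=> /(vgeE xy0); rewrite vM // he ?mem_head // => h; right; lia.
Qed.

Lemma fid_powE (p : fplace infty) (c : int) :
  fid_pow infty (fprime p) c = ideal_of (fun q => c * delta (sval p) q).
Proof.
have W (e : int) (I : set F) l : I = ideal_of (fun q => e * delta (sval p) q) ->
    iter l (fid_mul I) (fid_one infty) = ideal_of (fun q => (l%:Z * e) * delta (sval p) q).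
  move=> hI; elim: l => [|l IH].
    by rewrite /= fid_oneE; congr ideal_of; apply/funext => q; rewrite !mul0r.
  rewrite iterS IH hI (@ideal_of_mul [:: sval p]); try exact: supported_delta.
  by congr ideal_of; apply/funext => q; rewrite -mulrDl -[l.+1]add1n PoszD; congr (_ * _); ring.
case: c => l; rewrite /fid_pow.
  rewrite (W 1); last by rewrite fprimeE; congr ideal_of; apply/funext => q; rewrite mul1r.
  by congr ideal_of; apply/funext => q; rewrite mulr1.
rewrite (W (-1)); last first.
  by rewrite fprimeE fid_invE; congr ideal_of; apply/funext => q; rewrite mulN1r.
by congr ideal_of; apply/funext => q; rewrite NegzE mulrN1.
Qed.

Variable Fv : forall v : place F, completion v.
Local Notation vp p := (cval (Fv (sval p))).

Lemma adval_unit (x : idele infty Fv) p :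
  advalR infty Fv (uval x) p * advalR infty Fv (uinv x) p = 1.
Proof.
have e : advalR infty Fv (uval x) * advalR infty Fv (uinv x) = 1.
  by rewrite -rmorphM uvalK rmorph1.
exact: (congr1 (fun z : fullprod _ => z p) e).
Qed.

Lemma idele_val_finite (x : idele infty Fv) :
  finite_set [set p : fplace infty | idele_val x p != 0].
Proof.
have /asboolP h1 := advalP (uval x); have /asboolP h2 := advalP (uinv x).
have hU : finite_set ([set p : fplace infty | ~ integral_at p (adval (uval x))] `|`
    [set p | ~ integral_at p (adval (uinv x))]).
  by rewrite finite_setU.
apply: sub_finite_set hU => p /= px.
apply: contrapT => /not_orP[/contrapT i1 /contrapT i2]; move/eqP: px; apply.
have e := adval_unit x p.
have [x0 y0] : advalR infty Fv (uval x) p != 0 /\ advalR infty Fv (uinv x) p != 0.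
  by apply/andP; rewrite -negb_or -mulf_eq0 e oner_eq0.
have := congr1 (vp p) e; rewrite vM // v_1.
have := vgeE x0 i1; have := vgeE y0 i2; rewrite /idele_val.
move: (vp p _) (vp p _) => a b; lia.
Qed.

(** The exponents of an idele, extended by 0 to [infty]. *)
Definition idele_exp (x : idele infty Fv) (p : place F) : int :=
  if pselect (p <> infty) is left h then idele_val x (exist _ p h) else 0.

Lemma idele_expE x (p : fplace infty) : idele_exp x (sval p) = idele_val x p.
Proof.
case: p => p pi /=; rewrite /idele_exp; case: pselect => // h.
by congr idele_val; congr exist; exact: Prop_irrelevance.
Qed.

Lemma fplace_inj (p q : fplace infty) : sval p = sval q -> p = q.
Proof. by case: p q => [p hp] [q hq] /= e; subst q; congr exist; exact: Prop_irrelevance. Qed.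

(** [sval] at a type with decidable equality. *)
Definition fplace_val (p : fplace infty) : place F := sval p.

(** The big product runs over the places where the factor differs from the unit
    ideal; by [ideal_of_le] these are exactly the places where the idele has a
    nonzero valuation. *)
Lemma idele_idealE x : idele_ideal x = ideal_of (idele_exp x).
Proof.
rewrite /idele_ideal.
set f := fun p => fid_pow infty (fprime p) (idele_val x p).
pose t := finite_support (fid_one infty) [set: fplace infty] f.
rewrite -[LHS]/(\big[@fid_mul F/fid_one infty]_(p <- t) f p).
have tP (p : fplace infty) : p \in t = (f p != fid_one infty).
  have fin : finite_set ([set: fplace infty] `&` f @^-1` [set~ fid_one infty]).
    apply: sub_finite_set (idele_val_finite x) => p' [_ /= h].
    apply: contra_notN h => /eqP e; rewrite /f fid_powE e fid_oneE.
    by congr ideal_of; apply/funext => q; rewrite mul0r.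
  rewrite /t in_finite_support //.
  by apply/idP/idP => [/set_mem[_ /= /eqP]//|/eqP h]; apply/mem_set.
have t0 (p : fplace infty) : p \notin t -> idele_val x p = 0.
  rewrite tP negbK => /eqP; rewrite /f fid_powE fid_oneE => e.
  have s0 : supported [:: sval p] (fun=> 0) by [].
  have sub1 := @ideal_of_le _ (fun=> 0) _
    (@supported_delta (sval p) (idele_val x p)).
  have sub2 := @ideal_of_le (fun=> 0) (fun q => idele_val x p * delta (sval p) q) _ s0.
  apply/eqP; rewrite eq_le; apply/andP; split.
    by have := sub2 _ (sval p) (svalP p); rewrite e /delta eqxx mulr1; apply.
  by have := sub1 _ (sval p) (svalP p); rewrite e /delta eqxx mulr1; apply.
have -> : \big[@fid_mul F/fid_one infty]_(p <- t) f p
    = ideal_of (fun q => \sum_(p <- t) idele_val x p * delta (sval p) q).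
  elim: (t) => [|p t' IH].
    by rewrite big_nil fid_oneE; congr ideal_of; apply/funext => q; rewrite big_nil.
  rewrite big_cons IH /f fid_powE (@ideal_of_mul (sval p :: [seq fplace_val p | p <- t'])).
  - by congr ideal_of; apply/funext => q; rewrite big_cons.
  - move=> q qi; rewrite inE negb_or => /andP[h _].
    by apply: (@supported_delta (sval p) _ q qi); rewrite inE.
  - move=> q qi; rewrite inE negb_or => /andP[_ h]; apply: big1_seq => p' /andP[_ pt].
    by rewrite /delta; case: eqP => [e|]; rewrite ?mulr0 //; case/mapP: h; exists p'.
have sE q : q <> infty -> \sum_(p <- t) idele_val x p * delta (sval p) q = idele_exp x q.
  move=> qi; pose q' : fplace infty := exist _ q qi.
  rewrite (idele_expE x q'); have [qt|qt] := boolP (q' \in t).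
    rewrite (bigD1_seq q') ?finite_support_uniq //= /delta eqxx mulr1 big1 ?addr0 // => p /eqP pq.
    by case: eqP => [e|]; rewrite ?mulr0 //; case: pq; exact: fplace_inj.
  rewrite (t0 _ qt); apply: big1_seq => p /andP[_ pt].
  rewrite /delta; case: eqP => [e|]; rewrite ?mulr0 //.
  by move: qt; rewrite (_ : q' = p) ?pt //; exact: fplace_inj.
by apply/seteqP; split=> a ha q qi; have := ha q qi; rewrite sE.
Qed.

Lemma fid_mul_principal (f : F) n : f != 0 ->
  fid_mul (fprincipal infty f) (ideal_of n) = ideal_of (fun p => p f + n p).
Proof.
move=> f0; apply/seteqP; split=> [x [l [a [b [hab ->]]]] p pi|x hx].
  apply: vge_sum => i _; have [[c /asboolP hc <-] hb] := hab i.
  rewrite -mulrA; apply: vgeM; first exact: vge_v.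
  by apply: vgeMl; [exact: hc | exact: hb].
exists 1%N, (fun=> f), (fun=> x / f); split=> [_|]; last by rewrite big_ord1 mulrC divfK.
split; first by exists 1; rewrite ?mulr1 //; apply/asboolP => p _; exact: vge0_1.
move=> p pi; rewrite -[n p](addrK (p f)) [n p + _]addrC.
by apply: vgeM; [exact: hx | right; rewrite vV].
Qed.

Lemma ideal_class_idele (x y : idele infty Fv) (f : F) : f != 0 ->
  (forall p : fplace infty, idele_val y p = sval p f + idele_val x p) ->
  ideal_class infty (idele_ideal y) = ideal_class infty (idele_ideal x).
Proof.
move=> f0 hv.
have e : idele_ideal y = fid_mul (fprincipal infty f) (idele_ideal x).
  rewrite !idele_idealE fid_mul_principal //; apply/seteqP.
  by split=> a ha p pi; have := ha p pi;
    rewrite !(idele_expE _ (exist _ p pi)) hv.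
have mulE g h n : g != 0 -> h != 0 -> fid_mul (fprincipal infty g)
    (fid_mul (fprincipal infty h) (ideal_of n)) = fid_mul (fprincipal infty (g * h)) (ideal_of n).
  move=> g0 h0; rewrite !fid_mul_principal ?mulf_neq0 //; congr ideal_of; apply/funext => p.
  by rewrite vM // addrA.
rewrite {}e idele_idealE; apply/seteqP; split=> J [g g0 ->].
  by exists (g * f); rewrite ?mulf_neq0 // mulE.
exists (g / f); first by rewrite mulf_neq0 ?invr_eq0.
by rewrite mulE ?mulf_neq0 ?invr_eq0 // divfK.
Qed.

End FractionalIdeals.

(** * Nonemptiness of the period domain *)

Section PeriodDomain.
Variables (F : fieldType) (infty : place F) (Fi : completion infty).
Variables (C : completed_closure (cval Fi)) (r : nat).
Hypothesis r_gt0 : (0 < r)%N.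

(** The powers [1, y, ..., y ^ (r - 1)] of an [r]-th root [y] of a uniformizer are
    linearly independent: their valuations are distinct modulo the integers, so in
    a linear combination one term strictly dominates. *)
Lemma Psi_nonempty : inhabited (Psi C r).
Proof.
have [u u0 pu] := pval_norm infty.
set L := cc_closure C; pose v := cc_val C.
pose x : L := acemb L (cemb Fi u).
have [y hy] := ac_closed (a := L) (fun i => if i == 0%N then x else 0) r_gt0.
have yr : y ^+ r = x.
  rewrite hy; case: (r) r_gt0 => // n _; rewrite big_ord_recl /= mulr1 big1 ?addr0 // => i _.
  by rewrite mul0r.
have x0 : x != 0 by rewrite !fmorph_eq0.
have vx : v x = 1 by rewrite /v /x cc_val_ext cval_ext pu.
have y0 : y != 0.
  by apply: contraNneq x0 => e; rewrite -yr e expr0n -[r]prednK.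
have vy : v y *+ r = 1 by rewrite -vX // yr vx.
pose psi : 'rV[C]_r := \row_j cemb (cc_field C) (y ^+ j).
suff h : psi \in @Psi_pred _ _ _ C r by constructor; exact: (MkPsi h).
apply/asboolP => a; rewrite mulmx_sum_row => e.
pose t (j : 'I_r) : L := acemb L (a j 0) * y ^+ j.
have {}e : \sum_j t j = 0.
  apply: (fmorph_inj (cemb (cc_field C))); rewrite rmorph0 raddf_sum /=.
  move/matrixP/(_ 0 0): e; rewrite summxE mxE => e; rewrite -[RHS]e; apply: eq_bigr => j _.
  by rewrite /t rmorphM mulrC /psi !mxE.
apply: contrapT => /eqP/matrix0Pn[j0 [z]]; rewrite ord1 => aj0 {z}.
(* r times the valuation of the j-th term *)
pose f (j : 'I_r) : int := cval Fi (a j 0) * r%:Z + j%:Z.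
case: (@arg_minP _ _ _ j0 (fun j => a j 0 != 0) f aj0) => j aj hj.
have t0 i : a i 0 != 0 -> t i != 0 by move=> ai; rewrite mulf_neq0 ?fmorph_eq0 ?expf_neq0.
have vt i : a i 0 != 0 -> v (t i) *+ r = (f i)%:~R.
  move=> ai; rewrite /t vM ?fmorph_eq0 ?expf_neq0 // vX // /v cc_val_ext mulrnDl -mulrnA.
  by rewrite mulnC mulrnA vy /f rmorphD rmorphM /= !pmulrn mulrzr.
have [|h _] := @sum_dom _ _ v _ t j (t0 _ aj); last by rewrite e eqxx in h.
move=> i ij; have [ai|ai] := eqVneq (a i 0) 0; first by left; rewrite /t ai rmorph0 mul0r.
right; rewrite -(ltr_pMn2r r_gt0) !vt // ltr_int lt_neqAle hj // andbT.
apply: contra ij => /eqP; rewrite /f => fe; apply/eqP/val_inj => /=.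
have := ltn_ord i; have := ltn_ord j; move: fe; move: (cval Fi _) (cval Fi _) => b c.
move=> fe lj li.
have bc : b = c by nia.
lia.
Qed.

End PeriodDomain.

(** * Classes of integral units *)

Section IdeleClasses.
Variables (k : finFieldType) (F : fieldExtType {fraction {poly k}}).
Hypothesis k_const : is_constant_field F.
Variables (infty : place F) (Fv : forall v : place F, completion v).
Local Notation A := (Aring infty).
Local Notation Ahat := (Ahat infty Fv).
Local Notation vp p := (cval (Fv (sval p))).
Variable N : idealr A.
Hypothesis N_neq0 : exists2 a : A, a \in (N : {pred A}) & a != 0.
Variable r : nat.
Hypothesis r_gt0 : (0 < r)%N.

Local Notation incl := (unit_map (Ahat_to_adele infty Fv)).
Local Notation cls := (icl (Fv := Fv) N r).
Local Notation is_const :=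
  (fun x : {ideal_quot N} =>
     exists2 c : k, c != 0 & x = \pi_{ideal_quot N} (constA infty c)).

Lemma cls_eqP (x y : idele infty Fv) : cls x = cls y -> exists f : unit_of F,
  exists2 g : GL r Ahat, KN N g &
  forall p, advalR infty Fv (uval y) p
    = cemb (Fv (sval p)) (uval f)
      * (advalR infty Fv (uval x) p * Defs.ahval (uval (det_GL g)) p).
Proof.
move=> /eqmodP/asboolP[f [g hg e]]; exists f, g => // p.
move/(congr1 (fun w => uval w)): e; rewrite uvalM !uval_map uvalM uval_map.
move=> /(congr1 (fun z => z p)); rewrite fullprodM diagF_at adval_mul adval_Ahat.
exact.
Qed.

Lemma reduce_inv (x : unit_of Ahat) : is_const (reduce N (uval x)) ->
  is_const (reduce N (uval x^-1%g)).
Proof.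
move=> [c c0 e]; exists c^-1; first by rewrite invr_eq0.
have h : reduce N (uval x^-1%g) * reduce N (uval x) = 1.
  by rewrite -!(reduceRE k_const N_neq0) -rmorphM (uinvK x) rmorph1.
rewrite -[RHS]mul1r -h -mulrA e -rmorphM.
rewrite (_ : constA _ c * _ = 1) ?rmorph1 ?mulr1 //.
by apply: Aval_inj; rewrite AvalM Aval1 /= -constM mulfV // const1.
Qed.

(** If [u] is principal modulo [det K(N)], the principal factor has valuation 0 at
    every finite place, so it or its inverse is regular everywhere, hence it is a
    constant.  Conversely, dividing [u] by the constant makes it congruent to 1,
    hence a determinant from [K(N)]. *)
Lemma cls_unit_trivial (u : unit_of Ahat) :
  cls (incl u) = 1%g <-> is_const (reduce N (uval u)).
Proof.
split=> [/esym/cls_eqP[f [g hg e]]|[c c0 e]].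
  have f0 : uval f != 0.
    by apply/negP => /eqP f0; have := uvalK f; rewrite f0 mul0r => /esym/eqP; rewrite oner_eq0.
  have {}e p : Defs.ahval (uval u) p
      = cemb (Fv (sval p)) (uval f) * Defs.ahval (uval (det_GL g)) p.
    rewrite (e p : Defs.ahval (uval u) p = _); congr (_ * _).
    rewrite (_ : advalR infty Fv (uval 1%g) p = 1) ?mul1r //.
  have pf p : p <> infty -> p (uval f) = 0.
    move=> pi; have [g0 vg] := Ahat_unit_val (det_GL g) (exist _ p pi).
    have [u0 vu] := Ahat_unit_val u (exist _ p pi).
    move: vu; rewrite e vM ?fmorph_eq0 //.
    by rewrite [X in X + _](cval_ext (Fv p)) [X in _ + X]vg addr0.
  have [c fc] : exists c, uval f = constF F c.
    have [fi|fi] := leP 0 (infty (uval f)).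
      apply: (regular_everywhere k_const) => p; right.
      by have [->|/eqP pi] := eqVneq p infty; [|rewrite pf].
    have [c ec] : exists c, (uval f)^-1 = constF F c.
      apply: (regular_everywhere k_const) => p; right; rewrite vV // oppr_ge0.
      by have [->|/eqP pi] := eqVneq p infty; [exact: ltW |rewrite pf].
    by exists c^-1; rewrite -[uval f]invrK ec fmorphV.
  have c0 : c != 0 by rewrite -(constF_eq0 F) -fc.
  exists c => //; have -> : uval u = A_to_Ahat Fv (constA infty c) * uval (det_GL g).
    by apply: ahval_inj => p; rewrite ahvalM e ahval_A fc.
  rewrite -(reduceRE k_const N_neq0) rmorphM !reduceRE (reduce_A k_const Fv N_neq0).
  have -> : reduce N (uval (det_GL g)) = reduce N (1 : Ahat).
    by apply/(reduce_eq k_const N_neq0); exact: KN_det.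
  by rewrite -(reduceRE k_const N_neq0) rmorph1 mulr1.
have cK : A_to_Ahat Fv (constA infty c) * A_to_Ahat Fv (constA infty c^-1) = 1.
  apply: ahval_inj => p; rewrite ahvalM ahval1 !ahval_A -rmorphM /= -constM mulfV //.
  by rewrite const1 rmorph1.
have Kc : A_to_Ahat Fv (constA infty c^-1) * A_to_Ahat Fv (constA infty c) = 1.
  by rewrite mulrC.
pose w := (UnitOf Kc cK * u)%g.
have hw : NAhat N (uval w - 1).
  apply/(reduce_eq k_const N_neq0).
  rewrite (_ : uval w = A_to_Ahat Fv (constA infty c^-1) * uval u) //.
  rewrite -!(reduceRE k_const N_neq0) rmorphM !reduceRE e.
  rewrite (reduce_A k_const Fv N_neq0) -rmorphM.
  rewrite (_ : _ * _ = 1).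
    by rewrite -(reduceRE k_const N_neq0) !rmorph1.
  by apply: Aval_inj; rewrite AvalM Aval1 /= -constM mulVf // const1.
have [g hg gw] := det_KN_onto r_gt0 hw.
apply/esym/eqmodP/asboolP.
have fc : constF F c * constF F c^-1 = 1 by rewrite -constM mulfV // const1.
have cf : constF F c^-1 * constF F c = 1 by rewrite -constM mulVf // const1.
exists (UnitOf fc cf), g => //; rewrite gw; apply: unit_inj.
apply: functional_extensionality_dep => p.
have -> : u = (UnitOf cK Kc * w)%g.
  by rewrite /w; apply: unit_inj; rewrite /= mulrA cK mul1r.
rewrite mul1g uvalM !uval_map fullprodM diagF_at !adval_Ahat uvalM ahvalM ahval_A //.
Qed.

Lemma cls_reduce_eq (x y : unit_of Ahat) : reduce N (uval x) = reduce N (uval y) ->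
  cls (incl x) = cls (incl y).
Proof.
move=> e; have h : cls (incl (y^-1 * x)%g) = 1%g.
  apply/cls_unit_trivial; exists 1; first exact: oner_neq0.
  rewrite (_ : constA _ 1 = 1); last by apply: Aval_inj; rewrite Aval1 /= const1.
  rewrite rmorph1 -(reduceRE k_const N_neq0) uvalM rmorphM !reduceRE e.
  by rewrite -!(reduceRE k_const N_neq0) -rmorphM (uinvK y) rmorph1.
rewrite (_ : x = (y * (y^-1 * x))%g); last by rewrite mulgA mulgV mul1g.
rewrite unit_mapM iclM h.
exact: mulg1.
Qed.

(** Integral units have valuation 0. *)
Lemma ideal_class_unit (x y : idele infty Fv) (u : unit_of Ahat) :
  cls y = (cls x * cls (incl u))%g ->
  ideal_class infty (idele_ideal y) = ideal_class infty (idele_ideal x).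
Proof.
move=> e.
have /cls_eqP[f [g hg {}e]] : cls (x * incl u)%g = cls y by rewrite iclM e.
have f0 : uval f != 0.
  by apply/negP => /eqP f0; have := uvalK f; rewrite f0 mul0r => /esym/eqP; rewrite oner_eq0.
apply: (ideal_class_idele k_const f0) => p.
have {}e := e p; rewrite /idele_val e.
have -> : advalR infty Fv (uval (x * incl u)%g) p
    = advalR infty Fv (uval x) p * Defs.ahval (uval u) p.
  by rewrite uvalM adval_mul uval_map adval_Ahat.
have [u0 vu] := Ahat_unit_val u p; have [g0 vg] := Ahat_unit_val (det_GL g) p.
have x0 : advalR infty Fv (uval x) p != 0.
  by apply/negP => /eqP h; have := adval_unit x p; rewrite h mul0r => /esym/eqP; rewrite oner_eq0.
rewrite !vM ?mulf_neq0 ?fmorph_eq0 //.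
by rewrite vu vg !addr0 cval_ext.
Qed.

End IdeleClasses.

(** * The action on components *)

Section Components.
Variables (k : finFieldType) (F : fieldExtType {fraction {poly k}}).
Hypothesis k_const : is_constant_field F.
Variables (infty : place F) (Fv : forall v : place F, completion v).
Local Notation A := (Aring infty).
Local Notation Ahat := (Ahat infty Fv).
Variable N : idealr A.
Hypothesis N_neq0 : exists2 a : A, a \in (N : {pred A}) & a != 0.
Variable r : nat.
Hypothesis r_gt0 : (0 < r)%N.
Variable S : lset (GL r F).

Local Notation incl := (unit_map (Ahat_to_adele infty Fv)).
Local Notation cls := (icl (Fv := Fv) N r).
Local Notation is_const :=
  (fun x : {ideal_quot N} =>
     exists2 c : k, c != 0 & x = \pi_{ideal_quot N} (constA infty c)).
Local Notation comp := (component Fv N S).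
Local Notation M := (moduli Fv N S).
Implicit Types (gamma delta : GL r Ahat) (C D : comp) (c : M).

(** The factor by which [gamma] translates determinants. *)
Definition shift gamma : idele_class Fv N r := cls (incl (det_GL gamma^-1)%g).

Lemma det_level_act gamma c :
  det_class (level_act gamma c) = (det_class c * shift gamma)%g.
Proof.
rewrite -[c]reprK; case: (repr c) => s g.
by rewrite level_act_pi !det_class_pi det_GLM det_GL_map iclM.
Qed.

Lemma level_actK gamma c : level_act gamma (level_act gamma^-1%g c) = c.
Proof. by rewrite -level_actM mulgV; apply: level_act_KN; exact: KN1. Qed.

Lemma cset_fibre C c : cset C c <-> det_class c = comp_det C.
Proof.
split=> [|e]; first exact: comp_detE.
move: e; rewrite /comp_det; case: cid => c0 /= -> //.
Qed.

Lemma cset_nonempty C : exists c, cset C c.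
Proof. by case: (csetP C) => c e; exists c; rewrite e. Qed.

Lemma component_ext C D : comp_det C = comp_det D -> C = D.
Proof.
move=> e; have {e} : cset C = cset D.
  by apply/seteqP; split=> c /cset_fibre h; apply/cset_fibre; rewrite h e.
case: C D => [X hX] [Y hY] /= e; subst Y; congr Component; exact: Prop_irrelevance.
Qed.

Lemma component_at c : exists C, cset C c.
Proof.
have h : exists c0 : M,
    [set c' : M | det_class c' = det_class c] = [set c' : M | det_class c' = det_class c0].
  by exists c.
by exists (Component h).
Qed.

(** A point over the shifted class is the image of its translate by
    [gamma^-1]. *)
Lemma translate_fibre gamma C c :
  (level_act gamma @` cset C) c <-> det_class c = (comp_det C * shift gamma)%g.
Proof.
split=> [[c0 /cset_fibre e <-]|e]; first by rewrite det_level_act e.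
exists (level_act gamma^-1%g c); last exact: level_actK.
apply/cset_fibre; apply: (mulIg (shift gamma)).
by rewrite -det_level_act level_actK.
Qed.

Lemma translate_component gamma C : exists D,
  cset D = level_act gamma @` cset C /\ comp_det D = (comp_det C * shift gamma)%g.
Proof.
have [c Cc] := cset_nonempty C; have [D Dc] := component_at (level_act gamma c).
have e : comp_det D = (comp_det C * shift gamma)%g.
  by rewrite -(comp_detE Dc) det_level_act (comp_detE Cc).
exists D; split=> //; apply/seteqP; split=> c'.
  by move=> /cset_fibre h; apply/translate_fibre; rewrite h.
by move=> /translate_fibre h; apply/cset_fibre; rewrite h.
Qed.

Lemma translate_eq gamma delta C : shift gamma = shift delta ->
  level_act gamma @` cset C = level_act delta @` cset C.
Proof.
move=> e; apply/seteqP; split=> c /translate_fibre h; apply/translate_fibre.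
  by rewrite -e.
by rewrite e.
Qed.

Lemma translate_id gamma C :
  (level_act gamma @` cset C = cset C) <-> shift gamma = 1%g.
Proof.
split=> [e|e]; last first.
  by apply/seteqP; split=> c; [move=> /translate_fibre h; apply/cset_fibre |
    move=> /cset_fibre h; apply/translate_fibre]; rewrite h e mulg1.
have [c Cc] := cset_nonempty C.
have : (level_act gamma @` cset C) (level_act gamma c) by exists c.
rewrite e => /cset_fibre; rewrite det_level_act (comp_detE Cc) => h.
by apply: (mulgI (comp_det C)); rewrite h mulg1.
Qed.

Lemma shift_reduce_eq gamma delta :
  reduce N (uval (det_GL gamma)) = reduce N (uval (det_GL delta)) ->
  shift gamma = shift delta.
Proof.
move=> e; apply: (cls_reduce_eq k_const N_neq0 r_gt0).
rewrite !det_GLV.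
have unique (a b c : {ideal_quot N}) : a * b = 1 -> a * c = 1 -> b = c.
  by move=> ab ac; rewrite -[c]mul1r -ab mulrAC ac mul1r.
apply: unique (etrans (congr1 (fun z => z * _) (esym e)) (reduce_unitV k_const N_neq0 _))
  (reduce_unitV k_const N_neq0 _).
Qed.

Lemma shift_trivial gamma :
  shift gamma = 1%g <-> is_const (reduce N (uval (det_GL gamma))).
Proof.
rewrite /shift (cls_unit_trivial k_const N_neq0 r_gt0) det_GLV; split.
  by move=> /(reduce_inv k_const N_neq0); rewrite invgK.
exact: (reduce_inv k_const N_neq0).
Qed.

Lemma pi_N_translate C D gamma : comp_det D = (comp_det C * shift gamma)%g ->
  pi_N D = pi_N C.
Proof.
move=> e; apply: (ideal_class_unit k_const (N := N) (r := r) (u := det_GL gamma^-1%g)).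
by rewrite !icl_repr; exact: e.
Qed.

End Components.

Section Action.
Variables (k : finFieldType) (F : fieldExtType {fraction {poly k}}).
Hypothesis k_const : is_constant_field F.
Variables (infty : place F) (Fv : forall v : place F, completion v).
Local Notation A := (Aring infty).
Local Notation Ahat := (Ahat infty Fv).
Variable N : idealr A.
Hypothesis N_neq0 : exists2 a : A, a \in (N : {pred A}) & a != 0.
Variable r : nat.
Hypothesis r_gt0 : (0 < r)%N.
Local Notation AN := {ideal_quot N}.

Lemma det_mod_surjective (u : unit_of AN) :
  exists gamma : GL r Ahat, reduce N (uval (det_GL gamma)) = uval u.
Proof.
have [x hx] := unit_lift k_const Fv N_neq0 u.
by have [g [_ gx]] := diag1_unit (Ordinal r_gt0) x; exists g; rewrite gx.
Qed.

Lemma det_mod_unit (gamma : GL r Ahat) :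
  exists u : unit_of AN, uval u = reduce N (uval (det_GL gamma)).
Proof. by exists (unit_map (reduceR k_const Fv N_neq0) (det_GL gamma)). Qed.

Variable S : lset (GL r F).
Local Notation comp := (component Fv N S).

(** Let [u] act by any [gamma] whose inverse determinant reduces to [u]: the shift
    only depends on [u], and it is multiplicative in [u] as A/N is
    commutative. *)
Lemma action_on_components : exists rho : unit_of AN -> comp -> comp,
  [/\ forall C, rho 1%g C = C,
      forall u v C, rho (u * v)%g C = rho u (rho v C),
      forall (gamma : GL r Ahat) u C, uval u = reduce N (uval (det_GL gamma^-1%g)) ->
        cset (rho u C) = level_act gamma @` cset C
    & forall (gamma : GL r Ahat) u C, uval u = reduce N (uval (det_GL gamma^-1%g)) ->
        comp_det (rho u C) = (comp_det C * shift N gamma)%g].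
Proof.
have /choice[g hg] (u : unit_of AN) : exists gamma : GL r Ahat,
    reduce N (uval (det_GL gamma^-1%g)) = uval u.
  by have [x hx] := det_mod_surjective u; exists x^-1%g; rewrite invgK.
have /choice[rho hrho] (uC : unit_of AN * comp) : exists D : comp,
    cset D = level_act (g uC.1) @` cset uC.2 /\
    comp_det D = (comp_det uC.2 * shift N (g uC.1))%g.
  exact: translate_component.
have shiftE (gamma delta : GL r Ahat) :
    reduce N (uval (det_GL gamma^-1%g)) = reduce N (uval (det_GL delta^-1%g)) ->
    shift N gamma = shift N delta.
  exact: cls_reduce_eq.
exists (fun u C => rho (u, C)); split.
- move=> C; apply: component_ext; rewrite (hrho (_, C)).2 /=.
  rewrite (@shiftE _ 1%g) ?hg; first by rewrite /shift invg1 det_GL1 unit_map1; exact: mulg1.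
  by rewrite invg1 det_GL1 -(reduceRE k_const N_neq0) rmorph1.
- move=> u v C; apply: component_ext; rewrite !(hrho (_, _)).2 /= -mulgA; congr (_ * _)%g.
  rewrite (@shiftE _ (g u * g v)%g).
    by rewrite /shift invgM det_GLM unit_mapM iclM.
  apply: etrans (hg _) _; rewrite invgM det_GLM [uval (u * v)%g]mulrC.
  apply: etrans (esym (reduceM k_const N_neq0 _ _)).
  exact: congr2 (esym (hg _)) (esym (hg _)).
- move=> gamma u C e; rewrite (hrho (u, C)).1; apply: translate_eq.
  by apply: shiftE; rewrite hg.
- move=> gamma u C e; rewrite (hrho (u, C)).2; congr (_ * _)%g.
  by apply: shiftE; rewrite hg.
Qed.

End Action.
Theorem proposition38
    (k : finFieldType) (F : fieldExtType {fraction {poly k}})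
    (k_const : is_constant_field F)
    (infty : place F)
    (Fv : forall v : place F, completion v)
    (C_infty : completed_closure (cval (Fv infty)))
    (r : nat) (r_gt0 : (0 < r)%N)
    (N : idealr (Aring infty))
    (N_neq0 : exists2 a : Aring infty, a \in (N : {pred Aring infty}) & a != 0) :
  let AN : comNzRingType := {ideal_quot N} in
  let G := GL r (Ahat infty Fv) in
  let det_mod (gamma : G) : AN := reduce N (uval (det_GL gamma)) in
  let is_const (x : AN) := exists2 c : k, c != 0 & x = \pi_{ideal_quot N} (constA infty c) in
  let claim (S : lset (GL r F)) :=
    let comp := component Fv N S in
    let translate (gamma : G) (C : comp) := level_act gamma @` cset C in
    [/\ forall (gamma : G) (C : comp), exists D : comp,
          [/\ cset D = translate gamma C,
              comp_det D
              = (comp_det C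
                 * icl N r (unit_map (Ahat_to_adele infty Fv) (det_GL gamma^-1)))%g
            & pi_N D = pi_N C],
        forall gamma delta : G, det_mod gamma = det_mod delta ->
          forall C : comp, translate gamma C = translate delta C,
        forall gamma : G,
          (forall C : comp, translate gamma C = cset C) <-> is_const (det_mod gamma)
      & exists rho : unit_of AN -> comp -> comp,
          [/\ forall C, rho 1%g C = C,
              forall u v C, rho (u * v)%g C = rho u (rho v C),
              forall gamma u C, uval u = det_mod (gamma^-1)%g ->
                cset (rho u C) = translate gamma C,
              forall u, (forall C, rho u C = C) <-> is_const (uval u)
            & forall u C, pi_N (rho u C) = pi_N C]] in
  [/\ forall gamma : G, exists u : unit_of AN, uval u = det_mod gamma,
      forall u : unit_of AN, exists gamma : G, uval u = det_mod gamma,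
      claim (Omega_lset C_infty r)
    & claim (Psi_lset C_infty r)].
Proof.
move=> AN G det_mod is_const claim.
have main (S : lset (GL r F)) (s0 : S) : claim S.
  have [rho [rho1 rhoM rho_set rho_det]] := action_on_components k_const Fv N_neq0 r_gt0 S.
  have [C0 _] := component_at (\pi_(moduli Fv N S) (s0, 1%g)).
  have lift (u : unit_of AN) : exists gamma : G, uval u = det_mod gamma^-1%g.
    have [gamma e] := det_mod_surjective k_const Fv N_neq0 r_gt0 u.
    by exists gamma^-1%g; rewrite /det_mod invgK e.
  have trivE (gamma : G) : (forall C : component Fv N S,
      level_act gamma @` cset C = cset C) <-> is_const (det_mod gamma).
    have st : shift N gamma = 1%g <-> is_const (det_mod gamma) :=
      shift_trivial k_const N_neq0 r_gt0 gamma.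
    split=> [/(_ C0)/translate_id/st //|/st h C].
    exact/translate_id.
  split.
  - move=> gamma C; have [D [e1 e2]] := translate_component gamma C.
    by exists D; split=> //; exact: (pi_N_translate k_const e2).
  - move=> gamma delta e C; apply: translate_eq.
    exact: (shift_reduce_eq k_const N_neq0 r_gt0).
  - exact: trivE.
  exists rho; split=> //.
  - move=> u; have [gamma e] := lift u.
    have e1 : is_const (uval u) <-> is_const (det_mod gamma).
      rewrite e; split=> h; last by rewrite /det_mod det_GLV; exact: reduce_inv.
      rewrite -[gamma]invgK /det_mod det_GLV; exact: (reduce_inv k_const N_neq0 h).
    split=> [h|/e1/trivE h C].
      by apply/e1/trivE => C; rewrite -(rho_set _ _ _ e) h.
    apply: component_ext; rewrite (rho_det _ _ _ e).
    by have /translate_id -> := h C; rewrite mulg1.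
  - move=> u C; have [gamma e] := lift u.
    exact: (pi_N_translate k_const (rho_det _ _ _ e)).
have [psi] := Psi_nonempty C_infty r_gt0.
split.
- exact: det_mod_unit.
- move=> u; have [gamma e] := det_mod_surjective k_const Fv N_neq0 r_gt0 u.
  by exists gamma.
- exact: (main (Omega_lset C_infty r) (\pi_(Omega C_infty r) psi)).
- exact: (main (Psi_lset C_infty r) psi).
Qed.
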